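(* Let $V$ be a $\mathfrak{gl}_4$-module and $v\in V$ a $\mathfrak{gl}_4$-singular vector of weight $(\Lambda^1,\Lambda^2,\Lambda^3,\Lambda^4)$. Let $x\in\mathbb{C}$, let $\xi_1,\xi_2,\xi_3$ be nonnegative integers, $\boldsymbol{\xi}=(\xi_1,\xi_2,\xi_3)$, $\boldsymbol{t}^a=(t^a_1,\dots,t^a_{\xi_a})$ for $a=1,2,3$, and $\boldsymbol{t}=(\boldsymbol{t}^1,\boldsymbol{t}^2,\boldsymbol{t}^3)$. For every triple of integers $(p,q,r)$ with $0\le p\le\min(\xi_2,\xi_3)$, $0\le q\le\min(\xi_2,\xi_1)$, $\max(0,p+q-\xi_2)\le r\le\min(p,q)$, fix two sequences $\boldsymbol{i}=\{i_1<\dots<i_p\}$ and $\boldsymbol{j}=\{j_1<\dots<j_q\}$ of elements of $\{1,\dots,\xi_2\}$ such that $|\{i_1,\dots,i_p\}\cap\{j_1,\dots,j_q\}|=r$ (the sequences depend on $(p,q,r)$). Then: (a) In the evaluation $Y(\mathfrak{gl}_4)$-module $V(x)$, one has $$\mathbb{B}_{\boldsymbol{\xi}}(\boldsymbol{t})v=\prod_{a=1}^{3}\prod_{i=1}^{\xi_a}\frac{1}{t^a_i-x}\ \sum_{p=0}^{\min(\xi_2,\xi_3)}\ \sum_{q=0}^{\min(\xi_2,\xi_1)}\ \sum_{r=\max(0,p+q-\xi_2)}^{\min(p,q)}\overline{\mathrm{Sym}}_{\boldsymbol{t}^1}\overline{\mathrm{Sym}}_{\boldsymbol{t}^2}\overline{\mathrm{Sym}}_{\boldsymbol{t}^3}\,G_{\boldsymbol{i},\boldsymbol{j}}(\boldsymbol{t})\cdot\frac{e_{32}^{\xi_2-p-q+r}e_{31}^{q-r}e_{42}^{p-r}e_{41}^{r}e_{21}^{\xi_1-q}e_{43}^{\xi_3-p}v}{(\xi_2-p-q+r)!\,(q-r)!\,(p-r)!\,r!\,(\xi_1-q)!\,(\xi_3-p)!},$$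 where $$G_{\boldsymbol{i},\boldsymbol{j}}(\boldsymbol{t})=\prod_{a=1}^{p}\Biggl(\frac{t^3_a-x+\Lambda^3}{t^3_a-t^2_{i_a}}\prod_{m=i_a+1}^{\xi_2}\frac{t^3_a-t^2_m+1}{t^3_a-t^2_m}\Biggr)\prod_{s=1}^{q}\Biggl(\frac{t^1_{\xi_1-q+s}-x+\Lambda^2}{t^2_{j_s}-t^1_{\xi_1-q+s}}\prod_{l=1}^{j_s-1}\frac{t^2_l-t^1_{\xi_1-q+s}+1}{t^2_l-t^1_{\xi_1-q+s}}\Biggr).$$ (b) For each $(p,q,r)$, the function $\overline{\mathrm{Sym}}_{\boldsymbol{t}^1}\overline{\mathrm{Sym}}_{\boldsymbol{t}^2}\overline{\mathrm{Sym}}_{\boldsymbol{t}^3}\,G_{\boldsymbol{i},\boldsymbol{j}}(\boldsymbol{t})$ does not depend on the choice of the sequences $\boldsymbol{i}=\{i_1<\dots<i_p\}$ and $\boldsymbol{j}=\{j_1<\dots<j_q\}$ of elements of $\{1,\dots,\xi_2\}$ with $|\{i_1,\dots,i_p\}\cap\{j_1,\dots,j_q\}|=r$.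
   Context: Yangian. $Y(\mathfrak{gl}_n)$ is the unital associative algebra over $\mathbb{C}$ with generators $(T^a_b)^{\{s\}}$, $a,b=1,\dots,n$, $s\ge1$; with $T^a_b(u)=\delta_{ab}+\sum_{s\ge1}(T^a_b)^{\{s\}}u^{-s}$ the defining relations are $(u-w)[T^a_b(u),T^c_d(w)]=T^a_d(u)T^c_b(w)-T^a_d(w)T^c_b(u)$. Let $e_{ab}$ be the standard generators of $\mathfrak{gl}_n$, $[e_{ab},e_{cd}]=e_{ad}\delta_{bc}-e_{cb}\delta_{ad}$. A vector $v$ of a $\mathfrak{gl}_n$-module is singular of weight $(\Lambda^1,\dots,\Lambda^n)$ if $e_{ab}v=0$ for $a<b$ and $e_{aa}v=\Lambda^av$ for all $a$. For a $\mathfrak{gl}_n$-module $V$ and $x\in\mathbb{C}$, the evaluation module $V(x)$ is $V$ with $Y(\mathfrak{gl}_n)$ acting by $T^a_b(u)\mapsto\delta_{ab}+e_{ba}(u-x)^{-1}$. Vector-valued weight function for $n=4$. Entries of operators on $(\mathbb{C}^4)^{\otimes m}$ in the standard basis are labeled by multiindices, upper = row, lower = column. $E_{ab}$ is the matrix unit with $1$ in row $a$, column $b$. The $R$-matrix is $R(u)=1+u^{-1}\sum_{a,b=1}^4E_{ab}\otimes E_{ba}$, i.e. $R^{ab}_{cd}(u)=\delta_{ac}\delta_{bd}+u^{-1}\delta_{ad}\delta_{bc}$. Set $\xi^0=0$, $\xi^a=\xi_1+\dots+\xi_a$. In $\mathrm{End}((\mathbb{C}^4)^{\otimes\xi^3})\otimes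 Y(\mathfrak{gl}_4)$ (with formal series in the variables and rational coefficients), $T^{(m)}(u)=\sum_{a,b}E_{ab}^{(m)}\otimes T^a_b(u)$, where superscripts $(m)$, $(m,m')$ indicate the tensor factors in which an operator acts. Let $\overset{\rightarrow}{\prod}_{1\le i\le k}X_i=X_1\cdots X_k$, $\overset{\leftarrow}{\prod}_{1\le i\le k}X_i=X_k\cdots X_1$, and $$\overset{[j]}{\mathbb{T}}(\boldsymbol{t}^j)=\overset{\rightarrow}{\prod_{1\le k\le\xi_j}}T^{(\xi^{j-1}+k)}(t^j_k),\qquad \overset{[k,j]}{\mathbb{R}}(\boldsymbol{t}^k,\boldsymbol{t}^j)=\overset{\rightarrow}{\prod_{1\le i\le\xi_k}}\Bigl(\overset{\leftarrow}{\prod_{1\le l\le\xi_j}}R^{(\xi^{k-1}+i,\,\xi^{j-1}+l)}(t^k_i-t^j_l)\Bigr).$$ Then $\mathbb{B}_{\boldsymbol{\xi}}(\boldsymbol{t})$ is the entry $$\mathbb{B}_{\boldsymbol{\xi}}(\boldsymbol{t})=\Bigl(\overset{[1]}{\mathbb{T}}(\boldsymbol{t}^1)\overset{[2]}{\mathbb{T}}(\boldsymbol{t}^2)\overset{[3]}{\mathbb{T}}(\boldsymbol{t}^3)\overset{[3,2]}{\mathbb{R}}(\boldsymbol{t}^3,\boldsymbol{t}^2)\overset{[3,1]}{\mathbb{R}}(\boldsymbol{t}^3,\boldsymbol{t}^1)\overset{[2,1]}{\mathbb{R}}(\boldsymbol{t}^2,\boldsymbol{t}^1)\Bigr)^{\boldsymbol{1}^{\xi_1},\boldsymbol{2}^{\xi_2},\boldsymbol{3}^{\xi_3}}_{\boldsymbol{2}^{\xi_1},\boldsymbol{3}^{\xi_2},\boldsymbol{4}^{\xi_3}},$$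 where $\boldsymbol{c}^{m}$ denotes $c$ repeated $m$ times. Symmetrization. For $\boldsymbol{s}=(s_1,\dots,s_m)$ put $Q_m(\boldsymbol{s})=\prod_{1\le i<j\le m}\frac{s_i-s_j-1}{s_i-s_j}$ and $\overline{\mathrm{Sym}}_{\boldsymbol{s}}f(\boldsymbol{s})=\sum_{\sigma\in S_m}f(s_{\sigma(1)},\dots,s_{\sigma(m)})\,Q_m(s_{\sigma(1)},\dots,s_{\sigma(m)})$ (other variables are kept fixed). *)

(* Defs.v *)
From HB Require Import structures.
From mathcomp Require Import all_boot all_order all_algebra perm.
From mathcomp Require Import boolp classical_sets reals complex.

Set Implicit Arguments.
Unset Strict Implicit.
Unset Printing Implicit Defensive.

Import GRing.Theory.
Local Open Scope ring_scope.

Section Endomorphisms.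
Variables (K : fieldType) (V : lmodType K).

(* The K-algebra End(V), with composition as product.  It may be the zero
   ring, hence a pzRingType together with an lmodType, and not an algType. *)
Definition endo := {linear V -> V}.

Implicit Types f g h : endo.

HB.instance Definition _ := gen_eqMixin endo.
HB.instance Definition _ := gen_choiceMixin endo.

Lemma endoP f g : (f : V -> V) =1 (g : V -> V) -> f = g.
Proof.
case: f g => [f [[fB] [fZ]]] [g [[gB] [gZ]]] /= fg.
have efg : f = g by apply: funext.
by case: g / efg gB gZ {fg} => gB gZ; congr GRing.Linear.Pack;
  congr GRing.Linear.Class; [congr GRing.isNmodMorphism.Axioms_ |
  congr GRing.isScalable.Axioms_]; apply: Prop_irrelevance.
Qed.

Definition endo_zero : endo := \0.
Definition endo_opp f : endo := \- f.
Definition endo_add f g : endo := f \+ g.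
Definition endo_one : endo := idfun.
Definition endo_mul f g : endo := f \o g.
Definition endo_scale (a : K) f : endo := a \*: f.

Lemma endo_addA : associative endo_add.
Proof. by move=> f g h; apply: endoP => v /=; rewrite addrA. Qed.

Lemma endo_addC : commutative endo_add.
Proof. by move=> f g; apply: endoP => v /=; rewrite addrC. Qed.

Lemma endo_add0 : left_id endo_zero endo_add.
Proof. by move=> f; apply: endoP => v /=; rewrite add0r. Qed.

Lemma endo_addN : left_inverse endo_zero endo_opp endo_add.
Proof. by move=> f; apply: endoP => v /=; rewrite addNr. Qed.

HB.instance Definition _ :=
  GRing.isZmodule.Build endo endo_addA endo_addC endo_add0 endo_addN.

Lemma endo_mulA : associative endo_mul.
Proof. by move=> f g h; apply: endoP. Qed.

Lemma endo_mul1l : left_id endo_one endo_mul.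
Proof. by move=> f; apply: endoP. Qed.

Lemma endo_mul1r : right_id endo_one endo_mul.
Proof. by move=> f; apply: endoP. Qed.

Lemma endo_mulDl : left_distributive endo_mul +%R.
Proof. by move=> f g h; apply: endoP. Qed.

Lemma endo_mulDr : right_distributive endo_mul +%R.
Proof. by move=> f g h; apply: endoP => v; apply: linearD. Qed.

HB.instance Definition _ := GRing.Zmodule_isPzRing.Build endo
  endo_mulA endo_mul1l endo_mul1r endo_mulDl endo_mulDr.

Lemma endo_scaleA (a b : K) f :
  endo_scale a (endo_scale b f) = endo_scale (a * b) f.
Proof. by apply: endoP => v /=; rewrite scalerA. Qed.

Lemma endo_scale1 : left_id 1 endo_scale.
Proof. by move=> f; apply: endoP => v /=; rewrite scale1r. Qed.

Lemma endo_scaleDr : right_distributive endo_scale +%R.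
Proof. by move=> a f g; apply: endoP => v; apply: scalerDr. Qed.

Lemma endo_scaleDl f : {morph endo_scale^~ f : a b / a + b}.
Proof. by move=> a b; apply: endoP => v; apply: scalerDl. Qed.

HB.instance Definition _ := GRing.Zmodule_isLmodule.Build K endo
  endo_scaleA endo_scale1 endo_scaleDr endo_scaleDl.

Lemma endo0E v : (0 : endo) v = 0. Proof. by []. Qed.
Lemma endo1E v : (1 : endo) v = v. Proof. by []. Qed.
Lemma endoDE f g v : (f + g : endo) v = f v + g v. Proof. by []. Qed.
Lemma endoNE f v : (- f : endo) v = - f v. Proof. by []. Qed.
Lemma endoME f g v : (f * g : endo) v = f (g v). Proof. by []. Qed.
Lemma endoZE (a : K) f v : (a *: f : endo) v = a *: f v. Proof. by []. Qed.

End Endomorphisms.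

#[global] Opaque endo_zero endo_opp endo_add endo_one endo_mul endo_scale.

Section EndomorphismTheory.
Variables (K : fieldType) (V : lmodType K).
Implicit Types f g : endo V.

Lemma endo_sumE I (r : seq I) (P : pred I) (F : I -> endo V) v :
  (\sum_(i <- r | P i) F i : endo V) v = \sum_(i <- r | P i) F i v.
Proof. by elim/big_rec2: _ => [|i y z _ <-]; rewrite (endo0E, endoDE). Qed.

Lemma endo_scalerAl (a : K) f g : a *: (f * g) = (a *: f) * g.
Proof. by apply: endoP => v; rewrite !(endoZE, endoME). Qed.

Lemma endo_scalerAr (a : K) f g : a *: (f * g) = f * (a *: g).
Proof. by apply: endoP => v; rewrite !(endoZE, endoME) linearZ. Qed.

End EndomorphismTheory.

Section Modules.
Variables (K : fieldType) (n : nat) (V : lmodType K).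

Definition gl_relations (e : 'I_n -> 'I_n -> endo V) :=
  forall a b c d,
    e a b * e c d - e c d * e a b = e a d *+ (b == c) - e c b *+ (a == d).

Record gl_module := GlModule {
  gl_op :> 'I_n -> 'I_n -> endo V;
  gl_opP : gl_relations gl_op }.

Definition singular (e : gl_module) (Lam : 'I_n -> K) (v : V) :=
  (forall a b : 'I_n, (a < b)%N -> e a b v = 0) /\
  (forall a : 'I_n, e a a v = Lam a *: v).

(* T a b s stands for the operator (T^a_b)^{s} when s >= 1, and T a b 0 for
   the constant term delta_ab of the series T^a_b(u).  The last condition is
   the equality of the coefficients of u^-r w^-s in
     (u - w) [T^a_b(u), T^c_d(w)] = T^a_d(u) T^c_b(w) - T^a_d(w) T^c_b(u)
   for r, s >= 0; for r = -1 or s = -1, it holds because T a b 0 is central. *)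
Definition yangian_relations (T : 'I_n -> 'I_n -> nat -> endo V) :=
  (forall a b, T a b 0%N = (a == b)%:R) /\
  (forall a b c d r s,
     (T a b r.+1 * T c d s - T c d s * T a b r.+1)
     - (T a b r * T c d s.+1 - T c d s.+1 * T a b r)
     = T a d r * T c b s - T a d s * T c b r).

(* A Y(gl_n)-module structure on V, i.e. an algebra morphism from Y(gl_n) to
   End(V); as Y(gl_n) is given by generators and relations, this is the same
   as a family of operators on V that satisfies the relations. *)
Record yangian_module := YangianModule {
  yangian_op :> 'I_n -> 'I_n -> nat -> endo V;
  yangian_opP : yangian_relations yangian_op }.

Section Evaluation.
Variables (e : gl_module) (x : K).

(* The coefficients of delta_ab + e_ba (u - x)^-1, expanded in powers of
   u^-1. *)
Definition eval_op (a b : 'I_n) (s : nat) : endo V :=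
  if s is s'.+1 then x ^+ s' *: e b a else (a == b)%:R.

Lemma eval_opP : yangian_relations eval_op.
Proof.
have crossZ (k l : K) (f g : endo V) : (k *: f) * (l *: g) = (k * l) *: (f * g).
  by rewrite -endo_scalerAl -endo_scalerAr scalerA.
split=> // a b c d r s.
have natl (f : endo V) (k : nat) : k%:R * f = f *+ k by rewrite mulr_natl.
have natr (f : endo V) (k : nat) : f * k%:R = f *+ k by rewrite mulr_natr.
have eC (k : K) : k *: (e b a * e d c) - k *: (e d c * e b a)
    = (k *: e b c) *+ (a == d) - (k *: e d a) *+ (c == b).
  by rewrite -scalerBr (gl_opP e) scalerBr -!scalerMnr (eq_sym b).
case: r s => [|r] [|s] /=.
- by rewrite !natl !natr !subrr.
- by rewrite !natl !natr subrr subr0 !crossZ mul1r mulr1 eC.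
- by rewrite !natl !natr subrr sub0r !crossZ mul1r mulr1 eC opprB.
- rewrite !crossZ ![x ^+ _.+1 * _]mulrC !exprSr !mulrA.
  by rewrite ![x ^+ s * _]mulrC !subrr.
Qed.

Definition eval_module : yangian_module := YangianModule eval_opP.

End Evaluation.

(* The formal series S(w) = sum_s S_s w^-s is a rational function of w without
   pole at u, and A is its value at u: for some polynomial q with q(u) <> 0,
   the product q(w) S(w) is a polynomial in w, and its value at u is q(u) A. *)
Definition series_value (S : nat -> endo V) (u : K) (A : endo V) :=
  exists q : {poly K},
    [/\ q.[u] != 0,
        forall m : nat, (0 < m)%N -> \sum_(i < size q) q`_i *: S (i + m)%N = 0
      & q.[u] *: A = \sum_(k < size q)
          u ^+ k *: \sum_(k <= i < size q) q`_i *: S (i - k)%N].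

(* The value of T^a_b(u) in a Y(gl_n)-module, for a number u (and the junk
   value 0 if the series has no value at u in the sense above). *)
Definition current (T : yangian_module) (u : K) (a b : 'I_n) : endo V :=
  xget 0 [set A | series_value (T a b) u A]%classic.

End Modules.

Section EvaluationCurrent.
Variables (K : fieldType) (n : nat) (V : lmodType K).
Variables (e : gl_module n V) (x u : K).

Local Notation S := (eval_op e x).

Lemma eval_tail (q : {poly K}) a b (m : nat) : (0 < m)%N ->
  \sum_(i < size q) q`_i *: S a b (i + m)%N = (q.[x] * x ^+ m.-1) *: e b a.
Proof.
case: m => // m _; rewrite horner_coef mulr_suml scaler_suml.
by apply: eq_bigr => i _; rewrite addnS /= scalerA exprD mulrA.
Qed.

Lemma eval_head (q : {poly K}) a b : u != x ->
  \sum_(k < size q) u ^+ k *: \sum_(k <= i < size q) q`_i *: S a b (i - k)%N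
  = q.[u] *: ((a == b)%:R : endo V) + ((q.[u] - q.[x]) / (u - x)) *: e b a.
Proof.
move=> ux.
transitivity (\sum_(i < size q) q`_i *: \sum_(k < i.+1) u ^+ k *: S a b (i - k)%N).
  under eq_bigr do rewrite big_geq_mkord scaler_sumr.
  rewrite (exchange_big_dep xpredT) //=; apply: eq_bigr => i _.
  rewrite (big_ord_widen (size q) (fun k => u ^+ k *: S a b (i - k)%N)) //.
  rewrite scaler_sumr; apply: eq_bigr => k _.
  by rewrite !scalerA mulrC.
have step (i : nat) : \sum_(k < i.+1) u ^+ k *: S a b (i - k)%N
    = u ^+ i *: ((a == b)%:R : endo V) + ((u ^+ i - x ^+ i) / (u - x)) *: e b a.
  rewrite big_ord_recr /= subnn addrC; congr (_ + _).
  rewrite subrXX mulrAC divff ?subr_eq0 // mul1r.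
  rewrite (reindex_inj rev_ord_inj) /= scaler_suml.
  apply: eq_bigr => k _; have ki := ltn_ord k.
  by rewrite subKn //= scalerA -subn1 -subnDA add1n.
under eq_bigr do rewrite step scalerDr !scalerA.
rewrite big_split /= -!scaler_suml !horner_coef; congr (_ *: _ + _ *: _).
by rewrite -sumrB mulr_suml; apply: eq_bigr => i _; rewrite mulrA mulrBr.
Qed.

Lemma eval_current a b : u != x ->
  current (eval_module e x) u a b = ((a == b)%:R : endo V) + (u - x)^-1 *: e b a.
Proof.
move=> ux; apply: xget_unique => [|A [q [qu qm qA]]].
  exists ('X - x%:P); have qu : ('X - x%:P).[u] != 0 by rewrite hornerXsubC subr_eq0.
  split=> // [m m_gt0|]; rewrite ?eval_tail ?eval_head // !hornerXsubC subrr.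
    by rewrite mul0r scale0r.
  by rewrite subr0 divff ?subr_eq0 // scale1r scalerDr scalerA divff ?subr_eq0 // scale1r.
have := qm 1%N isT; rewrite eval_tail // mulr1 => qx0.
move: qA; rewrite eval_head // mulrBl scalerBl [_ / (u - x)]mulrC.
rewrite [q.[x] / _]mulrC -[(_ * q.[x]) *: _]scalerA qx0 scaler0 subr0 mulrC.
by rewrite -scalerA -scalerDr => /(scalerI qu).
Qed.

End EvaluationCurrent.

Section TensorOperators.
Variables (K : fieldType) (V : lmodType K) (N m : nat).

Definition multiindex := {ffun 'I_m -> 'I_N}.

(* End((C^N)^{(x) m}) (x) End(V): matrices over End(V) whose rows and columns
   are labeled by multiindices. *)
Definition tensor_op := 'M[endo V]_#|{: multiindex}|.

Definition tensor_mx (X : multiindex -> multiindex -> endo V) : tensor_op :=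
  \matrix_(i, j) X (enum_val i) (enum_val j).

Definition entry (X : tensor_op) (I J : multiindex) : endo V :=
  X (enum_rank I) (enum_rank J).

Definition in_factor (k : 'I_m) (L : 'I_N -> 'I_N -> endo V) : tensor_op :=
  tensor_mx (fun I J =>
    if [forall p, (p != k) ==> (I p == J p)] then L (I k) (J k) else 0).

Definition in_factors (k l : 'I_m) (M : 'I_N -> 'I_N -> 'I_N -> 'I_N -> K) :
    tensor_op :=
  tensor_mx (fun I J =>
    if [forall p, (p != k) && (p != l) ==> (I p == J p)]
    then M (I k) (I l) (J k) (J l) *: (1 : endo V) else 0).

Definition Rmatrix (u : K) (a b c d : 'I_N) : K :=
  (a == c)%:R * (b == d)%:R + u^-1 * ((a == d)%:R * (b == c)%:R).

(* In the next two definitions, pos, pos1, pos2 give the tensor factors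
   associated with the variables of each group. *)
Definition Tproduct (T : yangian_module N V) (k : nat)
    (pos : 'I_k -> 'I_m) (t : k.-tuple K) : tensor_op :=
  \prod_(i < k) in_factor (pos i) (current T (tnth t i)).

Definition Rproduct (k l : nat) (pos1 : 'I_k -> 'I_m) (pos2 : 'I_l -> 'I_m)
    (t : k.-tuple K) (s : l.-tuple K) : tensor_op :=
  \prod_(i < k) \prod_(j < l)
    in_factors (pos1 i) (pos2 (rev_ord j))
      (Rmatrix (tnth t i - tnth s (rev_ord j))).

End TensorOperators.

(* The element a of {1, 2, 3, 4}. *)
Definition lbl (a : nat) : 'I_4 := inord a.-1.

Section WeightFunction.
Variables (K : fieldType) (V : lmodType K) (xi1 xi2 xi3 : nat).

Definition group1 (k : 'I_xi1) : 'I_(xi1 + xi2 + xi3) := lshift xi3 (lshift xi2 k).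
Definition group2 (k : 'I_xi2) : 'I_(xi1 + xi2 + xi3) := lshift xi3 (rshift xi1 k).
Definition group3 (k : 'I_xi3) : 'I_(xi1 + xi2 + xi3) := rshift (xi1 + xi2) k.

Definition blockwise (a1 a2 a3 : 'I_4) : multiindex 4 (xi1 + xi2 + xi3) :=
  [ffun p : 'I_(xi1 + xi2 + xi3) =>
     if (p < xi1)%N then a1 else if (p < xi1 + xi2)%N then a2 else a3].

Definition weight_function (T : yangian_module 4 V)
    (t1 : xi1.-tuple K) (t2 : xi2.-tuple K) (t3 : xi3.-tuple K) : endo V :=
  entry (Tproduct T group1 t1 * Tproduct T group2 t2 * Tproduct T group3 t3
         * Rproduct V 4 group3 group2 t3 t2
         * Rproduct V 4 group3 group1 t3 t1
         * Rproduct V 4 group2 group1 t2 t1)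
    (blockwise (lbl 1) (lbl 2) (lbl 3)) (blockwise (lbl 2) (lbl 3) (lbl 4)).

End WeightFunction.

Section Symmetrization.
Variables (K : fieldType) (m : nat).

Definition Qfactor (s : m.-tuple K) : K :=
  \prod_(i < m) \prod_(j < m | (i < j)%N)
    ((tnth s i - tnth s j - 1) / (tnth s i - tnth s j)).

Definition permute (s : m.-tuple K) (sigma : 'S_m) : m.-tuple K :=
  [tuple tnth s (sigma i) | i < m].

Definition Sym (f : m.-tuple K -> K) (s : m.-tuple K) : K :=
  \sum_(sigma : 'S_m) f (permute s sigma) * Qfactor (permute s sigma).

End Symmetrization.

Section RationalFunctions.
Variables (K : fieldType) (xi1 xi2 xi3 : nat).
Implicit Types i j : seq nat.

(* The truncated subtraction p + q - xi2 is max(0, p + q - xi2). *)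
Definition in_range (p q r : nat) : bool :=
  [&& p <= minn xi2 xi3, q <= minn xi2 xi1, p + q - xi2 <= r & r <= minn p q]%N.

(* The elements of {1, ..., xi2} are shifted to {0, ..., xi2 - 1}. *)
Definition admissible (p q r : nat) i j :=
  [/\ size i = p, size j = q,
      sorted ltn i && all (fun k => k < xi2)%N i,
      sorted ltn j && all (fun k => k < xi2)%N j
    & count (mem j) i = r].

(* All indices of the usual formula are shifted by -1, so that the variables
   t^a_1, t^a_2, ... are t`_0, t`_1, ... *)
Definition Gfun (Lam2 Lam3 x : K) i j
    (t1 : xi1.-tuple K) (t2 : xi2.-tuple K) (t3 : xi3.-tuple K) : K :=
  let p := size i in let q := size j in
  \prod_(0 <= a < p)
    ((t3`_a - x + Lam3) / (t3`_a - t2`_(nth 0%N i a))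
     * \prod_((nth 0%N i a).+1 <= m < xi2)
         ((t3`_a - t2`_m + 1) / (t3`_a - t2`_m)))
  * \prod_(0 <= s < q)
    ((t1`_(xi1 - q + s) - x + Lam2) / (t2`_(nth 0%N j s) - t1`_(xi1 - q + s))
     * \prod_(0 <= l < nth 0%N j s)
         ((t2`_l - t1`_(xi1 - q + s) + 1) / (t2`_l - t1`_(xi1 - q + s)))).

Definition SymG (Lam2 Lam3 x : K) i j
    (t1 : xi1.-tuple K) (t2 : xi2.-tuple K) (t3 : xi3.-tuple K) : K :=
  Sym (fun s1 => Sym (fun s2 => Sym (fun s3 =>
    Gfun Lam2 Lam3 x i j s1 s2 s3) t3) t2) t1.

(* Identities of rational functions of t are stated at the points outside the
   zeros of the denominators t^a_i - t^a_j, t^3_i - t^2_j, t^2_i - t^1_j, and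
   also t^3_i - t^1_j and t^a_i - x when the weight function is involved. *)
Definition generic
    (t1 : xi1.-tuple K) (t2 : xi2.-tuple K) (t3 : xi3.-tuple K) :=
  [/\ uniq t1, uniq t2, uniq t3,
      forall k l, tnth t3 k != tnth t2 l
    & forall k l, tnth t2 k != tnth t1 l].

Definition generic_weight (x : K)
    (t1 : xi1.-tuple K) (t2 : xi2.-tuple K) (t3 : xi3.-tuple K) :=
  [/\ generic t1 t2 t3,
      forall k l, tnth t3 k != tnth t1 l
    & [/\ x \notin t1, x \notin t2 & x \notin t3]].

End RationalFunctions.

(* Main.v *)
Require Import Defs.
From HB Require Import structures.
From mathcomp Require Import all_boot all_order all_algebra perm.
From mathcomp Require Import boolp classical_sets reals complex.
From mathcomp Require Import ring ssrAC zify.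

Set Implicit Arguments.
Unset Strict Implicit.
Unset Printing Implicit Defensive.

Import GRing.Theory Num.Theory.
Local Open Scope ring_scope.

(** The tensor factors are called sites; the sites of block a carry the
    parameters t^a.  Multiindices are words on the sites, and the matrices over
    End(V) act on V-valued functions of words: R-matrices become operators that
    exchange two letters ([shift_op]), so that products of matrices can be
    handled as products of operators in a noncommutative ring.

    Reduction to block 2.  By the Yang-Baxter and RTT relations, the product
    T1 T2 T3 R32 R31 R21 equals R21 T2 R31 T3 R32 T1 ([nested_reorder]), where
    T1 acts first on v.  Since e23 v = 0, the entries of T1 v in column 2
    vanish as soon as one row letter is 3; therefore R31, which could only bring
    a letter 3 into block 1, acts as the identity ([frozen_columns]).  It follows
    that T2 has row letters 1, 2 and column letters 3, 4, and contributes a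
    product of the commuting operators e31, e32, e41, e42, whereas T1 only
    involves e21 and e22, and T3 only e43 and e33.  The Cartan elements act by
    scalars that depend on the number of lowering operators already applied
    ([lowering_product]).  What remains is a sum over the words w in pairs of
    bits on block 2, w telling which of the four operators sits at each site:
    the coefficient of the monomial is X(w) Y(w), where X collects R32 and T3,
    and Y collects R21 and T1 ([nested_expansion]).

    The coefficients.  X and Y are the same kind of lattice partition function,
    up to a change of sign of the parameters.  A partition function is evaluated
    by a recursion on the sites, the [amplitude] ([partition_functionE]), and
    the amplitude is, up to a factorial, the symmetrization of a product
    ([amplitude_symmetrization]); this product is the factor of G that depends
    on t^3, respectively on t^1.  Hence the symmetrization of G over t^3 and t^1
    is, up to factorials, the value of X Y at the word given by the two sets of
    indices ([SymG_amplitudes]).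

    The symmetrization over t^2.  Both X and Y satisfy the exchange relation
    [exchangeable] when two neighbouring sites are exchanged.  For such
    functions, and for every word a,
      multiplicity(a) * sum of X(w) Y(w) over the rearrangements w of a
        = sum of Q(s) X(s, a) Y(s, a) over the permutations s of t^2,
    with a reversal of the sites inside Y on the left ([symmetrize_words]).  The
    left-hand side depends on a only through the number of its letters, which is
    statement (b).  The triples (p, q, r) are exactly the classes of words up to
    rearrangement, and the multiplicity together with the factorials found above
    is the denominator in the formula: this is statement (a).  The identity is
    the iteration of a step that extracts one letter ([one_step]); the step
    itself is the comparison of the coefficients of 1/z in a noncommutative
    partial fraction expansion ([residues_sum]).  The same step also yields the
    evaluation of the partition functions. *)

(** * Noncommutative partial fractions *)

Section PartialFractions.
Variables (K : fieldType) (V : lmodType K) (I : eqType) (t : I -> K).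
Variable p : I -> endo V.

Definition factors (z : K) (s : seq I) : endo V :=
  \prod_(l <- s) (1 + (t l - z)^-1 *: p l).

(** The residue of the ordered product [factors z s] at z = t k, up to sign;
    the operators p l need not commute, so that p k stays at its place. *)
Definition residue (s : seq I) (k : I) : endo V :=
  factors (t k) (take (index k s) s) * p k
  * factors (t k) (drop (index k s).+1 s).

Lemma factors_cons z k s :
  factors z (k :: s) = (1 + (t k - z)^-1 *: p k) * factors z s.
Proof. by rewrite /factors big_cons. Qed.

Lemma residue_head k s : residue (k :: s) k = p k * factors (t k) s.
Proof. by rewrite /residue /= eqxx /= /factors big_nil mul1r drop0. Qed.

Lemma residue_tail k0 s k : k0 != k ->
  residue (k0 :: s) k = (1 + (t k0 - t k)^-1 *: p k0) * residue s k.
Proof.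
by move=> nk; rewrite /residue /= (negbTE nk) factors_cons !mulrA.
Qed.

Lemma residue_sum_cons k s : k \notin s ->
  \sum_(j <- k :: s) residue (k :: s) j
  = p k * factors (t k) s
    + \sum_(j <- s) (1 + (t k - t j)^-1 *: p k) * residue s j.
Proof.
move=> ks; rewrite big_cons residue_head; congr (_ + _).
by apply: eq_big_seq => j js; rewrite residue_tail //; apply: contraNneq ks => ->.
Qed.

(** The poles in z are simple, and at infinity the product tends to 1. In the
    induction, the product of two simple fractions with poles at t k and t j
    splits, and the part with the pole at t k is again an expansion of the
    remaining factors, now at z = t k. *)
Lemma factors_residues z s : uniq s -> {in s &, injective t} ->
  {in s, forall k, t k != z} ->
  factors z s = 1 + \sum_(k <- s) (t k - z)^-1 *: residue s k.
Proof.
elim: s z => [|k s IH] z /=; first by rewrite /factors !big_nil addr0.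
case/andP=> ks us tI tz.
have tI' : {in s &, injective t}.
  by move=> a b ha hb; apply: tI; rewrite inE ?ha ?hb orbT.
have tk : {in s, forall j, t j != t k}.
  move=> j js; apply: contraNneq ks => /tI <- //; rewrite inE ?eqxx ?js ?orbT //.
have tz' : {in s, forall j, t j != z} by move=> j js; apply: tz; rewrite inE js orbT.
have tkz : t k != z by apply: tz; rewrite inE eqxx.
rewrite factors_cons big_cons residue_head.
have -> : \sum_(j <- s) (t j - z)^-1 *: residue (k :: s) j
        = \sum_(j <- s) (t j - z)^-1 *: ((1 + (t k - t j)^-1 *: p k) * residue s j).
  apply: eq_big_seq => j js; rewrite residue_tail //; apply: contraNneq ks => -> //.
rewrite (IH z us tI' tz') (IH (t k) us tI' tk).
rewrite mulrDl mul1r -!endo_scalerAl !mulrDr !mulr1 !scalerDr -!addrA; congr (_ + _).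
rewrite [LHS]addrCA; congr (_ + _).
rewrite !mulr_sumr !scaler_sumr -!big_split /=.
apply: eq_big_seq => j js.
rewrite mulrDl mul1r scalerDr addrCA; congr (_ + _).
rewrite -!endo_scalerAr -!endo_scalerAl !scalerA -scalerDl; congr (_ *: _).
have h1 : t k - z != 0 by rewrite subr_eq0.
have h2 : t j - z != 0 by rewrite subr_eq0 tz'.
have h3 : t j - t k != 0 by rewrite subr_eq0 tk.
have h4 : t k - t j != 0 by rewrite subr_eq0 eq_sym tk.
by field; rewrite h1 h2 h3 h4.
Qed.

(** Both sides are the coefficient of 1/z at infinity of [factors z s], up to
    sign: it can be read off from the residues, or by expanding the product. *)
Lemma residues_sum s : uniq s -> {in s &, injective t} ->
  \sum_(k <- s) residue s k = \sum_(k <- s) p k.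
Proof.
elim: s => [|k s IH] /=; first by rewrite !big_nil.
case/andP=> ks us tI.
have tI' : {in s &, injective t}.
  by move=> a b ha hb; apply: tI; rewrite inE ?ha ?hb orbT.
have tk : {in s, forall j, t j != t k}.
  move=> j js; apply: contraNneq ks => /tI <- //; rewrite inE ?eqxx ?js ?orbT //.
rewrite residue_sum_cons // (factors_residues us tI' tk) mulrDr mulr1 big_cons.
rewrite -addrA; congr (_ + _); rewrite -IH // mulr_sumr -big_split /=.
apply: eq_big_seq => j js.
rewrite mulrDl mul1r addrCA -[RHS]addr0; congr (_ + _).
rewrite -endo_scalerAr -endo_scalerAl -scalerDl -[(t j - _)^-1]opprK -invrN opprB.
by rewrite addNr scale0r.
Qed.

End PartialFractions.

(** * Exchanging letters of words *)

Section Pull.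
Variables (K : fieldType) (W : lmodType K) (X : finType).

Definition pull (g : X -> X) (phi : {ffun X -> W}) : {ffun X -> W} :=
  [ffun x => phi (g x)].

Lemma pull_is_linear g : linear (pull g).
Proof. by move=> a f h; apply/ffunP => x; rewrite !ffunE. Qed.

HB.instance Definition _ g :=
  GRing.isLinear.Build K {ffun X -> W} {ffun X -> W} _ (pull g) (pull_is_linear g).

Definition pull_op g : endo {ffun X -> W} := pull g.

Lemma pull_opE g phi x : pull_op g phi x = phi (g x).
Proof. by rewrite /pull_op /pull ffunE. Qed.

Lemma pull_opM g h : pull_op g * pull_op h = pull_op (h \o g).
Proof. by apply: endoP => phi; rewrite endoME; apply/ffunP=> x; rewrite !pull_opE. Qed.

Lemma eq_pull_op g h : g =1 h -> pull_op g = pull_op h.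
Proof. by move=> gh; apply: endoP => phi; apply/ffunP => x; rewrite !pull_opE gh. Qed.

(** When g exchanges the letters k and l of a word, [shift_op u^-1 g] is the
    R-matrix R(u) in the tensor factors k and l. *)
Definition shift_op (c : K) g : endo {ffun X -> W} := 1 + c *: pull_op g.

Lemma shift_opE c g phi x : shift_op c g phi x = phi x + c *: phi (g x).
Proof. by rewrite /shift_op endoDE endo1E endoZE !ffunE. Qed.

End Pull.

Section Intertwining.
Variables (A : pzRingType) (I : eqType).

Lemma prod_intertwine (s : seq I) (a : A) (f g : I -> A) :
  {in s, forall l, a * f l = g l * a} ->
  a * (\prod_(l <- s) f l) = (\prod_(l <- s) g l) * a.
Proof.
elim: s => [|l s IH] h; first by rewrite !big_nil mulr1 mul1r.
rewrite !big_cons mulrA h ?inE ?eqxx // -mulrA IH ?mulrA // => j js.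
by apply: h; rewrite inE js orbT.
Qed.

Lemma prod_comm (s : seq I) (a : A) (f : I -> A) :
  {in s, forall l, a * f l = f l * a} ->
  a * (\prod_(l <- s) f l) = (\prod_(l <- s) f l) * a.
Proof. exact: prod_intertwine. Qed.

End Intertwining.

Section ShiftTheory.
Variables (K : fieldType) (W : lmodType K) (X : finType).
Implicit Types (g h : X -> X).
Local Notation pull_op := (pull_op W).
Local Notation shift_op := (shift_op W).

Lemma pull_shift (c : K) a g h : g \o a =1 a \o h ->
  pull_op a * shift_op c g = shift_op c h * pull_op a.
Proof.
move=> e; rewrite /shift_op mulrDr mulrDl mulr1 mul1r; congr (_ + _).
by rewrite -endo_scalerAr -endo_scalerAl !pull_opM (eq_pull_op _ e).
Qed.

Lemma shift_comm (c d : K) g h : g \o h =1 h \o g ->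
  shift_op c g * shift_op d h = shift_op d h * shift_op c g.
Proof.
move=> e; have -> : shift_op c g = 1 + c *: pull_op g by [].
rewrite mulrDl [RHS]mulrDr mul1r mulr1; congr (_ + _).
rewrite -endo_scalerAl -endo_scalerAr; congr (_ *: _).
exact: (pull_shift _ (fun x => esym (e x))).
Qed.

End ShiftTheory.

Section Adjoint.
Variables (K : fieldType) (X : finType).
Local Notation shift_op := (shift_op K^o).

Lemma shift_adjoint (c : K) (g : X -> X) (a b : {ffun X -> K^o}) :
  involutive g ->
  \sum_x a x * (shift_op c g b) x = \sum_x (shift_op c g a) x * b x.
Proof.
move=> gK; under eq_bigr do rewrite shift_opE mulrDr.
under [RHS]eq_bigr do rewrite shift_opE mulrDl.
rewrite !big_split /=; congr (_ + _).
rewrite (reindex_inj (inv_inj gK)) /=; apply: eq_bigr => x _.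
by rewrite gK /GRing.scale /= mulrCA mulrA.
Qed.

(** Exchanges are self-adjoint for the bilinear pairing of functions, and
    transposition reverses products. *)
Lemma prod_shift_adjoint (I : Type) (s : seq I) (c : I -> K) (g : I -> X -> X)
    (a b : {ffun X -> K^o}) : (forall i, involutive (g i)) ->
  \sum_x a x * ((\prod_(i <- s) shift_op (c i) (g i)) b) x
  = \sum_x ((\prod_(i <- rev s) shift_op (c i) (g i)) a) x * b x.
Proof.
move=> gK; elim: s a => [|i s IH] a; first by rewrite !big_nil.
rewrite big_cons rev_cons -cats1 big_cat big_seq1 /=.
under eq_bigr do rewrite endoME.
by rewrite shift_adjoint // IH; apply: eq_bigr => x _; rewrite endoME.
Qed.

End Adjoint.

Section Words.
Variables (P L : finType).
Implicit Types (w : {ffun P -> L}) (k l : P).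

Definition swap k l w : {ffun P -> L} := [ffun p => w (tperm k l p)].
Definition set_letter w k (b : L) : {ffun P -> L} :=
  [ffun p => if p == k then b else w p].

Lemma swapK k l : involutive (swap k l).
Proof. by move=> w; apply/ffunP => p; rewrite !ffunE tpermK. Qed.

Lemma swapL k l w : swap k l w k = w l. Proof. by rewrite ffunE tpermL. Qed.
Lemma swapR k l w : swap k l w l = w k. Proof. by rewrite ffunE tpermR. Qed.
Lemma swapD k l p w : k != p -> l != p -> swap k l w p = w p.
Proof. by move=> h1 h2; rewrite ffunE tpermD. Qed.

Lemma swapC k l : swap k l =1 swap l k.
Proof. by move=> w; apply/ffunP => p; rewrite !ffunE tpermC. Qed.

Lemma swap_swap k l k' l' w : swap k' l' (swap k l w)
  = swap (tperm k' l' k) (tperm k' l' l) (swap k' l' w).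
Proof.
apply/ffunP => p; rewrite !ffunE; congr (w _).
by rewrite [RHS](inj_tperm _ _ _ (@perm_inj _ (tperm k' l'))) !tpermK.
Qed.

End Words.

(** * Exchange relations and extraction of a letter *)

(** F is the coefficient function of a vector, depending on a sequence of
    parameters, such that exchanging two neighbouring parameters amounts to
    acting by the R-matrix on the corresponding letters. The predicate D keeps
    the parameters away from the poles of F. *)
Definition exchangeable (K : fieldType) (L : Type) (D : pred K)
    (F : seq (K * L) -> K) :=
  forall s1 s2 y1 y2 b1 b2,
    all (fun c => D c.1) (s1 ++ [:: (y1, b1), (y2, b2) & s2]) ->
    (y1 - y2 + 1) * F (s1 ++ [:: (y2, b2), (y1, b1) & s2])
    = (y1 - y2) * F (s1 ++ [:: (y1, b1), (y2, b2) & s2])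
      + F (s1 ++ [:: (y1, b2), (y2, b1) & s2]).

Lemma exchangeable_cons (K : fieldType) (L : Type) (D : pred K)
    (F : seq (K * L) -> K) x c : D x -> exchangeable D F ->
  exchangeable D (fun s => F ((x, c) :: s)).
Proof.
move=> Dx exF s1 s2 y1 y2 b1 b2 aD.
by have := exF ((x, c) :: s1) s2 y1 y2 b1 b2; apply; rewrite /= Dx.
Qed.

Lemma splitE (I : eqType) (k : I) (s : seq I) : k \in s ->
  s = take (index k s) s ++ k :: drop (index k s).+1 s.
Proof.
move=> ks; rewrite -{1}(cat_take_drop (index k s) s) (drop_nth k) ?index_mem //.
by rewrite nth_index.
Qed.

Section OneStep.
Variables (K : fieldType) (P L : finType) (t : P -> K) (D : pred K).
Local Notation word := {ffun P -> L}.
Implicit Types (w : word) (k l : P) (s ps : seq P).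

Definition labelled w s : seq (K * L) := [seq (t p, w p) | p <- s].

Lemma labelled_cat w s1 s2 : labelled w (s1 ++ s2) = labelled w s1 ++ labelled w s2.
Proof. exact: map_cat. Qed.

Lemma eq_labelled w w' s : {in s, w =1 w'} -> labelled w s = labelled w' s.
Proof. by move=> e; apply/eq_in_map => p /e ->. Qed.

Lemma labelled_swap k l w s : k \notin s -> l \notin s ->
  labelled (swap k l w) s = labelled w s.
Proof.
move=> ks ls; apply: eq_labelled => p ps.
by rewrite swapD //; [apply: contraNneq ks => -> | apply: contraNneq ls => ->].
Qed.

Definition labelled_fun (F : seq (K * L) -> K) s : {ffun word -> K^o} :=
  [ffun w => F (labelled w s)].

Definition exchange_ops k s : endo {ffun word -> K^o} :=
  \prod_(l <- s) shift_op K^o (t l - t k)^-1 (swap k l).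

(** Each R-matrix moves the site k one place to the left: by the exchange
    relation, this costs the factor 1 - 1/(t k - t l). *)
Lemma move_to_front (F : seq (K * L) -> K) k s1 s2 w :
  exchangeable D F -> uniq (s1 ++ k :: s2) -> {in s1, forall l, t l != t k} ->
  all D (map t (s1 ++ k :: s2)) ->
  exchange_ops k s1 (labelled_fun F (s1 ++ k :: s2)) w
  = \prod_(l <- s1) (1 - (t k - t l)^-1) * F (labelled w (k :: s1 ++ s2)).
Proof.
move=> exF; elim/last_ind: s1 s2 => [|s l IH] s2 us tk aD.
  by rewrite /exchange_ops !big_nil mul1r ffunE.
rewrite /exchange_ops -!cats1 !big_cat /= !big_seq1 endoME.
have -> : shift_op K^o (t l - t k)^-1 (swap k l)
            (labelled_fun F ((s ++ [:: l]) ++ k :: s2))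
        = (1 - (t k - t l)^-1) *: labelled_fun F (s ++ k :: l :: s2).
  apply/ffunP => w'; rewrite shift_opE !ffunE -!catA /=.
  have tlk : t l != t k by apply: tk; rewrite mem_rcons inE eqxx.
  move: us; rewrite -cats1 -catA /= cat_uniq /= => /and3P[_ nin /andP[lks /andP[ks2 us2]]].
  move: nin; rewrite !negb_or => /and3P[ls kns nin].
  have kl : k != l by move: lks; rewrite inE negb_or eq_sym => /andP[].
  have ls2 : l \notin s2 by move: lks; rewrite inE negb_or => /andP[].
  rewrite !labelled_cat /= swapL swapR !labelled_swap //.
  have := exF (labelled w' s) (labelled w' s2) (t l) (t k) (w' l) (w' k).
  move=> /(_ _)/wrap[].
    move: aD; rewrite -cats1 -!catA /= map_cat all_cat /= => /and3P[h1 h2 /andP[h3 h4]].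
    rewrite all_cat /= h2 h3 /= /labelled !all_map.
    by move: h1 h4; rewrite !all_map => h1 h4; apply/andP.
  move=> e.
  have d0 : t l - t k != 0 by rewrite subr_eq0.
  have d0' : t k - t l != 0 by rewrite subr_eq0 eq_sym.
  apply: (mulfI d0); rewrite /GRing.scale /= mulrDr mulrA divff // mul1r -e.
  by rewrite mulrA; congr (_ * _); field; rewrite d0'.
rewrite linearZ ffunE /GRing.scale /= IH ?mulrA.
- by rewrite (mulrC _ (1 - _)) -!catA.
- move: us; rewrite -cats1 -catA /=; congr is_true; apply: perm_uniq.
  by rewrite perm_cat2l -(cat1s l) -(cat1s k) -[l :: _]/([:: l] ++ _) -[k :: l :: _]/([:: k] ++ [:: l] ++ s2) perm_catCA.
- by move=> j js; apply: tk; rewrite mem_rcons inE js orbT.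
- move: aD; congr is_true; apply: perm_all; apply: perm_map.
  rewrite -cats1 -catA /= perm_cat2l.
  by rewrite -[l :: k :: _]/([:: l] ++ [:: k] ++ s2) perm_catCA.
Qed.

(** A word is extended by an auxiliary letter, that is, by one more tensor
    factor; the exchanges of this letter with the letters of the word are the
    operators to which [residues_sum] is applied. *)
Definition aux_swap l (c : L * word) : L * word := (c.2 l, set_letter c.2 l c.1).
Definition word_swap k l (c : L * word) : L * word := (c.1, swap k l c.2).

Lemma aux_swap_aux k l : k != l ->
  aux_swap l \o aux_swap k =1 aux_swap k \o word_swap k l.
Proof.
move=> kl [x w]; rewrite /aux_swap /word_swap /=; congr (_, _).
  by rewrite swapL ffunE eq_sym (negbTE kl).
apply/ffunP => p; rewrite !ffunE; case: (eqVneq p l) => [->|pl].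
  by rewrite tpermR eq_sym (negbTE kl).
by case: (eqVneq p k) => [//|pk]; rewrite tpermD // eq_sym.
Qed.

Lemma word_swap_aux k l : k != l ->
  word_swap k l \o aux_swap k =1 aux_swap k \o aux_swap l.
Proof.
move=> kl [x w]; rewrite /aux_swap /word_swap /=; congr (_, _).
  by rewrite ffunE (negbTE kl).
apply/ffunP => p; rewrite !ffunE; case: (eqVneq p k) => [->|pk].
  by rewrite tpermL eq_sym (negbTE kl).
case: (eqVneq p l) => [->|pl]; first by rewrite tpermR eqxx.
by rewrite tpermD 1?(negbTE pk) // eq_sym.
Qed.

Lemma aux_word_comm j k l : j != k -> j != l ->
  aux_swap j \o word_swap k l =1 word_swap k l \o aux_swap j.
Proof.
move=> jk jl [x w]; rewrite /aux_swap /word_swap /=; congr (_, _).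
  by rewrite swapD // eq_sym.
apply/ffunP => p; rewrite !ffunE /=.
case: eqP => [->|/eqP pj]; first by rewrite tpermD ?eqxx // eq_sym.
case: tpermP => [_|_|_ _]; rewrite 1?eq_sym ?(negbTE jk) ?(negbTE jl) ?(negbTE pj) //.
by rewrite eq_sym (negbTE pj).
Qed.

Definition aux_op l : endo {ffun L * word -> K^o} := pull_op K^o (aux_swap l).

(** By the relations between transpositions, the exchange of the auxiliary
    letter with k turns the other exchanges of the auxiliary letter into
    exchanges with k: only one of them is left, the others act inside the
    word. *)
Lemma residue_conj ps k : uniq ps -> k \in ps ->
  residue t aux_op ps k
  = (\prod_(l <- drop (index k ps).+1 ps)
        shift_op K^o (t l - t k)^-1 (word_swap k l))
    * aux_op k
    * (\prod_(l <- take (index k ps) ps)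
        shift_op K^o (t l - t k)^-1 (word_swap k l)).
Proof.
move=> us ks; rewrite /residue /factors.
have := splitE ks; move: (take _ _) (drop _ _) => s1 s2 e.
move: us; rewrite e cat_uniq /= => /and3P[us1 nin /andP[ks2 us2]].
move: nin; rewrite negb_or => /andP[ks1 nin].
have n1 l : l \in s1 -> k != l by move=> ls; apply: contraNneq ks1 => ->.
have n2 l : l \in s2 -> k != l by move=> ls; apply: contraNneq ks2 => ->.
have n12 l l' : l \in s1 -> l' \in s2 -> l != l'.
  by move=> h1 h2; apply: contraNneq (hasPn nin _ h2) => <-.
rewrite -/(shift_op _ _ _).
rewrite -mulrA (prod_intertwine (s := s2)
  (g := fun l => shift_op K^o (t l - t k)^-1 (word_swap k l))); last first.
  move=> l ls; apply: pull_shift => x.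
  exact: aux_swap_aux (n2 _ ls) x.
rewrite mulrA.
have -> : (\prod_(l <- s1) (1 + (t l - t k)^-1 *: aux_op l))
       * (\prod_(l <- s2) shift_op K^o (t l - t k)^-1 (word_swap k l))
     = (\prod_(l <- s2) shift_op K^o (t l - t k)^-1 (word_swap k l))
       * (\prod_(l <- s1) (1 + (t l - t k)^-1 *: aux_op l)).
  apply: prod_comm => l ls; apply/esym/prod_comm => j js; apply: shift_comm => x.
  have jk : j != k by rewrite eq_sym n1.
  exact: (esym (aux_word_comm jk (n12 _ _ js ls) x)).
rewrite -!mulrA; congr (_ * _); apply/esym.
apply: (prod_intertwine (f := fun l => shift_op K^o (t l - t k)^-1 (word_swap k l))).
by move=> l ls; apply: pull_shift => x; rewrite [LHS](word_swap_aux (n1 _ ls)).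
Qed.

Lemma word_swapK k l : involutive (word_swap k l).
Proof. by case=> x w; rewrite /word_swap /= swapK. Qed.

(** Exchanges inside the word do not see the auxiliary letter; the condition B
    comes along because it is stable under these exchanges. *)
Lemma word_shift_lift k s a (B : pred word) (phi : {ffun word -> K^o}) c :
  k \notin s -> (forall l w, l \in s -> B (swap k l w) = B w) ->
  (\prod_(l <- s) shift_op K^o (t l - t k)^-1 (word_swap k l))
    [ffun c => if (c.1 == a) && B c.2 then phi c.2 else 0] c
  = if (c.1 == a) && B c.2 then exchange_ops k s phi c.2 else 0.
Proof.
rewrite /exchange_ops => ks BI; elim: s ks BI c => [|l s IH] ks BI c.
  by rewrite !big_nil ffunE.
have ks' : k \notin s by move: ks; rewrite inE negb_or => /andP[].
have BI' j w : j \in s -> B (swap k j w) = B w.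
  by move=> js; apply: BI; rewrite inE js orbT.
rewrite !big_cons !endoME !shift_opE /= !IH //=.
by rewrite BI ?inE ?eqxx //; case: ifP => // _; rewrite scaler0 addr0.
Qed.

Lemma sum_aux (R : nmodType) (a : L) (B : pred word) (f : L * word -> R) :
  \sum_c (if (c.1 == a) && B c.2 then f c else 0) = \sum_(w | B w) f (a, w).
Proof.
transitivity (\sum_x \sum_w (if (x == a) && B w then f (x, w) else 0)).
  by rewrite pair_bigA; apply: eq_bigr => -[].
rewrite (bigD1 a) //= [X in _ + X]big1 ?addr0.
  by rewrite [RHS]big_mkcond; apply: eq_bigr => w _; rewrite eqxx.
by move=> x xa; apply: big1 => w _; rewrite (negbTE xa).
Qed.

(** Take the matrix element of [residues_sum] between F and G, both extended
    by the auxiliary letter a. On the right of [residues_sum], the exchange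
    with k is nonzero only if w k = a, which counts the letters a. In the
    residue at k, the exchanges on both sides of the auxiliary exchange are
    absorbed by F and by G (through their adjoints), which brings k to the
    front of both words. The sum runs over a set B of words that is stable
    under exchanges. *)
Theorem one_step (F G : seq (K * L) -> K) (a : L) (B : pred word) ps :
  exchangeable D F -> exchangeable D G -> uniq ps -> {in ps &, injective t} ->
  all D (map t ps) ->
  (forall k l w, k \in ps -> l \in ps -> B (swap k l w) = B w) ->
  \sum_(w | B w) (count (fun p => w p == a) ps)%:R
     * (F (labelled w ps) * G (labelled w (rev ps)))
  = \sum_(k <- ps) \prod_(l <- rem k ps) (1 - (t k - t l)^-1)
     * \sum_(w | B w && (w k == a))
         F (labelled w (k :: rem k ps)) * G (labelled w (k :: rev (rem k ps))).
Proof.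
move=> exF exG us tI aD BI.
pose xi : {ffun L * word -> K^o} :=
  [ffun c => if (c.1 == a) && xpredT c.2 then labelled_fun F ps c.2 else 0].
pose eta : {ffun L * word -> K^o} :=
  [ffun c => if (c.1 == a) && B c.2 then labelled_fun G (rev ps) c.2 else 0].
(* The matrix element of the operator identity between eta and xi. *)
have := congr1 (fun op : endo {ffun L * word -> K^o} => \sum_c eta c * (op xi) c)
  (residues_sum aux_op us tI).
have sumE (f : P -> endo {ffun L * word -> K^o}) :
    \sum_c eta c * ((\sum_(k <- ps) f k) xi) c
    = \sum_(k <- ps) \sum_c eta c * (f k xi) c.
  rewrite exchange_big /=; apply: eq_bigr => c _.
  by rewrite endo_sumE sum_ffunE mulr_sumr.
rewrite !sumE => E.
transitivity (\sum_(k <- ps) \sum_c eta c * (aux_op k xi) c).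
  rewrite exchange_big /=.
  transitivity (\sum_c (if (c.1 == a) && B c.2 then
     (count (fun p => c.2 p == a) ps)%:R
     * (F (labelled c.2 ps) * G (labelled c.2 (rev ps))) else 0)).
    by rewrite sum_aux.
  apply: eq_bigr => -[x w] _ /=; rewrite -mulr_sumr !ffunE /=.
  case: ifP => [/andP[/eqP -> _]|_]; last by rewrite mul0r.
  rewrite mulrA mulrC; congr (_ * _).
  rewrite -sum1_count natr_sum mulr_suml [LHS]big_mkcond /=.
  apply: eq_bigr => k _; rewrite pull_opE !ffunE /= andbT.
  case: ifP => [/eqP wk|//]; rewrite mul1r; congr F.
  by apply: eq_labelled => p _; rewrite ffunE; case: eqP => [->|].
rewrite -E; apply: eq_big_seq => k ks.
rewrite residue_conj //.
have ed := splitE ks; have er : rem k ps = take (index k ps) ps ++ drop (index k ps).+1 ps.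
  exact: remE.
rewrite er; move: ed; move: (take _ _) (drop _ _) => s1 s2 ed {er}.
have := us; rewrite {1}ed cat_uniq /= => /and3P[us1 nin /andP[ks2 us2]].
move: nin; rewrite negb_or => /andP[ks1 nin].
have n1 l : l \in s1 -> t l != t k.
  move=> ls; apply: contraNneq ks1 => /tI <- //; rewrite ed mem_cat ?inE ?eqxx ?ls ?orbT //.
have n2 l : l \in s2 -> t l != t k.
  move=> ls; apply: contraNneq ks2 => /tI <- //; rewrite ed mem_cat ?inE ?eqxx ?ls ?orbT //.
under eq_bigr do rewrite !endoME.
(* The exchanges on the left of the auxiliary one are moved to eta. *)
rewrite prod_shift_adjoint; last by move=> i; exact: word_swapK.
transitivity (\sum_c (if (c.1 == a) && B c.2 then
    (if c.2 k == a then exchange_ops k (rev s2) (labelled_fun G (rev ps)) c.2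
       * exchange_ops k s1 (labelled_fun F ps) c.2 else 0) else 0)).
  have lift1 c : (\prod_(l <- s1) shift_op K^o (t l - t k)^-1 (word_swap k l)) xi c
      = if (c.1 == a) && xpredT c.2 then exchange_ops k s1 (labelled_fun F ps) c.2 else 0.
    exact: word_shift_lift.
  have lift2 c : (\prod_(l <- rev s2) shift_op K^o (t l - t k)^-1 (word_swap k l)) eta c
      = if (c.1 == a) && B c.2
        then exchange_ops k (rev s2) (labelled_fun G (rev ps)) c.2 else 0.
    apply: word_shift_lift; rewrite ?mem_rev // => l w; rewrite mem_rev => ls.
    by apply: BI => //; rewrite ed mem_cat inE ls !orbT.
  apply: eq_bigr => -[x w] _; rewrite lift2 /=.
  case: ifP => [/andP[/eqP -> Bw]|_]; last by rewrite mul0r.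
  rewrite pull_opE lift1 /= andbT; case: eqP => [wk|]; last by rewrite mulr0.
  suff -> : set_letter w k a = w by [].
  by apply/ffunP => p; rewrite ffunE; case: eqP => [->|].
rewrite sum_aux /= -big_mkcondr /= mulr_sumr; apply: eq_bigr => w /andP[_ /eqP wk].
rewrite ed !rev_cat rev_cons cat_rcons.
rewrite (move_to_front _ exG) ?(move_to_front _ exF) //.
- by rewrite big_cat /= (perm_big _ (permEl (perm_rev s2))); ring.
- by rewrite -ed.
- by rewrite -ed.
- move: us; rewrite ed -rev_uniq rev_cat rev_cons cat_rcons //.
- by move=> l; rewrite mem_rev; apply: n2.
- by move: aD; rewrite ed -all_rev -map_rev rev_cat rev_cons cat_rcons.
Qed.

End OneStep.

(** * Symmetrization as a sum over words *)

Section Permutations.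
Variables (R : nmodType) (I : eqType).

Lemma sum_permutations_cons (s : seq I) (h : seq I -> R) : uniq s -> (0 < size s)%N ->
  \sum_(x <- permutations s) h x
  = \sum_(k <- s) \sum_(x <- permutations (rem k s)) h (k :: x).
Proof.
move=> us s0; rewrite (perm_big _ (permutationsE s0)) /= undup_id //.
by rewrite big_allpairs_dep.
Qed.

Lemma sum_permutations_map (J : eqType) (f : I -> J) (s : seq I) (h : seq J -> R) :
  {in s &, injective f} -> uniq s ->
  \sum_(x <- permutations (map f s)) h x = \sum_(x <- permutations s) h (map f x).
Proof.
move=> fI us; rewrite -(big_map (map f) xpredT h); apply: perm_big.
have fI' x y : x \in permutations s -> y \in permutations s ->
    map f x = map f y -> x = y.
  rewrite !mem_permutations => /perm_mem xs /perm_mem ys.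
  have xs' : {subset x <= s} by move=> i; rewrite xs.
  have ys' : {subset y <= s} by move=> i; rewrite ys.
  elim: x y {xs ys} xs' ys' => [|a x IH] [|b y] //= hx hy [e1 e2].
  have -> : a = b by apply: fI e1; [apply: hx|apply: hy]; rewrite inE eqxx.
  by congr (_ :: _); apply: IH e2 => i hi; [apply: hx|apply: hy]; rewrite inE hi orbT.
apply: uniq_perm.
- exact: permutations_uniq.
- by rewrite map_inj_in_uniq // permutations_uniq.
move=> y; rewrite mem_permutations; apply/idP/mapP => [|[x]]; last first.
  by rewrite mem_permutations => xs ->; apply: perm_map.
case: s us {fI fI'} => [|x0 s] us.
  by move/perm_nilP => ->; exists [::]; rewrite // mem_permutations.
move=> /(perm_iotaP (f x0)) [js pj ->]; rewrite size_map in pj.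
exists [seq nth x0 (x0 :: s) j | j <- js].
  by rewrite mem_permutations; apply/(perm_iotaP x0); exists js.
rewrite -map_comp; apply/eq_in_map => j; rewrite (perm_mem pj) mem_iota /= => hj.
by rewrite -[_ :: map f s]/(map f (x0 :: s)) (nth_map x0).
Qed.

End Permutations.

(** The factor Q of the symmetrization (see [Qfactor_ordered]), in a form
    suited to induction on the sequence. *)
Fixpoint ordered_factor (K : fieldType) (s : seq K) : K :=
  if s is x :: s' then \prod_(l <- s') (1 - (x - l)^-1) * ordered_factor s' else 1.

Section Multiplicity.
Variable L : finType.

(** The order of the group of those permutations of the places that fix the
    sequence. *)
Definition multiplicity (a : seq L) : nat := \prod_(c : L) (count_mem c a)`!.

Lemma multiplicity_cons c a :
  multiplicity (c :: a) = (count_mem c (c :: a) * multiplicity a)%N.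
Proof.
rewrite /multiplicity (bigD1 c) //= [in RHS](bigD1 c) //= eqxx add1n factS mulnA.
congr (_ * _)%N; apply: eq_bigr => d dc.
by rewrite eq_sym (negbTE dc).
Qed.

End Multiplicity.

Section Symmetrize.
Variables (K : fieldType) (P L : finType) (t : P -> K) (D : pred K).
Local Notation word := {ffun P -> L}.

(** A word is defined on all of P, hence frozen to the values of beta outside
    of the sites ps. *)
Definition rearranges (beta : word) ps a : pred word :=
  fun w => [forall p, (p \notin ps) ==> (w p == beta p)] && perm_eq (map w ps) a.

Lemma perm_map_swap ps k l (w : word) : uniq ps -> k \in ps -> l \in ps ->
  perm_eq (map (swap k l w) ps) (map w ps).
Proof.
move=> us ks ls.
have -> : map (swap k l w) ps = map w (map (tperm k l) ps).
  by rewrite -map_comp; apply: eq_map => p; rewrite /= ffunE.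
apply: perm_map; apply: uniq_perm => //.
  by rewrite map_inj_uniq //; apply: perm_inj.
move=> p; apply/mapP/idP => [[q qs ->]|pps].
  by case: tpermP => // [_|_]; rewrite ?ks ?ls.
exists (tperm k l p); last by rewrite tpermK.
by case: tpermP => // [_|_]; rewrite ?ks ?ls.
Qed.

Lemma rearranges_swap beta ps a k l w : uniq ps -> k \in ps -> l \in ps ->
  rearranges beta ps a (swap k l w) = rearranges beta ps a w.
Proof.
move=> us ks ls; rewrite /rearranges; congr (_ && _).
  apply: eq_forallb => p; case: (boolP (p \in ps)) => //= pps.
  by rewrite swapD //; apply: contraNneq pps => <-.
by rewrite (permPl (perm_map_swap w us ks ls)).
Qed.

Lemma rearranges_cons beta ps c a k w : uniq ps -> k \in ps ->
  rearranges beta ps (c :: a) w && (w k == c)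
  = rearranges (set_letter beta k c) (rem k ps) a w && (w k == c).
Proof.
move=> us ks; case: eqP => [wk|]; rewrite ?andbF ?andbT // /rearranges.
congr (_ && _); last first.
  rewrite (permPl (perm_map w (perm_to_rem ks))) /= wk.
  by rewrite perm_cons.
apply/forallP/forallP => h p; apply/implyP.
  rewrite mem_rem_uniq // inE negb_and negbK ffunE => /orP[/eqP ->|pps].
    by rewrite eqxx wk.
  case: (p =P k) => [->|_]; first by rewrite wk.
  by apply: (implyP (h p)).
move=> pps; have := h p; rewrite mem_rem_uniq // inE (negbTE pps) andbF /= ffunE.
by case: (p =P k) pps => [->|//]; rewrite ks.
Qed.

(** By induction on the length of a: [one_step] puts the first letter of a in
    front, at any of the sites, and the factor that it produces is the first
    factor of Q. The number of occurrences of the letter, which also appears,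
    builds up the multiplicity. *)
Theorem symmetrize_words a (F G : seq (K * L) -> K) ps beta :
  exchangeable D F -> exchangeable D G -> uniq ps -> {in ps &, injective t} ->
  all D (map t ps) -> size a = size ps ->
  (multiplicity a)%:R * \sum_(w | rearranges beta ps a w)
     F (labelled t w ps) * G (labelled t w (rev ps))
  = \sum_(qs <- permutations ps) ordered_factor (map t qs)
     * (F (zip (map t qs) a) * G (zip (map t qs) a)).
Proof.
elim: a F G ps beta => [|c a IH] F G ps beta exF exG us tI aD sz.
  case: ps us tI aD sz => // _ _ _ _.
  rewrite big_cons big_nil addr0 /= mul1r /multiplicity big1 // mul1r.
  rewrite (big_pred1 beta) // => w; rewrite /rearranges andbT /=.
  apply/forallP/eqP => [h|-> p]; last by rewrite eqxx.
  by apply/ffunP => p; have /eqP := h p.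
rewrite multiplicity_cons natrM mulrC mulrA mulrC.
rewrite mulr_suml.
(* All rearrangements have the same number of letters c. *)
transitivity ((multiplicity a)%:R * \sum_(w | rearranges beta ps (c :: a) w)
   (count (fun p => w p == c) ps)%:R
     * (F (labelled t w ps) * G (labelled t w (rev ps)))).
  congr (_ * _); apply: eq_bigr => w /andP[_ /seq.permP/(_ (pred1 c))].
  rewrite count_map /= => <-; rewrite mulrC; congr (_%:R * _).
rewrite (one_step _ exF exG us tI aD); last first.
  by move=> k l w ks ls; apply: rearranges_swap.
rewrite mulr_sumr sum_permutations_cons -?sz //.
apply: eq_big_seq => k ks.
have kD : D (t k) by apply: (allP aD); apply: map_f.
rewrite mulrCA.
have -> : \sum_(w | rearranges beta ps (c :: a) w && (w k == c))
     F (labelled t w (k :: rem k ps)) * G (labelled t w (k :: rev (rem k ps)))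
  = \sum_(w | rearranges (set_letter beta k c) (rem k ps) a w)
     F ((t k, c) :: labelled t w (rem k ps)) * G ((t k, c) :: labelled t w (rev (rem k ps))).
  under eq_bigl do rewrite rearranges_cons //.
  rewrite (eq_bigl (fun w => rearranges (set_letter beta k c) (rem k ps) a w)).
    apply: eq_bigr => w /andP[/forallP/(_ k)].
    by rewrite mem_rem_uniq // !inE eqxx /= ffunE eqxx => /eqP ->.
  move=> w; apply: andb_idr => /andP[/forallP/(_ k)].
  by rewrite mem_rem_uniq // !inE eqxx /= ffunE eqxx.
rewrite (IH (fun s => F ((t k, c) :: s)) (fun s => G ((t k, c) :: s))); first last.
- by rewrite size_rem // -sz.
- by apply/allP => y /mapP[p /mem_rem ps_p ->]; apply: (allP aD); apply: map_f.
- by move=> p q /mem_rem ps_p /mem_rem ps_q; apply: tI.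
- exact: rem_uniq.
- exact: exchangeable_cons.
- exact: exchangeable_cons.
rewrite mulr_sumr; apply: eq_big_seq => qs; rewrite mem_permutations => pq.
rewrite /= -[RHS]mulrA; congr (_ * _).
by rewrite big_map (perm_big _ pq).
Qed.

End Symmetrize.

Section SymmetrizeTuple.
Variables (K : fieldType) (L : finType) (D : pred K) (m : nat).

Corollary symmetrize_tuple (t : m.-tuple K) a (F G : seq (K * L) -> K) :
  exchangeable D F -> exchangeable D G -> uniq t -> all D t -> size a = m ->
  (multiplicity a)%:R * \sum_(w : {ffun 'I_m -> L} | perm_eq (codom w) a)
     F (labelled (tnth t) w (enum 'I_m)) * G (rev (labelled (tnth t) w (enum 'I_m)))
  = \sum_(s <- permutations t) ordered_factor s * (F (zip s a) * G (zip s a)).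
Proof.
move=> exF exG ut aD sz.
have tE : map (tnth t) (enum 'I_m) = t by apply: map_tnth_enum.
have tI : {in enum 'I_m &, injective (tnth t)}.
  by move=> i j _ _; apply/tuple_uniqP.
case: a sz => [|c a] sz.
  case: m t ut aD tE tI sz => // t0 _ _ _ _ _.
  rewrite tuple0 /= big_seq1 /= !mul1r /multiplicity big1 // mul1r.
  rewrite (big_pred1 (finfun (fun i : 'I_0 => match i with Ordinal _ h => False_rect L (notF h) end))).
    by rewrite enum_ord0.
  move=> w; rewrite (_ : codom w = [::]); last by apply: size0nil; rewrite size_codom card_ord.
  by apply/esym/eqP/ffunP => -[].
have := symmetrize_words (finfun (fun _ => c)) exF exG (enum_uniq 'I_m) tI _ _.
move/(_ (c :: a)); rewrite tE size_enum_ord => /(_ aD sz).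
rewrite -(sum_permutations_map (fun s => ordered_factor s * (F (zip s (c :: a)) * G (zip s (c :: a)))) tI (enum_uniq _)) tE => <-.
congr (_ * _); apply: eq_big => w; last by move=> _; rewrite /labelled map_rev.
rewrite /rearranges andb_idl // => _; apply/forallP => p.
by rewrite mem_enum.
Qed.

End SymmetrizeTuple.

(** * Amplitudes *)

Section Amplitude.
Variables (K : numFieldType) (c : K).
Implicit Types (zs : seq K) (s : seq (K * bool)).

Definition passing (x : K) s : K := \prod_(d <- s) (1 + (x - d.1)^-1).

(** A site with letter true absorbs one of the particles x of zs, which first
    crosses all the sites behind. The product over [rem x zs] is the first
    factor of Q, so that the amplitude is, up to a factorial, the
    symmetrization over zs of [ordered_amplitude], with the sum over the first
    particle carried out at the first occasion. *)
Fixpoint amplitude zs s : K :=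
  match s with
  | [::] => 1
  | (y, b) :: s' =>
    if b then \sum_(x <- zs) \prod_(l <- rem x zs) (1 - (x - l)^-1)
      * ((x + c) / (x - y) * passing x s' * amplitude (rem x zs) s')
    else amplitude zs s'
  end.

(** The particles are absorbed in the given order, from left to right. *)
Fixpoint ordered_amplitude zs s : K :=
  match s with
  | [::] => 1
  | (y, b) :: s' =>
    if b then if zs is z :: zs' then
      (z + c) / (z - y) * passing z s' * ordered_amplitude zs' s' else 0
    else ordered_amplitude zs s'
  end.

Lemma passing_cat x s1 s2 : passing x (s1 ++ s2) = passing x s1 * passing x s2.
Proof. exact: big_cat. Qed.

Lemma passing_cons x d s : passing x (d :: s) = (1 + (x - d.1)^-1) * passing x s.
Proof. exact: big_cons. Qed.

Lemma rem_rem (T : eqType) (x y : T) (zs : seq T) : uniq zs -> rem x (rem y zs) = rem y (rem x zs).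
Proof.
move=> us; rewrite !rem_filter ?filter_uniq // -!filter_predI.
by apply: eq_filter => l /=; rewrite andbC.
Qed.

(** The two first particles x, x' contribute a common factor M, symmetric in x
    and x', times an elementary function H. Only the sum of the terms for (x,
    x') and (x', x) is symmetric in y1 and y2. *)
Lemma amplitude_swap_particles zs y1 y2 s : uniq zs -> y1 \notin zs -> y2 \notin zs ->
  amplitude zs [:: (y1, true), (y2, true) & s]
  = amplitude zs [:: (y2, true), (y1, true) & s].
Proof.
move=> us y1z y2z.
pose M (x x' : K) : K := \prod_(l <- rem x' (rem x zs)) ((1 - (x - l)^-1) * (1 - (x' - l)^-1))
  * ((x + c) * (x' + c) * (passing x s * passing x' s)
     * amplitude (rem x' (rem x zs)) s).
pose H (a b x x' : K) : K :=
  (1 - (x - x')^-1) * ((x - a)^-1 * (1 + (x - b)^-1)) / (x' - b).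
have MC x x' : M x x' = M x' x.
  rewrite /M rem_rem //; congr (_ * (_ * _)); last by ring.
  by apply: eq_bigr => l _; rewrite mulrC.
have ampE a b : amplitude zs [:: (a, true), (b, true) & s]
   = \sum_(x <- zs) \sum_(x' <- zs | x' != x) H a b x x' * M x x'.
  rewrite /=; apply: eq_big_seq => x xs.
  transitivity (\sum_(x' <- rem x zs) H a b x x' * M x x'); last first.
    by rewrite rem_filter // big_filter.
  rewrite !mulr_sumr; apply: eq_big_seq => x' xs'.
  rewrite passing_cons /= /H /M (big_rem x') //= big_split /=; ring.
rewrite !ampE; apply/eqP; rewrite -subr_eq0 -sumrB.
under eq_bigr do rewrite -sumrB.
set T := (X in X == 0).
(* Doubling allows adding to each term the one with x and x' exchanged. *)
suff : T + T == 0 by rewrite -mulr2n mulrn_eq0.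
rewrite {2}/T (exchange_big_dep xpredT) //= /T -big_split /=; apply/eqP.
apply: big1_seq => x /= xs.
have -> : \sum_(x' <- zs | x != x') (H y1 y2 x' x * M x' x - H y2 y1 x' x * M x' x)
   = \sum_(x' <- zs | x' != x) (H y1 y2 x' x * M x' x - H y2 y1 x' x * M x' x).
  by apply: eq_bigl => x'; rewrite eq_sym.
rewrite -big_split /=; apply: big1_seq => x' /andP[xx' xs'].
rewrite [M x' x]MC -!mulrBl -mulrDl [X in X * _](_ : _ = 0) ?mul0r // /H.
have d1 : x - x' != 0 by rewrite subr_eq0 eq_sym.
have d2 : x' - x != 0 by rewrite subr_eq0.
have dn y z : y \notin zs -> z \in zs -> z - y != 0.
  by move=> h1 h2; rewrite subr_eq0; apply: contraNneq h1 => <-.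
by field; rewrite d1 d2 !dn.
Qed.

Lemma amplitude_exchangeable zs : uniq zs ->
  exchangeable [pred y | y \notin zs] (amplitude zs).
Proof.
move=> us s1; elim: s1 zs us => [|[y b] s1 IH] zs us s2 y1 y2 b1 b2.
  move=> /= /and3P[y1z y2z _].
  have dn y z : y \notin zs -> z \in zs -> z - y != 0.
    by move=> h1 h2; rewrite subr_eq0; apply: contraNneq h1 => <-.
  case: b1 b2 => [] [] /=; last ring.
  - have := amplitude_swap_particles s2 us y1z y2z; rewrite /= => ->; ring.
  - rewrite !mulr_sumr -big_split /=; apply: eq_big_seq => x xs.
    rewrite !passing_cons /=; move: (\prod_(_ <- _) _) (passing _ _) (amplitude _ _) => p q r.
    by field; rewrite !dn.
  - rewrite !mulr_sumr -big_split /=; apply: eq_big_seq => x xs.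
    rewrite !passing_cons /=; move: (\prod_(_ <- _) _) (passing _ _) (amplitude _ _) => p q r.
    by field; rewrite !dn.
rewrite /= => /andP[yz aD]; case: b; last exact: IH.
rewrite !mulr_sumr -big_split /=; apply: eq_big_seq => x xs.
have := IH (rem x zs) (rem_uniq x us) s2 y1 y2 b1 b2.
move=> /(_ _)/wrap[].
  by apply: sub_all aD => -[d b] /=; apply: contra => /mem_rem.
rewrite !passing_cat !passing_cons /=.
move: (amplitude _ _) (amplitude _ _) (amplitude _ _) => A3 A2 A1 e.
transitivity ((\prod_(l <- rem x zs) (1 - (x - l)^-1) * ((x + c) / (x - y)
   * (passing x s1 * ((1 + (x - y1)^-1) * ((1 + (x - y2)^-1) * passing x s2)))))
   * ((y1 - y2 + 1) * A1)); first by ring.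
by rewrite e; ring.
Qed.

(** Symmetrizing 1: the case of a one-letter alphabet in [symmetrize_tuple],
    where there is only one word, whose multiplicity is the factorial. *)
Lemma sum_ordered_factor (zs : seq K) : uniq zs ->
  \sum_(x <- permutations zs) ordered_factor x = (size zs)`!%:R.
Proof.
move=> us.
have ex : exchangeable predT (fun _ : seq (K * unit) => 1 : K).
  by move=> *; rewrite !mulr1.
have := symmetrize_tuple (t := in_tuple zs) (a := nseq (size zs) tt) ex ex us (all_predT _).
rewrite size_nseq => /(_ erefl); under [RHS]eq_bigr do rewrite !mulr1.
move=> <-; rewrite mul1r.
rewrite (eq_bigl xpredT) => [|w]; last first.
  have -> : codom w = nseq (size zs) tt.
    have -> : nseq (size zs) tt = nseq (size (codom w)) tt by rewrite size_codom card_ord.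
    by apply/all_pred1P/allP => -[].
  by rewrite perm_refl.
rewrite sumr_const card_ffun card_ord card_unit exp1n mulr1.
by rewrite /multiplicity (big_pred1 tt) ?count_nseq ?mul1n // => -[].
Qed.

(** The factorial is the contribution of the particles that are never
    absorbed, by [sum_ordered_factor]. *)
Theorem amplitude_symmetrization zs s :
  uniq zs -> (count snd s <= size zs)%N ->
  \sum_(x <- permutations zs) ordered_factor x * ordered_amplitude x s
  = (size zs - count snd s)`!%:R * amplitude zs s.
Proof.
elim: s zs => [|[y b] s IH] zs us /= sz.
  rewrite subn0 mulr1 -sum_ordered_factor //.
  by apply: eq_bigr => x _; rewrite mulr1.
case: b sz => /=; last exact: IH.
rewrite add1n => sz; rewrite sum_permutations_cons ?(leq_ltn_trans _ sz) //.
rewrite mulr_sumr; apply: eq_big_seq => x xs.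
have szr : (count snd s <= size (rem x zs))%N by rewrite size_rem // -ltnS prednK // (leq_ltn_trans _ sz).
have := IH (rem x zs) (rem_uniq x us) szr.
rewrite size_rem // -subn1 -subnDA add1n => e.
transitivity (\prod_(l <- rem x zs) (1 - (x - l)^-1) * ((x + c) / (x - y) * passing x s)
  * ((size zs - (count snd s).+1)`!%:R * amplitude (rem x zs) s)); last by ring.
rewrite -e mulr_sumr; apply: eq_big_seq => xs'; rewrite mem_permutations => px.
by rewrite /= (perm_big _ px) /=; ring.
Qed.

End Amplitude.

(** * Partition functions *)

Section Line.
Variables (K : fieldType) (L : Type).
Implicit Types (y : K) (a : L) (ls : seq (K * L)) (phi : seq (K * L) -> L -> K).

(** One line of a lattice: the letter a enters with parameter y and crosses
    the sites of ls, from left to right, each crossing being weighted by the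
    R-matrix; phi receives the new letters on the sites and the outgoing
    letter. *)
Fixpoint line y a ls phi : K :=
  match ls with
  | [::] => phi [::] a
  | (z, b) :: ls' =>
    line y a ls' (fun r => phi ((z, b) :: r))
    + (z - y)^-1 * line y b ls' (fun r => phi ((z, a) :: r))
  end.

Lemma eq_line y a ls phi psi :
  (forall r x, map fst r = map fst ls -> phi r x = psi r x) ->
  line y a ls phi = line y a ls psi.
Proof.
elim: ls a phi psi => [|[z b] ls IH] a phi psi e /=; first exact: e.
by congr (_ + _ * _); apply: IH => r x er; apply: e; rewrite /= er.
Qed.

Lemma line_linear y a ls k1 k2 phi psi :
  line y a ls (fun r x => k1 * phi r x + k2 * psi r x)
  = k1 * line y a ls phi + k2 * line y a ls psi.
Proof.
elim: ls a phi psi => [|[z b] ls IH] a phi psi //=.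
by rewrite !IH; ring.
Qed.

Lemma line_scale y a ls k phi :
  line y a ls (fun r x => k * phi r x) = k * line y a ls phi.
Proof.
rewrite -[RHS]addr0 -[X in _ + X](mul0r (line y a ls phi)) -line_linear.
by apply: eq_line => r x _; rewrite mul0r addr0.
Qed.

(** The Yang-Baxter relation: exchanging two sites commutes with the line, so
    that the exchange relation of phi carries over. *)
Lemma line_exchangeable (D : pred K) y a phi : (forall z, D z -> z != y) ->
  (forall x, exchangeable D (phi^~ x)) ->
  exchangeable D (fun ls => line y a ls phi).
Proof.
move=> Dy exphi s1; elim: s1 a phi exphi => [|[z b] s1 IH] a phi exphi s2 y1 y2 b1 b2.
  move=> /= /and3P[D1 D2 aD].
  have d1 : y1 - y != 0 by rewrite subr_eq0 Dy.
  have d2 : y2 - y != 0 by rewrite subr_eq0 Dy.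
  have rel x p q : (y1 - y2 + 1) * line y x s2 (fun r => phi [:: (y2, q), (y1, p) & r])
     = (y1 - y2) * line y x s2 (fun r => phi [:: (y1, p), (y2, q) & r])
       + line y x s2 (fun r => phi [:: (y1, q), (y2, p) & r]).
    rewrite -[line y x s2 (fun r => phi [:: (y1, q), (y2, p) & r])]mul1r -line_linear -line_scale; apply: eq_line => r x' er.
    rewrite mul1r; apply: (exphi x' [::]); rewrite /= D1 D2 /=.
    by move: aD; rewrite -!(all_map fst) er.
  set W := fun x p q => line y x s2 (fun r => phi [:: (y2, q), (y1, p) & r]) in rel.
  set W' := fun x p q => line y x s2 (fun r => phi [:: (y1, p), (y2, q) & r]) in rel.
  set W'' := fun x p q => line y x s2 (fun r => phi [:: (y1, q), (y2, p) & r]) in rel.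
  transitivity ((y1 - y2 + 1) * W a b1 b2 + (y1 - y)^-1 * ((y1 - y2 + 1) * W b1 a b2)
    + (y2 - y)^-1 * ((y1 - y2 + 1) * W b2 b1 a
                     + (y1 - y)^-1 * ((y1 - y2 + 1) * W b1 b2 a))).
    by rewrite /W; ring.
  rewrite !rel /W' /W''.
  do ![move: (line _ _ _ _) => ?].
  by field; rewrite d1 d2.
rewrite /= => /andP[Dz aD].
have ex x x' : exchangeable D (fun r => phi ((z, x) :: r) x').
  exact: (@exchangeable_cons _ _ _ (phi^~ x')).
rewrite mulrDr mulrCA (IH _ _ (ex b)) // (IH _ _ (ex a)) //; ring.
Qed.

End Line.

Lemma exchangeable_sub (K : fieldType) (L : Type) (D D' : pred K) (F : seq (K * L) -> K) :
  {subset D' <= D} -> exchangeable D F -> exchangeable D' F.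
Proof.
by move=> sD exF s1 s2 y1 y2 b1 b2 aD; apply: exF; apply: sub_all aD => d /sD.
Qed.

Section Partition.
Variables (K : numFieldType) (c : K).
Implicit Types (y z : K) (ls s : seq (K * bool)).

(** The eigenvalues of a Cartan element in a product of Cartan and lowering
    operators: k counts the lowering operators (letters true) met so far, each
    of which shifts the weight by one (see [lowering_product]). *)
Fixpoint weight_product k ls : K :=
  match ls with
  | [::] => 1
  | (z, b) :: ls' =>
    if b then weight_product k.+1 ls' else (z + c - k%:R) * weight_product k ls'
  end.

Lemma weight_product_exchangeable k : exchangeable predT (weight_product k).
Proof.
move=> s1; elim: s1 k => [|[z b] s1 IH] k s2 y1 y2 b1 b2 _ /=.
  by case: b1 b2 => [] [] /=; rewrite ?[k.+1%:R]mulrSr; ring.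
have {}IH k' := IH k' s2 y1 y2 b1 b2 (all_predT _).
by case: b; rewrite ?IH // mulrCA IH; ring.
Qed.

(** Each element (y, b) of s is a line with parameter y that enters with
    letter false and leaves with letter b. *)
Fixpoint partition_function s (tau : seq (K * bool) -> K) ls : K :=
  match s with
  | [::] => tau ls
  | (y, b) :: s' =>
    line y false ls (fun r a => (a == b)%:R * partition_function s' tau r)
  end.

Lemma partition_exchangeable s tau : exchangeable predT tau ->
  exchangeable [pred z | z \notin map fst s] (partition_function s tau).
Proof.
move=> extau; elim: s => [|[y b] s IH] /=; first exact: exchangeable_sub extau.
apply: line_exchangeable => [z|x]; first by rewrite inE negb_or => /andP[].
have {}IH : exchangeable [pred z | z \notin y :: map fst s] (partition_function s tau).
  by apply: exchangeable_sub IH => z /=; rewrite !inE negb_or => /andP[].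
by move=> s1 s2 y1 y2 b1 b2 aD; rewrite mulrCA IH //; ring.
Qed.

(** All lines enter with letter false; a first site with the same letter keeps
    it, so that each crossing only contributes a scalar. *)
Lemma partition_ground s z ls :
  partition_function s (weight_product 0) ((z, false) :: ls)
  = (z + c) * passing z s * partition_function s (weight_product 0) ls.
Proof.
elim: s ls => [|[y b] s IH] ls /=.
  by rewrite /passing big_nil subr0 mulr1.
rewrite passing_cons /=.
have -> : line y false ls (fun r a =>
     (a == b)%:R * partition_function s (weight_product 0) ((z, false) :: r))
  = ((z + c) * passing z s) * line y false ls (fun r a =>
     (a == b)%:R * partition_function s (weight_product 0) r).
  by rewrite -line_scale; apply: eq_line => r x _; rewrite IH; ring.
by ring.
Qed.

Lemma weight_product_true k zs : weight_product k [seq (z, true) | z <- zs] = 1.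
Proof. by elim: zs k => //= z zs IH k; rewrite IH. Qed.

Lemma line_full y zs phi :
  line y true [seq (z, true) | z <- zs] phi
  = \prod_(z <- zs) (1 + (z - y)^-1) * phi [seq (z, true) | z <- zs] true.
Proof.
elim: zs phi => [|z zs IH] phi /=; first by rewrite big_nil mul1r.
by rewrite !IH big_cons; ring.
Qed.

Lemma line_no_emission y zs (G : seq (K * bool) -> K) :
  line y false [seq (z, true) | z <- zs] (fun r a => (a == false)%:R * G r)
  = G [seq (z, true) | z <- zs].
Proof.
elim: zs G => [|z zs IH] G /=; first by rewrite mul1r.
by rewrite (IH (fun r => G ((z, true) :: r))) line_full /=; ring.
Qed.

Section OneHole.
Variables (P : finType) (t : P -> K).
Implicit Types (p k : P) (ps : seq P).

Definition hole k : {ffun P -> bool} := [ffun p => p != k].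

Lemma labelled_hole k ps : k \notin ps ->
  labelled t (hole k) ps = [seq (z, true) | z <- map t ps].
Proof.
move=> kps; rewrite -map_comp; apply/eq_in_map => p pps.
by rewrite ffunE; case: eqP kps pps => [-> /negP|].
Qed.

Lemma hole_inj : injective hole.
Proof. by move=> k l /ffunP/(_ k); rewrite !ffunE eqxx; case: eqP. Qed.

Lemma swap_hole k l j : swap k l (hole j) = hole (tperm k l j).
Proof.
apply/ffunP => p; rewrite !ffunE; congr (~~ _).
by rewrite -[in RHS](inj_eq (@perm_inj _ (tperm k l))) tpermK.
Qed.

(** The weight of a line that enters with letter false, leaves with letter
    true, and deposits its letter false at one of the sites, the sites being
    read from right to left. As a function of the word it is exchangeable,
    which makes the sum in [line_emission] a sum to which [one_step] applies. *)
Fixpoint hole_coef y ls : K :=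
  match ls with
  | [::] => 0
  | (z, b) :: ls' => if b then (1 + (z - y)^-1) * hole_coef y ls'
                     else (z - y)^-1 * (all snd ls')%:R
  end.

Lemma hole_coef_exchangeable y : exchangeable [pred z | z != y] (hole_coef y).
Proof.
move=> s1; elim: s1 => [|[z b] s1 IH] s2 y1 y2 b1 b2.
  move=> /= /and3P[h1 h2 _].
  have d1 : y1 - y != 0 by rewrite subr_eq0.
  have d2 : y2 - y != 0 by rewrite subr_eq0.
  by case: b1 b2 => [] [] /=; field; rewrite ?d1 ?d2.
move=> /= /andP[_ aD]; case: b; first by rewrite mulrCA IH //; ring.
by rewrite !all_cat /= [b2 && (b1 && _)]andbCA; ring.
Qed.

Lemma hole_coefE y k (s1 s2 : seq P) : k \notin s1 -> k \notin s2 ->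
  hole_coef y (labelled t (hole k) (s1 ++ k :: s2))
  = \prod_(p <- s1) (1 + (t p - y)^-1) / (t k - y).
Proof.
move=> ks1 ks2; rewrite labelled_cat (labelled_hole ks1) /= ffunE eqxx /=.
rewrite (labelled_hole ks2).
elim: (s1) => [|p s IH] /=; last by rewrite IH big_cons mulrA.
by rewrite big_nil mul1r [all _ _](_ : _ = true) ?mulr1 // all_map all_predT.
Qed.

Lemma line_emission y qs (G : seq (K * bool) -> K) : uniq qs ->
  line y false [seq (z, true) | z <- map t qs] (fun r a => (a == true)%:R * G r)
  = \sum_(k <- qs) hole_coef y (labelled t (hole k) (rev qs))
                   * G (labelled t (hole k) qs).
Proof.
elim: qs G => [|q qs IH] G /=; first by rewrite big_nil mul0r.
case/andP=> qqs uqs; rewrite (IH (fun r => G ((t q, true) :: r))) // line_full /=.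
rewrite big_cons addrC; congr (_ + _).
  rewrite rev_cons -cats1 hole_coefE ?mem_rev // ffunE eqxx /= (labelled_hole qqs).
  by rewrite (perm_big _ (permEl (perm_rev qs))) big_map mul1r; ring.
apply: eq_big_seq => k kqs; rewrite ffunE [q == k](_ : _ = false); last first.
  by apply: contraNF qqs => /eqP ->.
congr (_ * _); have := splitE kqs; move: (take _ _) (drop _ _) => s1 s2 e.
move: uqs qqs; rewrite e cat_uniq /= => /and3P[_ nin /andP[ks2 _]].
rewrite mem_cat inE !negb_or => /and3P[_ qk _].
move: nin; rewrite negb_or => /andP[ks1 _].
rewrite rev_cons rev_cat rev_cons cat_rcons -cats1 -catA /=.
rewrite !hole_coefE ?mem_rev //.
by rewrite mem_cat negb_or mem_rev ks1 inE eq_sym.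
Qed.

End OneHole.

Lemma map_rem (T1 T2 : eqType) (f : T1 -> T2) (s : seq T1) x :
  {in s &, injective f} -> x \in s -> map f (rem x s) = rem (f x) (map f s).
Proof.
elim: s => //= a s IH fI; rewrite inE => xs.
case: (eqVneq a x) => [->|ax]; first by rewrite eqxx.
have {}xs : x \in s by move: xs; rewrite eq_sym (negbTE ax).
rewrite ifN /=; last first.
  apply: contraNneq ax => /fI -> //; rewrite inE ?eqxx ?xs ?orbT //.
rewrite IH // => p q ps qs; apply: fI; rewrite inE ?ps ?qs orbT //.
Qed.

(** The first line either leaves with letter false, and then all sites keep
    their letter true, or leaves a hole at one of the sites. In the second
    case, [one_step] for the letter false moves the hole to the front of the
    remaining partition function, where it is crossed trivially
    ([partition_ground]): this is the recursion of the amplitude. *)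
Theorem partition_functionE s zs : uniq zs ->
  all [pred d | d.1 \notin zs] s ->
  partition_function s (weight_product 0) (rev [seq (z, true) | z <- zs])
  = amplitude c zs s.
Proof.
rewrite -map_rev; elim: s zs => [|[y b] s IH] zs us /=.
  by rewrite weight_product_true.
case/andP=> yzs azs; case: b; last by rewrite line_no_emission IH.
pose t := tnth (in_tuple zs); pose ps := enum 'I_(size zs).
have tE : map t ps = zs by apply: (map_tnth_enum (in_tuple zs)).
have tI : {in ps &, injective t} by move=> i j _ _; apply/tuple_uniqP.
have ups : uniq ps by apply: enum_uniq.
rewrite -[in rev _]tE -map_rev line_emission ?rev_uniq // revK.
rewrite (perm_big _ (permEl (perm_rev ps))) /=.
pose D : pred K := fun z => z \notin y :: map fst s.
have exX : exchangeable D (hole_coef y).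
  apply: (exchangeable_sub _ (hole_coef_exchangeable (y := y))) => z.
  by rewrite /in_mem /= /D inE negb_or => /andP[].
have exY : exchangeable D (partition_function s (weight_product 0)).
  apply: (exchangeable_sub _ (partition_exchangeable (s := s) (@weight_product_exchangeable 0))) => z.
  by rewrite /in_mem /= /D inE negb_or => /andP[].
(* The words with one hole form a set stable under exchanges. *)
pose B : pred {ffun 'I_(size zs) -> bool} := fun w => w \in [set hole k | k : 'I_(size zs)].
have BI k l w : k \in ps -> l \in ps -> B (swap k l w) = B w.
  move=> _ _; apply/imsetP/imsetP => -[j _ e]; exists (tperm k l j) => //.
    by rewrite -swap_hole -e swapK.
  by rewrite e swap_hole.
have aD : all D (map t ps).
  rewrite tE; apply/allP => z zzs; rewrite /D inE negb_or; apply/andP; split.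
    by apply: contraNneq yzs => <-.
  by apply/mapP => -[d ds e]; move: (allP azs d ds); rewrite /= -e zzs.
have := one_step false exX exY ups tI aD BI.
rewrite big_imset /=; last by move=> k l _ _; apply: hole_inj.
move=> e.
transitivity (\sum_(k : 'I_(size zs)) (count (fun p => hole k p == false) ps)%:R
  * (hole_coef y (labelled t (hole k) ps)
     * partition_function s (weight_product 0) (labelled t (hole k) (rev ps)))).
  rewrite big_enum; apply: eq_bigr => k _.
  rewrite (eq_count (a2 := pred1 k)); last by move=> p; rewrite ffunE eqbF_neg negbK.
  by rewrite count_uniq_mem // mem_enum mul1r.
transitivity (\sum_(k <- ps) \prod_(l <- rem k ps) (1 - (t k - t l)^-1)
  * ((t k + c) / (t k - y) * passing (t k) s * amplitude c (rem (t k) zs) s)); last first.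
  pose f x := \prod_(l <- rem x zs) (1 - (x - l)^-1)
    * ((x + c) / (x - y) * passing x s * amplitude c (rem x zs) s).
  rewrite -[RHS]/(\sum_(x <- zs) f x) -[in RHS]tE [RHS]big_map.
  apply: eq_big_seq => k ks; rewrite /f; congr (_ * _).
  have -> : rem (t k) zs = map t (rem k ps) by rewrite map_rem // tE.
  by rewrite big_map.
rewrite [LHS]e; apply: eq_big_seq => k ks; congr (_ * _).
rewrite (big_pred1 (hole k)) => [|w]; last first.
  apply/andP/eqP => [[/imsetP[j _ ->]]|->]; last first.
    by rewrite ffunE eqxx; split=> //; apply/imsetP; exists k.
  by rewrite ffunE eqbF_neg negbK => /eqP ->.
have kr : k \notin rem k ps by rewrite mem_rem_uniq // !inE eqxx.
rewrite ffunE eqxx partition_ground.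
have -> : all snd (labelled t (hole k) (rem k ps)) = true.
  by rewrite labelled_hole // all_map all_predT.
have krr : k \notin rev (rem k ps) by rewrite mem_rev.
rewrite (labelled_hole t krr) map_rev IH /=.
- by rewrite map_rem // tE; ring.
- by rewrite map_inj_in_uniq ?rem_uniq // => p q /mem_rem ? /mem_rem ?; apply: tI.
- rewrite map_rem // tE; apply: sub_all azs => d /=.
  by apply: contra => /mem_rem.
Qed.

End Partition.

(** * Block exchange relations *)

Section BlockExchange.
Variable A : pzRingType.

Lemma exchange_row (I : eqType) (s : seq I) (X R : I -> A) (Y : A) : uniq s ->
  {in s, forall i, X i * Y * R i = R i * Y * X i} ->
  {in s &, forall i j, i != j -> X i * R j = R j * X i} ->
  (\prod_(i <- s) X i) * Y * (\prod_(i <- rev s) R i)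
  = (\prod_(i <- rev s) R i) * Y * (\prod_(i <- s) X i).
Proof.
elim: s => [|i s IH] /=; first by rewrite !big_nil !mulr1 !mul1r.
case/andP=> is_ us rel comm.
rewrite rev_cons -cats1 !big_cat !big_seq1 !big_cons /=.
set X' := \prod_(j <- s) _; set R' := \prod_(j <- rev s) _.
have XR : X i * R' = R' * X i.
  apply: prod_comm => j; rewrite mem_rev => js; apply: comm; rewrite ?inE ?eqxx ?js ?orbT //.
  by apply: contraNneq is_ => ->.
have RX : R i * X' = X' * R i.
  apply: prod_comm => j js; apply/esym; apply: comm; rewrite ?inE ?eqxx ?js ?orbT //.
  by apply: contraNneq is_ => <-.
have {}IH : X' * Y * R' = R' * Y * X'.
  apply: IH => // [j js|j l js ls]; first by apply: rel; rewrite inE js orbT.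
  by apply: comm; rewrite inE ?js ?ls orbT.
have -> : X i * X' * Y * (R' * R i) = X i * (X' * Y * R') * R i by rewrite !mulrA.
have -> : R' * R i * Y * (X i * X') = R' * (R i * Y * X i) * X' by rewrite !mulrA.
by rewrite IH -rel ?inE ?eqxx // !mulrA XR -!mulrA RX.
Qed.

Lemma prod_split (J : eqType) (s : seq J) (f g : J -> A) : uniq s ->
  {in s &, forall i j, i != j -> f i * g j = g j * f i} ->
  (\prod_(j <- s) f j) * (\prod_(j <- s) g j) = \prod_(j <- s) (f j * g j).
Proof.
elim: s => [|j s IH] /=; first by rewrite !big_nil mulr1.
case/andP=> js us comm; rewrite !big_cons -IH //; last first.
  by move=> i l hi hl; apply: comm; rewrite inE ?hi ?hl orbT.
rewrite -!mulrA; congr (_ * _); rewrite !mulrA; congr (_ * _).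
apply/esym/prod_comm => i hi; apply/esym; apply: comm; rewrite ?inE ?eqxx ?hi ?orbT //.
by apply: contraNneq js => <-.
Qed.

(** Factors in different rows and columns commute, so that only the order
    inside each row and each column matters. *)
Lemma grid_swap (I J : eqType) (s1 : seq I) (s2 : seq J) (R : I -> J -> A) :
  uniq s1 -> uniq s2 ->
  (forall i i' j j', i \in s1 -> i' \in s1 -> j \in s2 -> j' \in s2 ->
     i != i' -> j != j' -> R i j * R i' j' = R i' j' * R i j) ->
  \prod_(i <- s1) \prod_(j <- s2) R i j = \prod_(j <- s2) \prod_(i <- s1) R i j.
Proof.
move=> u1 u2; elim: s1 u1 => [|i s1 IH] /=.
  by move=> _ _; rewrite big_nil big1 // => j _; rewrite big_nil.
case/andP=> is1 u1 comm; rewrite big_cons IH //; last first.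
  by move=> i1 i2 j1 j2 h1 h2; apply: comm; rewrite inE ?h1 ?h2 orbT.
rewrite prod_split //; first by apply: eq_bigr => j _; rewrite big_cons.
move=> j j' js js' jj'; apply: prod_comm => i' hi'.
apply: comm; rewrite ?inE ?eqxx ?hi' ?orbT //.
by apply: contraNneq is1 => ->.
Qed.

(** Exchanging two blocks of operators site by site, given the exchange
    relation for single sites: the operators R travel through the factors at
    other sites. *)
Lemma exchange_block (I J : eqType) (s1 : seq I) (s2 : seq J)
    (X : I -> A) (Y : J -> A) (R : I -> J -> A) : uniq s1 -> uniq s2 ->
  (forall i j, i \in s1 -> j \in s2 -> X i * Y j * R i j = R i j * Y j * X i) ->
  (forall i i' j, i \in s1 -> i' \in s1 -> j \in s2 -> i != i' ->
     X i * R i' j = R i' j * X i) ->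
  (forall i j j', i \in s1 -> j \in s2 -> j' \in s2 -> j != j' ->
     Y j * R i j' = R i j' * Y j) ->
  (\prod_(i <- s1) X i) * (\prod_(j <- s2) Y j)
    * (\prod_(j <- s2) \prod_(i <- rev s1) R i j)
  = (\prod_(j <- s2) \prod_(i <- rev s1) R i j)
    * (\prod_(j <- s2) Y j) * (\prod_(i <- s1) X i).
Proof.
move=> u1; elim: s2 => [|j s2 IH] /=.
  by rewrite !big_nil !mul1r !mulr1.
case/andP=> js2 u2 rel cX cY.
rewrite !big_cons.
set XX := \prod_(i <- s1) _; set YY := \prod_(j <- s2) _.
set R1 := \prod_(i <- rev s1) _; set RR := \prod_(j <- s2) _.
have YR : Y j * RR = RR * Y j.
  apply: prod_comm => j' h; apply: prod_comm => i; rewrite mem_rev => hi.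
  apply: cY; rewrite ?inE ?eqxx ?h ?orbT //.
  by apply: contraNneq js2 => ->.
have RY : R1 * YY = YY * R1.
  apply: prod_comm => j' h; apply/esym/prod_comm => i; rewrite mem_rev => hi.
  apply: cY; rewrite ?inE ?eqxx ?h ?orbT //.
  by apply: contraNneq js2 => <-.
have row : XX * Y j * R1 = R1 * Y j * XX.
  apply: exchange_row => // [i hi|i i' hi hi' ii']; first by apply: rel; rewrite ?inE ?eqxx.
  by apply: cX; rewrite ?inE ?eqxx.
have {}IH : XX * YY * RR = RR * YY * XX.
  apply: IH => // [i k hi hk|i i' k hi hi' hk|i k k' hi hk hk'].
  - by apply: rel; rewrite // inE hk orbT.
  - by apply: cX; rewrite // inE hk orbT.
  - by apply: cY; rewrite // inE ?hk ?hk' orbT.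
have -> : XX * (Y j * YY) * (R1 * RR) = XX * Y j * (YY * R1) * RR by rewrite !mulrA.
have -> : R1 * RR * (Y j * YY) * XX = R1 * (RR * Y j) * YY * XX by rewrite !mulrA.
rewrite -RY -YR.
have -> : XX * Y j * (R1 * YY) * RR = XX * Y j * R1 * (YY * RR) by rewrite !mulrA.
by rewrite row -!mulrA (mulrA XX) IH !mulrA.
Qed.

End BlockExchange.

Section Yang.
Variables (K : fieldType) (V : lmodType K).
Implicit Types (P Q S : endo V).

Lemma triple_expand (a b c : K) P Q S :
  (1 + a *: P) * (1 + b *: Q) * (1 + c *: S)
  = 1 + a *: P + b *: Q + c *: S + (a * b) *: (P * Q) + (a * c) *: (P * S)
    + (b * c) *: (Q * S) + (a * b * c) *: (P * Q * S).
Proof.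
rewrite !(mulrDl, mulrDr, mul1r, mulr1) -!(endo_scalerAl, endo_scalerAr) !scalerA.
by rewrite !addrA [LHS](ACl (1*3*2*5*4*7*6*8)).
Qed.

(** P, Q, S behave like the transpositions (12), (13), (23); the condition on
    the coefficients is that of u^-1, v^-1, w^-1 with v = u + w. *)
Lemma yang_baxter (a b c : K) P Q S :
  P * Q = Q * S -> Q * S = S * P -> P * S = Q * P -> Q * P = S * Q ->
  a * b + b * c = a * c ->
  (1 + a *: P) * (1 + b *: Q) * (1 + c *: S)
  = (1 + c *: S) * (1 + b *: Q) * (1 + a *: P).
Proof.
move=> e1 e2 e3 e4 eabc; rewrite !triple_expand.
rewrite [RHS](ACl (1*4*3*2*5*6*7*8)) /=.
have -> : P * Q * S = S * Q * P.
  by rewrite e1 e2 -!mulrA e3.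
rewrite -e4 -e2 e3 -e1 [c * b * a]mulrC [c * b]mulrC [c * a]mulrC [b * a]mulrC.
rewrite [LHS](ACl (1*2*3*4*(5*7)*6*8)) [RHS](ACl (1*2*3*4*6*(5*7)*8)) /=.
by rewrite -!scalerDl eabc [b * c + _]addrC eabc mulrA.
Qed.

(** P stands for the exchange of two tensor factors, E and F for the matrix of
    generators of gl_n placed in either of them: the relations of P, E, F are
    the commutation relations of gl_n. *)
Lemma rtt_relation (a b c : K) P E F :
  P * E = F * P -> P * F = E * P -> E * F - F * E = P * E - P * F ->
  a * b = c * (b - a) ->
  (1 + c *: P) * (1 + a *: E) * (1 + b *: F)
  = (1 + b *: F) * (1 + a *: E) * (1 + c *: P).
Proof.
move=> e1 e2 e3 eabc; rewrite !triple_expand.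
have -> : F * E * P = P * E * F by rewrite -mulrA -e2 mulrA -e1.
have -> : F * E = E * F - (P * E - P * F) by rewrite -e3 opprB addrCA subrr addr0.
rewrite -e1 -e2 [RHS](ACl (1*4*3*2*5*6*7*8)) /=.
have -> : b * a * c = c * a * b by rewrite mulrC mulrA [c * b * a]mulrAC.
rewrite !scalerBr opprB !addrA [RHS](ACl (1*2*3*4*(8*7)*(6*9)*5*10)) /=.
rewrite -scalerBl -scalerDl.
have -> : b * c - b * a = c * a by rewrite [b * a]mulrC eabc; ring.
have -> : b * a + a * c = c * b by rewrite [b * a]mulrC eabc; ring.
by rewrite [b * a]mulrC.
Qed.

End Yang.

(** * Operators on functions of words *)

Section WordOperators.
Variables (K : fieldType) (V : lmodType K) (n : nat) (P : finType).
Local Notation word := {ffun P -> 'I_n}.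
Local Notation tensor := {ffun word -> V}.
Implicit Types (k l p : P) (w : word) (phi : tensor).

Lemma swap_set k l p w b :
  swap k l (set_letter w p b) = set_letter (swap k l w) (tperm k l p) b.
Proof.
apply/ffunP => q; rewrite !ffunE.
by rewrite -(inj_eq (@perm_inj _ (tperm k l))) tpermK.
Qed.

(** A matrix over End(V) acting in the tensor factor k, on V-valued functions
    of words. *)
Definition act_letter (M : 'I_n -> 'I_n -> endo V) k phi : tensor :=
  [ffun w : word => \sum_b M (w k) b (phi (set_letter w k b))].

Lemma act_letter_is_linear M k : linear (act_letter M k).
Proof.
move=> a f h; apply/ffunP => w; rewrite !ffunE scaler_sumr -big_split /=.
by apply: eq_bigr => b _; rewrite !ffunE linearP.
Qed.

HB.instance Definition _ M k :=
  GRing.isLinear.Build K tensor tensor _ (act_letter M k) (act_letter_is_linear M k).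

Definition letter_op M k : endo tensor := act_letter M k.

Lemma letter_opE M k phi w :
  letter_op M k phi w = \sum_b M (w k) b (phi (set_letter w k b)).
Proof. by rewrite /letter_op /act_letter /= ffunE. Qed.

Local Notation swap_op k l := (pull_op V (@swap P 'I_n k l)).
Definition R_op (u : K) k l : endo tensor := shift_op V u^-1 (swap k l).

Lemma swap_letter M k l p :
  swap_op k l * letter_op M p = letter_op M (tperm k l p) * swap_op k l.
Proof.
apply: endoP => phi; rewrite !endoME; apply/ffunP => w.
rewrite pull_opE !letter_opE; apply: eq_bigr => b _.
by rewrite pull_opE swap_set tpermK ffunE.
Qed.

Lemma swap_opC k l : swap_op k l = swap_op l k.
Proof. by apply: eq_pull_op => w; rewrite swapC. Qed.

Lemma swap_op_conj k l k' l' :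
  swap_op k l * swap_op k' l'
  = swap_op k' l' * swap_op (tperm k' l' k) (tperm k' l' l).
Proof. by rewrite !pull_opM; apply: eq_pull_op => w; rewrite /= swap_swap. Qed.

Lemma R_opC u k l : R_op u k l = R_op u l k.
Proof. by rewrite /R_op /shift_op swap_opC. Qed.

Lemma R_letter_comm u M k l p : p != k -> p != l ->
  R_op u k l * letter_op M p = letter_op M p * R_op u k l.
Proof.
move=> pk pl; rewrite /R_op /shift_op mulrDl [RHS]mulrDr mul1r mulr1; congr (_ + _).
by rewrite -endo_scalerAl -endo_scalerAr swap_letter tpermD // eq_sym.
Qed.

Lemma R_comm u u' k l k' l' : k != k' -> k != l' -> l != k' -> l != l' ->
  R_op u k l * R_op u' k' l' = R_op u' k' l' * R_op u k l.
Proof.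
move=> h1 h2 h3 h4; apply: shift_comm => w /=.
by rewrite swap_swap !tpermD // eq_sym.
Qed.

Lemma R_yang_baxter a b c i j l :
  i != j -> i != l -> j != l -> a != b -> a != c -> b != c ->
  R_op (c - b) i j * R_op (c - a) i l * R_op (b - a) j l
  = R_op (b - a) j l * R_op (c - a) i l * R_op (c - b) i j.
Proof.
move=> ij il jl ab ac bc.
have [ji li lj] : [/\ j != i, l != i & l != j] by split; rewrite eq_sym.
apply: yang_baxter.
- by rewrite swap_op_conj tpermL tpermD // (swap_opC l j).
- by rewrite swap_op_conj tpermR tpermD.
- by rewrite [RHS]swap_op_conj tpermL tpermD.
- by rewrite [RHS]swap_op_conj tpermR tpermD // (swap_opC j i).
- have h1 : c - b != 0 by rewrite subr_eq0 eq_sym.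
  have h2 : c - a != 0 by rewrite subr_eq0 eq_sym.
  have h3 : b - a != 0 by rewrite subr_eq0 eq_sym.
  by field; rewrite h1 h2 h3.
Qed.

Section Evaluation.
Variables (e : gl_module n V) (x : K).

Definition E_op k : endo tensor := letter_op (fun a b => e b a) k.
Definition T_op u k : endo tensor := 1 + (u - x)^-1 *: E_op k.

Lemma T_opE u k phi w :
  T_op u k phi w = phi w + (u - x)^-1 *: \sum_b e b (w k) (phi (set_letter w k b)).
Proof. by rewrite /T_op endoDE endo1E endoZE !ffunE. Qed.

Lemma set_letterC w k l b d : k != l ->
  set_letter (set_letter w k b) l d = set_letter (set_letter w l d) k b.
Proof.
move=> kl; apply/ffunP => p; rewrite !ffunE.
by case: eqP => [->|//]; rewrite eq_sym (negbTE kl).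
Qed.

Lemma swap_set2 k l w b : k != l ->
  set_letter (swap k l w) k b = set_letter (set_letter w k b) l (w k).
Proof.
move=> kl; apply/ffunP => p; rewrite !ffunE.
case: (eqVneq p k) => [->|pk]; first by rewrite (negbTE kl).
case: (eqVneq p l) => [->|pl]; first by rewrite tpermR.
by rewrite tpermD // eq_sym.
Qed.

(** The commutation relations of gl_n in matrix form. *)
Lemma E_op_comm k l : k != l ->
  E_op k * E_op l - E_op l * E_op k
  = swap_op k l * E_op k - swap_op k l * E_op l.
Proof.
move=> kl; apply: endoP => phi; rewrite !(endoDE, endoNE, endoME).
apply/ffunP => w.
have lk : l != k by rewrite eq_sym.
have -> : (E_op k (E_op l phi) - E_op l (E_op k phi)) w
  = E_op k (E_op l phi) w - E_op l (E_op k phi) w by rewrite !ffunE.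
have -> : (swap_op k l (E_op k phi) - swap_op k l (E_op l phi)) w
  = swap_op k l (E_op k phi) w - swap_op k l (E_op l phi) w by rewrite !ffunE.
rewrite !pull_opE !letter_opE.
transitivity (\sum_b \sum_d (e b (w k) * e d (w l) - e d (w l) * e b (w k) : endo V)
                (phi (set_letter (set_letter w k b) l d))).
  have -> : \sum_b e b (w k) (E_op l phi (set_letter w k b))
     = \sum_b \sum_d (e b (w k) * e d (w l) : endo V)
          (phi (set_letter (set_letter w k b) l d)).
    apply: eq_bigr => b _; rewrite letter_opE linear_sum; apply: eq_bigr => d _.
    by rewrite endoME ffunE (negbTE lk).
  have -> : \sum_b e b (w l) (E_op k phi (set_letter w l b))
     = \sum_b \sum_d (e d (w l) * e b (w k) : endo V)
          (phi (set_letter (set_letter w k b) l d)).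
    rewrite exchange_big; apply: eq_bigr => d _.
    rewrite letter_opE linear_sum; apply: eq_bigr => b _.
    by rewrite endoME ffunE (negbTE kl) set_letterC.
  rewrite -sumrB; apply: eq_bigr => b _; rewrite -sumrB; apply: eq_bigr => d _.
  by rewrite endoDE endoNE.
under eq_bigr do under eq_bigr do rewrite (gl_opP e) endoDE endoNE.
under eq_bigr do rewrite sumrB.
rewrite sumrB; congr (_ - _).
  apply: eq_bigr => b _; rewrite (bigD1 (w k)) //= eqxx mulr1n big1 ?addr0.
    by rewrite swapL swap_set2.
  by move=> d /negbTE dk; rewrite eq_sym dk mulr0n endo0E.
rewrite exchange_big; apply: eq_bigr => d _.
rewrite (bigD1 (w l)) //= eqxx mulr1n big1 ?addr0.
  rewrite swapR swapC swap_set2 //; congr (_ (phi _)); rewrite set_letterC //.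
by move=> b /negbTE bl; rewrite bl mulr0n endo0E.
Qed.

(** The RTT relation in the evaluation module. *)
Lemma T_T_R u t k l : k != l -> u != t -> u != x -> t != x ->
  T_op t l * T_op u k * R_op (u - t) k l = R_op (u - t) k l * T_op u k * T_op t l.
Proof.
move=> kl ut ux tx; apply/esym/rtt_relation.
- by rewrite swap_letter tpermL.
- by rewrite swap_letter tpermR.
- exact: E_op_comm.
have h1 : u - x != 0 by rewrite subr_eq0.
have h2 : t - x != 0 by rewrite subr_eq0.
have h3 : u - t != 0 by rewrite subr_eq0.
by field; rewrite h1 h2 h3.
Qed.

Lemma T_R_comm u u' k l p : p != k -> p != l ->
  T_op u p * R_op u' k l = R_op u' k l * T_op u p.
Proof.
move=> pk pl; rewrite /T_op mulrDl [RHS]mulrDr mul1r mulr1; congr (_ + _).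
by rewrite -endo_scalerAl -endo_scalerAr R_letter_comm.
Qed.

End Evaluation.
End WordOperators.

(** * Tensor operators as operators on functions of words *)

Section TensorAction.
Variables (K : fieldType) (V : lmodType K) (n m : nat).
Local Notation word := (multiindex n m).
Local Notation tensor := {ffun word -> V}.
Implicit Types (X Y : tensor_op V n m) (k l : 'I_m).

Definition act_tensor X (phi : tensor) : tensor :=
  [ffun w : word => \sum_w' entry X w w' (phi w')].

Lemma act_tensor_is_linear X : linear (act_tensor X).
Proof.
move=> a f h; apply/ffunP => w; rewrite !ffunE scaler_sumr -big_split /=.
by apply: eq_bigr => b _; rewrite !ffunE linearP.
Qed.

HB.instance Definition _ X :=
  GRing.isLinear.Build K tensor tensor _ (act_tensor X) (act_tensor_is_linear X).

Definition action X : endo tensor := act_tensor X.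

Lemma actionE X phi w : action X phi w = \sum_w' entry X w w' (phi w').
Proof. by rewrite /action /act_tensor /= ffunE. Qed.

Lemma action1 : action 1 = 1.
Proof.
apply: endoP => phi; rewrite endo1E; apply/ffunP => w; rewrite actionE.
rewrite (bigD1 w) //= /entry mxE eqxx endo1E big1 ?addr0 // => w' ww'.
by rewrite mxE (inj_eq enum_rank_inj) eq_sym (negbTE ww') endo0E.
Qed.

Lemma actionM X Y : action (X * Y) = action X * action Y.
Proof.
apply: endoP => phi; rewrite endoME; apply/ffunP => w; rewrite !actionE.
transitivity (\sum_w' \sum_w'' entry X w w'' (entry Y w'' w' (phi w'))).
  apply: eq_bigr => w' _; rewrite /entry mxE endo_sumE.
  rewrite (reindex (@enum_rank word)) /=; last by apply: onW_bij; apply: enum_rank_bij.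
    by apply: eq_bigr => w'' _; rewrite endoME.
rewrite exchange_big; apply: eq_bigr => w'' _.
by rewrite actionE linear_sum.
Qed.

Lemma action_prod (I : Type) (s : seq I) (F : I -> tensor_op V n m) :
  action (\prod_(i <- s) F i) = \prod_(i <- s) action (F i).
Proof. exact: (big_morph action actionM action1). Qed.

Lemma action_in_factor k L : action (in_factor k L) = letter_op L k.
Proof.
apply: endoP => phi; apply/ffunP => w; rewrite actionE letter_opE.
rewrite (bigID [pred w' : word | [forall p, (p != k) ==> (w p == w' p)]]) /=.
rewrite [X in _ + X]big1 ?addr0; last first.
  by move=> w' /negbTE h; rewrite /entry !mxE !enum_rankK h endo0E.
rewrite (reindex_onto (set_letter w k) (fun w' : word => w' k)) /=; last first.
  move=> w' /forallP h; apply/ffunP => p; rewrite ffunE; case: eqP => [->|/eqP pk] //.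
  by apply/eqP/(implyP (h p)).
apply: eq_big => [b|b _].
  have -> : set_letter w k b k = b by rewrite ffunE eqxx.
  rewrite eqxx andbT; apply/forallP => p; rewrite ffunE.
  by case: eqP => //=; rewrite eqxx.
rewrite /entry !mxE !enum_rankK ifT; first by rewrite ffunE eqxx.
by apply/forallP => p; rewrite ffunE; case: eqP => //= _; rewrite eqxx.
Qed.

Lemma action_R k l u : k != l -> action (in_factors V k l (Rmatrix u)) = R_op V n u k l.
Proof.
move=> kl; apply: endoP => phi; apply/ffunP => w; rewrite actionE shift_opE.
have ent w' : entry (in_factors V k l (Rmatrix u)) w w'
   = ((w' == w)%:R + u^-1 * (w' == swap k l w)%:R) *: (1 : endo V).
  rewrite /entry !mxE !enum_rankK; case: ifP => [/forallP h|/negbT].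
    congr (_ *: _); rewrite /Rmatrix -!natrM !mulnb; congr (_%:R + _ * _%:R).
      apply/esym; congr nat_of_bool; apply/eqP/andP => [->|[/eqP e1 /eqP e2]]; first by rewrite !eqxx.
      apply/ffunP => p; case: (eqVneq p k) => [->|pk] //; case: (eqVneq p l) => [->|pl] //.
      by apply/esym/eqP/(implyP (h p)); rewrite pk pl.
    apply/esym; congr nat_of_bool; apply/eqP/andP => [->|[/eqP e1 /eqP e2]].
      by rewrite swapL swapR !eqxx.
    apply/ffunP => p; case: (eqVneq p k) => [->|pk]; first by rewrite swapL.
    case: (eqVneq p l) => [->|pl]; first by rewrite swapR.
    rewrite swapD 1?eq_sym //; apply/esym/eqP/(implyP (h p)); rewrite pk pl //.
  rewrite negb_forall => /existsP[p]; rewrite negb_imply => /andP[/andP[pk pl] wp].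
  rewrite [w' == w](_ : _ = false); last by apply: contraNF wp => /eqP ->.
  rewrite [w' == _](_ : _ = false) ?mulr0 ?addr0 ?scale0r //.
  by apply: contraNF wp => /eqP ->; rewrite swapD // eq_sym.
under eq_bigr do rewrite ent endoZE endo1E scalerDl -scalerA.
rewrite big_split /= -scaler_sumr; congr (_ + _ *: _).
  rewrite (bigD1 w) //= eqxx scale1r big1 ?addr0 // => w' /negbTE ->.
  by rewrite scale0r.
rewrite (bigD1 (swap k l w)) //= eqxx scale1r big1 ?addr0 // => w' /negbTE ->.
by rewrite scale0r.
Qed.

Lemma action_T (e : gl_module n V) (x u : K) k : u != x ->
  action (in_factor k (current (eval_module e x) u)) = T_op (P := 'I_m) e x u k.
Proof.
move=> ux; rewrite action_in_factor; apply: endoP => phi; apply/ffunP => w.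
rewrite letter_opE T_opE.
under eq_bigr do rewrite eval_current // endoDE endoZE.
rewrite big_split /= -scaler_sumr; congr (_ + _).
rewrite (bigD1 (w k)) //= eqxx endo1E big1 ?addr0.
  by congr (phi _); apply/ffunP => p; rewrite ffunE; case: eqP => [->|].
by move=> b /negbTE bk; rewrite eq_sym bk endo0E.
Qed.

End TensorAction.

(** * Reordering of the nested product *)

Section RProducts.
Variables (K : fieldType) (V : lmodType K) (n : nat) (P : finType) (t : P -> K).
Local Notation word := {ffun P -> 'I_n}.
Local Notation tensor := {ffun word -> V}.
Implicit Types (p q k l : P) (s : seq P) (w : word).

Definition Rx p q : endo tensor := R_op V n (t p - t q) p q.

Definition R_block s s' : endo tensor := \prod_(p <- s) \prod_(q <- rev s') Rx p q.

Lemma RxE p q (phi : tensor) w :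
  Rx p q phi w = phi w + (t p - t q)^-1 *: phi (swap p q w).
Proof. exact: shift_opE. Qed.

(** Exchanges preserving a set S of words only see the values on S. This
    allows replacing a function by another one that is only equal to it on the
    words that occur. *)
Lemma R_block_local (S : pred word) s s' (phi psi : tensor) :
  (forall p q w, p \in s -> q \in s' -> S w -> S (swap p q w)) ->
  (forall w, S w -> phi w = psi w) ->
  forall w, S w -> R_block s s' phi w = R_block s s' psi w.
Proof.
rewrite /R_block => HS; elim: s HS phi psi => [|p s IH] HS phi psi e w Sw.
  by rewrite !big_nil !endo1E e.
rewrite !big_cons !endoME.
have {}IH := IH (fun p' q w h => HS p' q w (mem_behead (s := p :: s) h)) phi psi e.
move: (_ phi) (_ psi) IH => phi' psi' {}e.
have : {subset rev s' <= s'} by move=> q; rewrite mem_rev.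
elim: (rev s') w Sw => [|q r IHr] w Sw sub; first by rewrite !big_nil !endo1E e.
rewrite !big_cons !endoME !RxE !IHr //; do ?[by move=> j jr; apply: sub; rewrite inE jr orbT].
by apply: HS => //; [rewrite inE eqxx | apply: sub; rewrite inE eqxx].
Qed.

Lemma disjointP s s' p q : ~~ has (mem s) s' -> p \in s -> q \in s' -> p != q.
Proof. by move=> /hasPn h ps qs; apply: contraNneq (h q qs) => <-. Qed.

Section Frozen.
Variables (theta : 'I_n) (s3 s1 : seq P) (phi : tensor).
Hypothesis s31 : ~~ has (mem s3) s1.
Hypothesis phi0 : forall (w : word) l, l \in s1 -> w l = theta -> phi w = 0.

(** An exchange of p and l brings theta to l; the other exchanges with l then
    give zero, by induction, as psi does. *)
Lemma frozen_column l s (psi : tensor) w : {subset s <= s3} -> l \in s1 -> uniq s ->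
  (forall w : word, w l = theta -> psi w = 0) ->
  {in s, forall p, w p = theta} ->
  (\prod_(p <- s) Rx p l) psi w = if w l == theta then 0 else psi w.
Proof.
move=> sub ls1 us psi0; elim: s sub us w => [|p s IH] sub us w e.
  by rewrite big_nil endo1E; case: eqP => // /psi0.
case/andP: us => ps us.
have {}sub : {subset s <= s3} by move=> q qs; apply: sub; rewrite inE qs orbT.
have wp : w p = theta by apply: e; rewrite inE eqxx.
have ws : {in s, forall q, w q = theta} by move=> q qs; apply: e; rewrite inE qs orbT.
rewrite big_cons endoME RxE !IH //; last first.
  move=> q qs; have lq : l != q by rewrite eq_sym (disjointP s31) // sub.
  by rewrite swapD ?ws //; apply: contraNneq ps => ->.
rewrite swapR wp eqxx; case: eqP => _; by rewrite ?scaler0 addr0.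
Qed.

(** When all sites of s3 carry the letter theta, an exchange with a site of s1
    moves a letter theta to s1. Once the columns are separated ([grid_swap]),
    it is seen that this letter stays in s1, where phi vanishes. *)
Lemma frozen_columns w : uniq s3 -> uniq s1 ->
  {in s3, forall p, w p = theta} -> {in s1, forall l, w l != theta} ->
  R_block s3 s1 phi w = phi w.
Proof.
move=> u3 u1; rewrite /R_block grid_swap ?rev_uniq //; last first.
  move=> p p' q q' hp hp'; rewrite !mem_rev => hq hq' pp' qq'.
  apply: R_comm => //.
  - exact: (disjointP s31).
  - by rewrite eq_sym (disjointP s31).
move=> w3 w1; have : {subset rev s1 <= s1} by move=> l; rewrite mem_rev.
have : uniq (rev s1) by rewrite rev_uniq.
elim: (rev s1) => [|l s IH] us sub; first by rewrite big_nil endo1E.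
case/andP: us => ls us.
have ls1 : l \in s1 by apply: sub; rewrite inE eqxx.
have {}sub : {subset s <= s1} by move=> q qs; apply: sub; rewrite inE qs orbT.
rewrite big_cons endoME frozen_column //; first by rewrite (negbTE (w1 _ ls1)) IH.
move=> w' w'l; move: (sub) ls {us IH}; elim: s {sub} w' w'l => [|q s IH] w' w'l sub ls.
  by rewrite big_nil endo1E; apply: phi0 w'l.
move: ls; rewrite inE negb_or => /andP[lq ls].
have {}IH w'' : w'' l = theta -> (\prod_(j <- s) \prod_(i <- s3) Rx i j) phi w'' = 0.
  by move=> h; apply: IH => // j js; apply: sub; rewrite inE js orbT.
rewrite big_cons endoME; move: (_ phi) IH => psi psi0.
have : {subset s3 <= s3} by [].
elim: {1 3}s3 w' w'l => [|p r IHr] w' w'l sub3; first by rewrite big_nil endo1E psi0.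
have {}IHr := fun w'' h => IHr w'' h (fun i ir => sub3 i (mem_behead (s := p :: r) ir)).
rewrite big_cons endoME RxE !IHr ?scaler0 ?addr0 // swapD // 1?eq_sym //.
by rewrite eq_sym (disjointP s31) // sub3 ?inE ?eqxx.
Qed.

End Frozen.
End RProducts.

Section OperatorIdentity.
Variables (K : fieldType) (V : lmodType K) (n : nat) (P : finType) (t : P -> K).
Variables (e : gl_module n V) (x : K).
Local Notation R_block := (R_block V n t).
Local Notation Rx := (Rx V n t).
Implicit Types (p q k l : P) (s : seq P).

Definition Tx p := T_op (P := P) e x (t p) p.
Definition T_block s := \prod_(p <- s) Tx p.

Variables s1 s2 s3 : seq P.
Hypothesis us : uniq (s1 ++ s2 ++ s3).
Hypothesis tI : {in s1 ++ s2 ++ s3, forall p, t p != x}.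
Hypothesis t21 : {in s2 & s1, forall p q, t p != t q}.
Hypothesis t31 : {in s3 & s1, forall p q, t p != t q}.
Hypothesis t32 : {in s3 & s2, forall p q, t p != t q}.

Let u1 : uniq s1. Proof. by move: us; rewrite cat_uniq => /and3P[]. Qed.
Let u2 : uniq s2. Proof. by move: us; rewrite !cat_uniq => /and5P[]. Qed.
Let u3 : uniq s3. Proof. by move: us; rewrite !cat_uniq => /and5P[]. Qed.
Let d12 p q : p \in s1 -> q \in s2 -> p != q.
Proof.
move: us; rewrite cat_uniq has_cat negb_or => /and3P[_ /andP[h _] _].
exact: (disjointP h).
Qed.
Let d13 p q : p \in s1 -> q \in s3 -> p != q.
Proof.
move: us; rewrite cat_uniq has_cat negb_or => /and3P[_ /andP[_ h] _].
exact: (disjointP h).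
Qed.
Let d23 p q : p \in s2 -> q \in s3 -> p != q.
Proof. by move: us; rewrite !cat_uniq => /and5P[_ _ _ h _]; apply: (disjointP h). Qed.
Let tx1 p : p \in s1 -> t p != x. Proof. by move=> h; apply: tI; rewrite mem_cat h. Qed.
Let tx2 p : p \in s2 -> t p != x. Proof. by move=> h; apply: tI; rewrite !mem_cat h orbT. Qed.
Let tx3 p : p \in s3 -> t p != x. Proof. by move=> h; apply: tI; rewrite !mem_cat h !orbT. Qed.

Lemma T_T_block sa sb : uniq sa -> uniq sb ->
  (forall p q, p \in sa -> q \in sb -> p != q) ->
  {in sb & sa, forall p q, t p != t q} ->
  {in sa, forall p, t p != x} -> {in sb, forall p, t p != x} ->
  T_block sa * T_block sb * R_block sb sa = R_block sb sa * T_block sb * T_block sa.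
Proof.
move=> ua ub dab tba txa txb; apply: exchange_block => //.
- move=> l k hl hk; apply: T_T_R.
  + by rewrite eq_sym dab.
  + exact: tba.
  + exact: txb.
  + exact: txa.
- move=> l l' k hl hl' hk ll'; apply: T_R_comm => //; exact: dab.
- by move=> l k k' hl hk hk' kk'; apply: T_R_comm => //; rewrite eq_sym dab.
Qed.

Lemma T_R_block_comm sa sb sc :
  (forall p q, p \in sa -> q \in sb -> p != q) ->
  (forall p q, p \in sa -> q \in sc -> p != q) ->
  T_block sa * R_block sb sc = R_block sb sc * T_block sa.
Proof.
move=> dab dac; apply: prod_comm => p hp; apply: prod_comm => q.
rewrite mem_rev => hq; apply/esym/prod_comm => k hk; apply/esym.
by apply: T_R_comm; [apply: dab | apply: dac].
Qed.

(** For each site of s3, the R-matrices with the blocks s2 and s1 play the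
    part of T in an RTT relation for which R21 is the exchange operator. *)
Lemma R_block_yang_baxter :
  R_block s3 s2 * R_block s3 s1 * R_block s2 s1
  = R_block s2 s1 * R_block s3 s1 * R_block s3 s2.
Proof.
have Rcol : R_block s2 s1 = \prod_(l <- rev s1) \prod_(j <- s2) Rx j l.
  transitivity (\prod_(p <- s2) \prod_(l <- rev s1) Rx p l); first by [].
  rewrite grid_swap ?rev_uniq //.
  move=> p p' q q' hp hp'; rewrite !mem_rev => hq hq' pp' qq'.
  by apply: R_comm => //; [rewrite eq_sym d12 | rewrite d12].
have split_comm sa sb : (forall p q, p \in s3 -> q \in sa -> p != q) ->
    (forall p q, p \in s3 -> q \in sb -> p != q) ->
    (forall p q, p \in sa -> q \in sb -> p != q) ->
    R_block s3 sa * R_block s3 sb = \prod_(i <- s3)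
      ((\prod_(q <- rev sa) Rx i q) * (\prod_(q <- rev sb) Rx i q)).
  move=> d3a d3b dab; apply: prod_split => // i i' hi hi' ii'.
  apply: prod_comm => q; rewrite mem_rev => hq; apply/esym/prod_comm => p.
  rewrite mem_rev => hp; apply: R_comm.
  - by rewrite eq_sym.
  - exact: d3a.
  - by rewrite eq_sym d3b.
  - by rewrite eq_sym dab.
have d31 p q : p \in s3 -> q \in s1 -> p != q by move=> hp hq; rewrite eq_sym d13.
have d32 p q : p \in s3 -> q \in s2 -> p != q by move=> hp hq; rewrite eq_sym d23.
have d21 p q : p \in s2 -> q \in s1 -> p != q by move=> hp hq; rewrite eq_sym d12.
rewrite (split_comm s2 s1) // -(mulrA (R_block s2 s1)) (split_comm s1 s2) //.
apply/esym; apply: prod_intertwine => i hi.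
rewrite Rcol mulrA; apply/esym.
have := @exchange_block _ _ _ (rev s2) (rev s1) (Rx i) (Rx i) (fun j l => Rx j l).
rewrite !rev_uniq revK; apply=> //.
- move=> j l; rewrite !mem_rev => hj hl.
  apply: R_yang_baxter.
  + exact: d32.
  + exact: d31.
  + exact: d21.
  + by rewrite eq_sym t21.
  + by rewrite eq_sym t31.
  + by rewrite eq_sym t32.
- move=> j j' l; rewrite !mem_rev => hj hj' hl jj'.
  by apply: R_comm => //; [exact: d32 | exact: d31 | exact: d21].
- move=> j l l'; rewrite !mem_rev => hj hl hl' ll'.
  by apply: R_comm => //; [exact: d32 | exact: d31 | exact: d12].
Qed.

(** The Yang-Baxter relation puts R21 and R31 next to T1 T2 and T1 T3, and the
    RTT relation then moves T1 to the right. The point of this form is that T1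
    acts first and R21 last, and that R31 acts right after T3: there, the row
    letters of the sites in block 3 are all equal to 3 (see [nested_sum]). *)
Theorem nested_reorder :
  T_block s1 * T_block s2 * T_block s3
    * R_block s3 s2 * R_block s3 s1 * R_block s2 s1
  = R_block s2 s1 * T_block s2 * R_block s3 s1 * T_block s3 * R_block s3 s2
    * T_block s1.
Proof.
have d31 p q : p \in s3 -> q \in s1 -> p != q by move=> hp hq; rewrite eq_sym d13.
have d32 p q : p \in s3 -> q \in s2 -> p != q by move=> hp hq; rewrite eq_sym d23.
rewrite -!mulrA (mulrA (R_block s3 s2)) R_block_yang_baxter !mulrA.
rewrite -(mulrA _ (T_block s3) (R_block s2 s1)) (T_R_block_comm d32 d31) !mulrA.
rewrite (T_T_block u1 u2 d12 t21) //.
rewrite -!mulrA; congr (_ * (_ * _)); rewrite !mulrA.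
rewrite (T_T_block u1 u3 d13 t31) //.
by rewrite -!mulrA (T_R_block_comm d13 d12).
Qed.

End OperatorIdentity.

(** * Matrix elements between words *)

Lemma endo_combination (K : fieldType) (V : lmodType K) (f : endo V) (I : finType)
    (c : I -> K) (F : I -> V) :
  f (\sum_i c i *: F i) = \sum_i c i *: f (F i).
Proof. by rewrite linear_sum; apply: eq_bigr => i _; rewrite linearZ. Qed.

Section PureTensors.
Variables (K : fieldType) (V : lmodType K) (X : finType).

Definition pure_tensor (rho : {ffun X -> K^o}) (v : V) : {ffun X -> V} :=
  [ffun w => rho w *: v].
Definition indicator (J : X) : {ffun X -> K^o} := [ffun w => (w == J)%:R].

Lemma pure_tensorE rho v w : pure_tensor rho v w = rho w *: v.
Proof. by rewrite ffunE. Qed.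

Lemma pure_tensor_sum rho v :
  pure_tensor rho v = \sum_J rho J *: pure_tensor (indicator J) v.
Proof.
apply/ffunP => w; rewrite ffunE sum_ffunE (bigD1 w) //= big1 ?addr0.
  by rewrite !ffunE eqxx scale1r.
by move=> J /negbTE Jw; rewrite !ffunE eq_sym Jw scale0r scaler0.
Qed.

Lemma shift_pure_tensor c g rho v :
  shift_op V c g (pure_tensor rho v) = pure_tensor (shift_op K^o c g rho) v.
Proof.
apply/ffunP => w; rewrite shift_opE !pure_tensorE shift_opE scalerDl.
by rewrite scalerA.
Qed.

Lemma prod_pure_tensor (I : Type) (s : seq I) (f : I -> endo {ffun X -> V})
    (g : I -> endo {ffun X -> K^o}) rho v :
  (forall i rho, f i (pure_tensor rho v) = pure_tensor (g i rho) v) ->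
  (\prod_(i <- s) f i) (pure_tensor rho v) = pure_tensor ((\prod_(i <- s) g i) rho) v.
Proof.
move=> fg; elim: s rho => [|i s IH] rho; first by rewrite !big_nil !endo1E.
by rewrite !big_cons !endoME IH fg.
Qed.

End PureTensors.

Section TProducts.
Variables (K : fieldType) (V : lmodType K) (n : nat) (P : finType) (t : P -> K).
Variables (e : gl_module n V) (x : K).
Local Notation word := {ffun P -> 'I_n}.
Local Notation tensor := {ffun word -> V}.
Implicit Types (p q k l : P) (s : seq P) (w J : word).
Local Notation T_block := (T_block t e x).
Local Notation Tx := (Tx t e x).

Definition T_entry p (a b : 'I_n) : endo V :=
  (a == b)%:R + (t p - x)^-1 *: e b a.

Lemma TxE p (phi : tensor) w :
  Tx p phi w = \sum_b T_entry p (w p) b (phi (set_letter w p b)).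
Proof.
rewrite T_opE; under [RHS]eq_bigr do rewrite endoDE endoZE.
rewrite big_split /= -scaler_sumr; congr (_ + _).
rewrite (bigD1 (w p)) //= eqxx endo1E big1 ?addr0.
  by congr (phi _); apply/ffunP => q; rewrite ffunE; case: eqP => [->|].
by move=> b /negbTE bk; rewrite eq_sym bk endo0E.
Qed.

Lemma T_block_local (S : pred word) s (phi psi : tensor) :
  (forall p w b, p \in s -> S w -> S (set_letter w p b)) ->
  (forall w, S w -> phi w = psi w) ->
  forall w, S w -> T_block s phi w = T_block s psi w.
Proof.
rewrite !/(T_block _); elim: s => [|p s IH] HS eq w Sw.
  by rewrite !big_nil !endo1E eq.
rewrite !big_cons !endoME !TxE; apply: eq_bigr => b _; congr (T_entry _ _ _ _).
apply: IH => // [q w' b' qs|]; first by apply: HS; rewrite inE qs orbT.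
by apply: HS; rewrite // inE eqxx.
Qed.

Definition agree_off s w J := [forall p, (p \notin s) ==> (w p == J p)].

(** Each factor of T changes the letter of its own site only. *)
Lemma T_block_indicator s J v w : uniq s ->
  T_block s (pure_tensor (indicator K J) v) w
  = if agree_off s w J then (\prod_(p <- s) T_entry p (w p) (J p) : endo V) v else 0.
Proof.
rewrite !/(T_block _); elim: s w => [|p s IH] w /= us.
  rewrite !big_nil !endo1E !ffunE.
  have -> : agree_off [::] w J = (w == J).
    apply/forallP/eqP => [h|-> q]; last by rewrite eqxx.
    by apply/ffunP => q; have /eqP := h q.
  by case: eqP; rewrite ?scale1r ?scale0r.
case/andP: us => ps us.
rewrite !big_cons endoME TxE (bigD1 (J p)) //= IH // [X in _ + X]big1 ?addr0.
  have -> : agree_off s (set_letter w p (J p)) J = agree_off (p :: s) w J.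
    apply: eq_forallb => q; rewrite inE negb_or ffunE.
    by case: (q =P p) => [->|]; rewrite ?eqxx ?implybT.
  case: ifP => _; last by rewrite linear0.
  rewrite endoME; congr (T_entry _ _ _ _).
  have -> // : \prod_(q <- s) T_entry q (set_letter w p (J p) q) (J q)
     = \prod_(q <- s) T_entry q (w q) (J q).
  apply: eq_big_seq => q qs.
  by rewrite ffunE; case: eqP => // qp; rewrite -qp qs in ps.
move=> b bJ; rewrite IH // ifN ?linear0 //; apply/negP => /forallP/(_ p).
by rewrite ps /= ffunE eqxx (negbTE bJ).
Qed.

End TProducts.

Section NestedSum.
Variables (K : fieldType) (V : lmodType K) (P : finType) (t : P -> K).
Variables (e : gl_module 4 V) (x : K) (v : V) (Lam : 'I_4 -> K).
Hypothesis sing : singular e Lam v.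
Local Notation word := {ffun P -> 'I_4}.
Local Notation T_block := (T_block t e x).
Local Notation T_entry := (T_entry t e x).
Local Notation R_block W := (R_block W 4 t).
Implicit Types (p q k l : P) (s : seq P) (w I J : word).

Lemma lblE a : (0 < a <= 4)%N -> (lbl a : nat) = a.-1.
Proof. by case: a => // a /= h; rewrite /lbl inordK. Qed.

Lemma lbl_eq a b : (0 < a <= 4)%N -> (0 < b <= 4)%N -> (lbl a == lbl b) = (a == b).
Proof.
move=> ha hb; rewrite -val_eqE /= !lblE //.
by case: a b ha hb => [|a] [|b].
Qed.

(** The commutator of e23 with e2a is a multiple of e23, so that e23 kills all
    the vectors obtained from v by the operators e2a; a factor e23 occurs
    because w l = 3. *)
Lemma raising_kills s w l : l \in s -> w l = lbl 3 ->
  (\prod_(p <- s) T_entry p (w p) (lbl 2) : endo V) v = 0.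
Proof.
have e23 s' : e (lbl 2) (lbl 3) ((\prod_(p <- s') T_entry p (w p) (lbl 2) : endo V) v) = 0.
  elim: s' => [|p s' IH].
    by rewrite big_nil endo1E; apply: (proj1 sing); rewrite !lblE.
  rewrite big_cons endoME; move: (_ v) IH => u IH.
  rewrite !/(T_entry _ _ _) endoDE endoZE linearD linearZ /=.
  have -> : e (lbl 2) (lbl 3) (e (lbl 2) (w p) u) = - (e (lbl 2) (lbl 3) u *+ (lbl 2 == w p)).
    have : (e (lbl 2) (lbl 3) * e (lbl 2) (w p) - e (lbl 2) (w p) * e (lbl 2) (lbl 3)
            : endo V) u = (e (lbl 2) (w p) *+ (lbl 3 == lbl 2)
                           - e (lbl 2) (lbl 3) *+ (lbl 2 == w p) : endo V) u.
      by rewrite gl_opP.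
    rewrite lbl_eq // mulr0n sub0r !(endoDE, endoNE, endoME) IH linear0 subr0 => ->.
    by case: (lbl 2 == w p); rewrite ?mulr1n ?mulr0n ?endo0E ?IH.
  rewrite IH mul0rn oppr0 scaler0 addr0.
  by case: (w p == lbl 2); rewrite ?endo1E ?endo0E ?linear0.
move=> ls wl; elim: s ls => // p s IH; rewrite inE big_cons endoME => /orP[/eqP <-|ls].
  rewrite wl !/(T_entry _ _ _) endoDE endoZE e23 scaler0 addr0 lbl_eq //= endo0E //.
by rewrite IH // linear0.
Qed.

Variables s1 s2 s3 : seq P.
Hypothesis us : uniq (s1 ++ s2 ++ s3).
Hypothesis cover : forall p, p \in s1 ++ s2 ++ s3.
Hypothesis tI : forall p, t p != x.
Hypothesis t21 : {in s2 & s1, forall p q, t p != t q}.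
Hypothesis t31 : {in s3 & s1, forall p q, t p != t q}.
Hypothesis t32 : {in s3 & s2, forall p q, t p != t q}.

Variables row col : word.
Hypothesis row1 : {in s1, forall p, row p = lbl 1}.
Hypothesis row2 : {in s2, forall p, row p = lbl 2}.
Hypothesis row3 : {in s3, forall p, row p = lbl 3}.
Hypothesis col1 : {in s1, forall p, col p = lbl 2}.

Let u1 : uniq s1. Proof. by move: us; rewrite cat_uniq => /and3P[]. Qed.
Let u2 : uniq s2. Proof. by move: us; rewrite !cat_uniq => /and5P[]. Qed.
Let u3 : uniq s3. Proof. by move: us; rewrite !cat_uniq => /and5P[]. Qed.
Let d12 p q : p \in s1 -> q \in s2 -> p != q.
Proof.
move: us; rewrite cat_uniq has_cat negb_or => /and3P[_ /andP[h _] _].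
exact: (disjointP h).
Qed.
Let d13 p q : p \in s1 -> q \in s3 -> p != q.
Proof.
move: us; rewrite cat_uniq has_cat negb_or => /and3P[_ /andP[_ h] _].
exact: (disjointP h).
Qed.
Let d23 p q : p \in s2 -> q \in s3 -> p != q.
Proof. by move: us; rewrite !cat_uniq => /and5P[_ _ _ h _]; apply: (disjointP h). Qed.

Definition entries I J : V :=
  (\prod_(p <- s2) T_entry p (I p) (J p) : endo V)
    ((\prod_(p <- s3) T_entry p (I p) (J p) : endo V)
       ((\prod_(p <- s1) T_entry p (I p) (J p) : endo V) v)).

(** T1 v vanishes at the words with a letter 3 in block 1 ([raising_kills]),
    and the operators R32 and T3 do not touch the letters of block 1. *)
Lemma phi_vanishes w l : l \in s1 -> w l = lbl 3 ->
  T_block s3 (R_block V s3 s2 (T_block s1 (pure_tensor (indicator K col) v))) w = 0.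
Proof.
move=> ls wl; pose S : pred word := fun w => w l == lbl 3.
pose zero : {ffun word -> V} := 0.
have z0 w' : zero w' = 0 by rewrite ffunE.
have TZ s : T_block s zero = zero by rewrite linear0.
have RZ s s' : R_block V s s' zero = zero by rewrite linear0.
have h1 w' : S w' -> T_block s1 (pure_tensor (indicator K col) v) w' = zero w'.
  move=> /eqP w'l; rewrite T_block_indicator // z0; case: ifP => // _.
  rewrite -(raising_kills ls w'l).
  have -> // : \prod_(p <- s1) T_entry p (w' p) (col p)
     = \prod_(p <- s1) T_entry p (w' p) (lbl 2).
  by apply: eq_big_seq => p ps; rewrite col1.
have h2 w' : S w' -> R_block V s3 s2 (T_block s1 (pure_tensor (indicator K col) v)) w' = zero w'.
  rewrite -(RZ s3 s2); apply: R_block_local h1 w' => p q w' ps qs.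
  by rewrite /S swapD //; rewrite eq_sym; [exact: d13 | exact: d12].
rewrite -[RHS](z0 w) -(TZ s3); apply: (T_block_local t e x (S := S)) => //; last exact/eqP.
by move=> p w' b ps; rewrite /S ffunE ifN //; exact: d13.
Qed.

(** R31 is replaced by the identity: the words that occur have letters 3 in
    block 3, since R21 and T2 leave them alone there, and letters different
    from 3 in block 1, since R21 only exchanges the letters 1 and 2 of blocks
    1 and 2. Then R32 acts on the column index, R21 on the row index, and the
    three blocks T are read off entry by entry. *)
Theorem nested_sum :
  (T_block s1 * T_block s2 * T_block s3
    * R_block V s3 s2 * R_block V s3 s1 * R_block V s2 s1)
     (pure_tensor (indicator K col) v) row
  = \sum_J (R_block K^o s3 s2 (indicator K col)) J
       *: R_block V s2 s1 [ffun I => entries I J] row.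
Proof.
have tI' : {in s1 ++ s2 ++ s3, forall p, t p != x} by move=> p _; apply: tI.
rewrite (nested_reorder e us tI' t21 t31 t32) !endoME.
set Phi := T_block s3 _.
pose S : pred word := fun w =>
  all (fun p => w p == lbl 3) s3 && all (fun p => w p != lbl 3) (s1 ++ s2).
pose S' : pred word := fun w =>
  all (fun p => w p == lbl 3) s3 && all (fun p => w p != lbl 3) s1.
have frozen w : S' w -> R_block V s3 s1 Phi w = Phi w.
  case/andP=> /allP h3 /allP h1.
  apply: (frozen_columns t (theta := lbl 3)) => //.
  - by apply/hasPn => p ps; apply/negP => ps3; move: (d13 ps ps3); rewrite eqxx.
  - by move=> w' l ls w'l; apply: phi_vanishes w'l.
  - by move=> p ps; apply/eqP/h3.
have SS w p q : p \in s2 -> q \in s1 -> S w -> S (swap p q w).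
  move=> ps qs /andP[/allP h3 /allP h12]; apply/andP; split; apply/allP => k ks.
    by rewrite swapD ?h3 //; [exact: d23 | exact: d13].
  rewrite ffunE; case: tpermP => [_|_|_ _]; apply: h12 => //.
    by rewrite mem_cat qs.
  by rewrite mem_cat ps orbT.
have Srow : S row.
  apply/andP; split; apply/allP => p ps; first by rewrite row3.
  by move: ps; rewrite mem_cat => /orP[/row1 ->|/row2 ->]; rewrite lbl_eq.
have step1 w : S w -> T_block s2 (R_block V s3 s1 Phi) w = T_block s2 Phi w.
  move=> Sw; apply: (T_block_local t e x (S := S')) => //; last first.
    by move: Sw => /andP[h3]; rewrite all_cat => /andP[h1 _]; rewrite /S' h3 h1.
  move=> p w' b ps /andP[/allP h3 /allP h1]; apply/andP; split; apply/allP => k ks.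
    by rewrite ffunE ifN ?h3 // eq_sym; exact: d23.
  by rewrite ffunE ifN ?h1 //; exact: d12.
rewrite (R_block_local t (fun p q w => @SS w p q) step1 Srow).
(* T1 is moved to the left of R32, so that R32 acts on the column index alone. *)
have comm : T_block s1 * R_block V s3 s2 = R_block V s3 s2 * T_block s1.
  by apply: T_R_block_comm; [exact: d13 | exact: d12].
rewrite /Phi -(endoME (R_block V s3 s2)) -comm endoME.
have -> : R_block V s3 s2 (pure_tensor (indicator K col) v)
        = pure_tensor (R_block K^o s3 s2 (indicator K col)) v.
  apply: prod_pure_tensor => p rho; apply: prod_pure_tensor => q rho'.
  exact: shift_pure_tensor.
rewrite pure_tensor_sum !endo_combination sum_ffunE; apply: eq_bigr => J _.
rewrite [LHS]ffunE; congr (_ *: _).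
suff -> : T_block s2 (T_block s3 (T_block s1 (pure_tensor (indicator K J) v)))
   = [ffun I => entries I J] by [].
apply/ffunP => w; rewrite ffunE.
transitivity (T_block (s2 ++ s3 ++ s1) (pure_tensor (indicator K J) v) w).
  by rewrite !/(T_block _) !big_cat /= !endoME.
have pe : perm_eq (s2 ++ s3 ++ s1) (s1 ++ s2 ++ s3).
  by rewrite perm_sym perm_catC -catA.
rewrite T_block_indicator; last by rewrite (perm_uniq pe).
rewrite ifT; last by apply/forallP => p; rewrite (perm_mem pe) cover.
by rewrite !big_cat /= !endoME.
Qed.

End NestedSum.

(** * Lowering operators and partition functions *)

Section Lowering.
Variables (K : numFieldType) (V : lmodType K) (P : eqType) (t : P -> K) (x : K).
Variables (f h : endo V) (u : V) (lam eta : K).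
Hypothesis hf : h * f = f * h - eta *: f.
Hypothesis hu : h u = lam *: u.
Hypothesis eta2 : eta * eta = 1.

Lemma cartan_power k : h ((f ^+ k : endo V) u) = (lam - eta * k%:R) *: (f ^+ k : endo V) u.
Proof.
elim: k => [|k IH]; first by rewrite expr0 endo1E mulr0 subr0.
rewrite exprS endoME.
have -> : h (f ((f ^+ k : endo V) u)) = (h * f : endo V) ((f ^+ k : endo V) u).
  by rewrite endoME.
rewrite hf endoDE endoNE endoME endoZE IH linearZ /= -scalerBl; congr (_ *: _).
by rewrite -natr1; ring.
Qed.

Lemma weight_product_rcons (c : K) k ls z b :
  weight_product c k (rcons ls (z, b))
  = weight_product c k ls * (if b then 1 else z + c - (k + count snd ls)%:R).
Proof.
elim: ls k => [|[y a] ls IH] k /=; first by rewrite addn0; case: b; ring.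
by case: a; rewrite IH ?addSnnS ?add1n // mulrA.
Qed.

(** The entry of T at one site: a lowering operator f off the diagonal, a
    Cartan element h on it. *)
Definition ladder (b : bool) (c : K) : endo V := if b then c *: f else 1 + c *: h.

(** Every h meets a vector f^k u, of weight lam - eta k. The sign eta = 1 or
    -1 treats together the pairs f = e43, h = e33 and f = e21, h = e22, where
    f lowers, respectively raises, the eigenvalue of h. *)
Lemma lowering_product (s : seq P) (a : P -> bool) : {in s, forall p, t p != x} ->
  (\prod_(p <- s) ladder (a p) (t p - x)^-1 : endo V) u
  = (\prod_(p <- s) (t p - x)^-1
     * (eta ^+ count (fun p => ~~ a p) s
        * weight_product (eta * (lam - x)) 0 [seq (eta * t p, a p) | p <- rev s]))
    *: (f ^+ count a s : endo V) u.
Proof.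
elim: s => [|p s IH] tx; first by rewrite !big_nil /= !mul1r expr0 scale1r.
rewrite !big_cons endoME IH; last by move=> q qs; apply: tx; rewrite inE qs orbT.
rewrite rev_cons map_rcons weight_product_rcons linearZ /=.
have px : t p - x != 0 by rewrite subr_eq0 tx ?inE ?eqxx.
have -> : count snd [seq (eta * t q, a q) | q <- rev s] = count a s.
  by rewrite count_map -[RHS]count_rev; apply: eq_count.
rewrite /ladder; case: (a p); rewrite ?endoDE ?endo1E endoZE /= ?add1n ?add0n.
  by rewrite exprS endoME scalerA; congr (_ *: _); ring.
rewrite cartan_power scalerA -[X in _ *: (X + _)]scale1r -scalerDl scalerA.
congr (_ *: _); rewrite exprS.
set W := weight_product _ _ _; set Q := \prod_(_ <- _) _; set H := eta ^+ _.
set n := (count a s)%:R.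
transitivity (((t p - x)^-1 * Q) * (H * W) * ((eta * eta) * (t p + lam - x) - eta * n)).
  by rewrite eta2; field.
by ring.
Qed.

End Lowering.

Section PartitionLink.
Variables (K : numFieldType) (P L : finType) (tau : P -> K) (lam : bool -> L).
Hypothesis lam_inj : injective lam.
Local Notation word := {ffun P -> L}.
Local Notation fn := {ffun word -> K^o}.
Implicit Types (p q : P) (w : word) (s qs : seq P).

(** The R-matrix that lets the line p cross the site q; tau is t up to sign. *)
Definition cross p q : endo fn := shift_op K^o (tau q - tau p)^-1 (swap p q).

(** The letters are only two, lam false and lam true; [line] is the same
    computation on bits. *)
Lemma line_link p qs (phi : fn) (psi : seq (K * bool) -> bool -> K) w c beta :
  uniq (p :: qs) ->
  w p = lam c -> {in qs, forall q, w q = lam (beta q)} ->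
  (forall w' c' beta', (forall k, k \notin p :: qs -> w' k = w k) ->
     w' p = lam c' -> {in qs, forall q, w' q = lam (beta' q)} ->
     phi w' = psi [seq (tau q, beta' q) | q <- qs] c') ->
  (\prod_(q <- qs) cross p q) phi w
  = line (tau p) c [seq (tau q, beta q) | q <- qs] psi.
Proof.
elim: qs phi psi w c beta => [|q qs IH] phi psi w c beta us wp wq H.
  by rewrite big_nil endo1E /=; apply: (H w c beta).
have upqs : uniq (p :: qs).
  by move: us => /= /andP[]; rewrite inE negb_or => /andP[_ ->] /andP[_ ->].
have pq : p != q by move: us => /= /andP[]; rewrite inE negb_or => /andP[].
have pqs : p \notin qs by move: upqs => /andP[].
have qqs : q \notin qs by move: us => /= /and3P[].
have qpqs : q \notin p :: qs by rewrite inE negb_or eq_sym pq.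
rewrite big_cons endoME shift_opE /=; congr (_ + _ *: _).
  apply: (IH _ (fun r => psi ((tau q, beta q) :: r))) => // [k kqs|w' c' beta' e e1 e2].
    by apply: wq; rewrite inE kqs orbT.
  pose beta2 k := if k == q then beta q else beta' k.
  rewrite (H w' c' beta2) //=.
  - rewrite /beta2 eqxx; congr (psi (_ :: _) _); apply/eq_in_map => k kqs.
    by rewrite ifN //; apply: contraNneq qqs => <-.
  - by move=> k; rewrite !inE !negb_or => /and3P[h1 _ h2]; apply: e; rewrite inE negb_or h1.
  - move=> k; rewrite inE /beta2; case: eqP => [-> _|_ /e2 //].
    by rewrite (e _ qpqs) wq // inE eqxx.
apply: (IH _ (fun r => psi ((tau q, c) :: r))) => //.
- by rewrite swapL wq // inE eqxx.
- move=> k kqs; rewrite swapD ?wq ?inE ?kqs ?orbT //.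
    by apply: contraNneq pqs => ->.
  by apply: contraNneq qqs => ->.
move=> w' c' beta' e e1 e2.
pose beta2 k := if k == q then c else beta' k.
rewrite (H w' c' beta2) //=.
- rewrite /beta2 eqxx; congr (psi (_ :: _) _); apply/eq_in_map => k kqs.
  by rewrite ifN //; apply: contraNneq qqs => <-.
- move=> k; rewrite !inE !negb_or => /and3P[h1 h3 h2].
  have kpqs : k \notin p :: qs by rewrite inE negb_or h1.
  by rewrite (e _ kpqs) swapD // eq_sym.
- move=> k; rewrite inE /beta2; case: eqP => [-> _|_ /e2 //].
  by rewrite (e _ qpqs) swapR wp.
Qed.

(** After all lines have crossed: the letters at the lines s must be those
    prescribed by kappa, and the letters at the sites qs enter the eigenvalues
    of the Cartan element. *)
Definition site_function (c : K) (kappa : {ffun P -> bool}) s qs : fn :=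
  [ffun w : word => (all (fun p => w p == lam (kappa p)) s)%:R
             * weight_product c 0 [seq (tau q, w q == lam true) | q <- qs]].

Lemma partition_link c kappa s qs w beta : uniq (s ++ qs) ->
  {in s, forall p, w p = lam false} -> {in qs, forall q, w q = lam (beta q)} ->
  (\prod_(p <- s) \prod_(q <- qs) cross p q) (site_function c kappa s qs) w
  = partition_function [seq (tau p, kappa p) | p <- s] (weight_product c 0)
      [seq (tau q, beta q) | q <- qs].
Proof.
have lamE (b : bool) : (lam b == lam true) = b.
  by rewrite (inj_eq lam_inj); case: b.
suff gen (s0 : seq P) : uniq (s ++ qs) -> {in s0, forall p, p \notin s ++ qs} ->
   {in s, forall p, w p = lam false} -> {in qs, forall q, w q = lam (beta q)} ->
  (\prod_(p <- s) \prod_(q <- qs) cross p q) (site_function c kappa (s0 ++ s) qs) w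
  = (all (fun p => w p == lam (kappa p)) s0)%:R *
    partition_function [seq (tau p, kappa p) | p <- s] (weight_product c 0)
      [seq (tau q, beta q) | q <- qs].
  by move=> us ws wq; rewrite (gen [::]) //= mul1r.
elim: s s0 w beta => [|p s IH] s0 w beta us s0d ws wq.
  rewrite big_nil endo1E ffunE cats0; congr (_ * weight_product _ _ _).
  by apply/eq_in_map => q qqs; rewrite wq // lamE.
move: us; rewrite cat_cons cons_uniq mem_cat negb_or => /andP[/andP[ps pqs] us].
rewrite big_cons endoME -line_scale.
apply: line_link => //.
- by rewrite /= pqs; move: us; rewrite cat_uniq => /and3P[].
- by apply: ws; rewrite inE eqxx.
move=> w' c' beta' e e1 e2.
rewrite -cat_rcons (IH (rcons s0 p) w' beta') //.
- rewrite all_rcons e1 (inj_eq lam_inj) mulrCA mulrA -natrM mulnb.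
  congr (_%:R * _); congr (_ && _); apply: eq_in_all => k ks0.
  rewrite e //; apply: contra (s0d _ ks0).
  by rewrite /= !inE mem_cat => /orP[->//|->]; rewrite !orbT.
- move=> k; rewrite mem_rcons inE => /orP[/eqP ->|/s0d].
    by rewrite mem_cat negb_or ps.
  by rewrite /= inE negb_or => /andP[].
move=> k ks; rewrite e; first by apply: ws; rewrite inE ks orbT.
rewrite inE negb_or; apply/andP; split; first by apply: contraNneq ps => <-.
by apply/negP => kqs; move: us; rewrite cat_uniq => /and3P[_ /hasPn/(_ k kqs)/negP].
Qed.

End PartitionLink.

Lemma R_block_adjoint (K : fieldType) (n : nat) (P : finType) (t : P -> K)
    (s s' : seq P) (a b : {ffun {ffun P -> 'I_n} -> K^o}) :
  \sum_w a w * R_block K^o n t s s' b w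
  = \sum_w ((\prod_(p <- rev s) \prod_(q <- s') Rx K^o n t p q) a) w * b w.
Proof.
rewrite /R_block; elim: s a b => [|p s IH] a b; first by rewrite !big_nil.
rewrite rev_cons -cats1 !big_cons big_cat big_seq1 /= !endoME.
rewrite (@prod_shift_adjoint _ _ _ (rev s') (fun q => (t p - t q)^-1) (fun q => swap p q));
  last by move=> q; apply: swapK.
by rewrite revK IH.
Qed.

(** * Expansion of the weight function over words *)

Section TwoLetters.
Variables (P L : finType) (lam : bool -> L).
Implicit Types (w : {ffun P -> L}) (s : seq P).

(** The number of letters lam true is recorded, because it is preserved by
    exchanges and determines the exponents of e21 and e43. *)
Definition two_letters s k w :=
  all (fun p => (w p == lam false) || (w p == lam true)) s
  && (count (fun p => w p == lam true) s == k).

Lemma two_letters_swap s k p q w : uniq s -> p \in s -> q \in s ->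
  two_letters s k (swap p q w) = two_letters s k w.
Proof.
move=> us ps qs; have pe := perm_map_swap w us ps qs.
rewrite /two_letters.
have aE w' : all (fun p => (w' p == lam false) || (w' p == lam true)) s
    = all (fun a => (a == lam false) || (a == lam true)) (map w' s).
  by rewrite all_map.
have cE w' : count (fun p => w' p == lam true) s = count (pred1 (lam true)) (map w' s).
  by rewrite count_map.
by rewrite !aE !cE (perm_all _ pe) (seq.permP pe).
Qed.

Lemma two_lettersP s k w : two_letters s k w -> forall p, p \in s ->
  w p = lam (w p == lam true).
Proof. by case/andP=> /allP h _ p /h /orP[/eqP e|/eqP ->]; rewrite ?eqxx // e; case: eqP. Qed.

Definition all_letters (a : L) s w := all (fun p => w p == a) s.

Lemma all_letters_swap a s p q w : p \notin s -> q \notin s ->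
  all_letters a s (swap p q w) = all_letters a s w.
Proof.
move=> ps qs; apply: eq_in_all => k ks.
by rewrite swapD //; [apply: contraNneq ps => -> | apply: contraNneq qs => ->].
Qed.

End TwoLetters.

Lemma prod_endo_scale (K : fieldType) (V : lmodType K) (I : Type) (s : seq I)
    (c : I -> K) (F : I -> endo V) :
  \prod_(i <- s) (c i *: F i) = (\prod_(i <- s) c i) *: \prod_(i <- s) F i.
Proof.
elim: s => [|i s IH]; first by rewrite !big_nil scale1r.
by rewrite !big_cons IH -endo_scalerAl -endo_scalerAr scalerA.
Qed.

(** A bit encodes a letter of block 2 after reduction: the row letters there
    are 1 and 2, the column letters 3 and 4. The values for false are the
    letters in the initial row and column. *)
Definition lower_label (b : bool) : 'I_4 := if b then lbl 1 else lbl 2.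
Definition upper_label (b : bool) : 'I_4 := if b then lbl 4 else lbl 3.

Lemma lower_label_inj : injective lower_label.
Proof. by case=> [] [] //= /eqP; rewrite lbl_eq. Qed.
Lemma upper_label_inj : injective upper_label.
Proof. by case=> [] [] //= /eqP; rewrite lbl_eq. Qed.

Section GlComm.
Variables (K : fieldType) (V : lmodType K) (e : gl_module 4 V).

Lemma gl_swap a b c d :
  e a b * e c d = e c d * e a b + (e a d *+ (b == c) - e c b *+ (a == d)).
Proof. by rewrite -(gl_opP e) addrCA subrr addr0. Qed.

End GlComm.

Section Expansion.
Variables (K : numFieldType) (V : lmodType K) (P : finType) (t : P -> K).
Variables (e : gl_module 4 V) (x : K) (v : V) (Lam : 'I_4 -> K).
Hypothesis sing : singular e Lam v.
Local Notation word := {ffun P -> 'I_4}.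
Local Notation T_block := (T_block t e x).
Local Notation T_entry := (T_entry t e x).
Local Notation R_block W := (R_block W 4 t).
Implicit Types (p q k l : P) (s : seq P) (w I J : word).
Local Notation lam2 := (Lam (lbl 2)).
Local Notation lam3 := (Lam (lbl 3)).

Variables s1 s2 s3 : seq P.
Hypothesis us : uniq (s1 ++ s2 ++ s3).
Hypothesis cover : forall p, p \in s1 ++ s2 ++ s3.
Hypothesis tx : forall p, t p != x.
Hypothesis t21 : {in s2 & s1, forall p q, t p != t q}.
Hypothesis t31 : {in s3 & s1, forall p q, t p != t q}.
Hypothesis t32 : {in s3 & s2, forall p q, t p != t q}.

Variables row col : word.
Hypothesis row1 : {in s1, forall p, row p = lbl 1}.
Hypothesis row2 : {in s2, forall p, row p = lbl 2}.
Hypothesis row3 : {in s3, forall p, row p = lbl 3}.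
Hypothesis col1 : {in s1, forall p, col p = lbl 2}.
Hypothesis col2 : {in s2, forall p, col p = lbl 3}.
Hypothesis col3 : {in s3, forall p, col p = lbl 4}.

Let u12 : uniq (s1 ++ s2).
Proof. by move: us; rewrite catA cat_uniq => /and3P[]. Qed.
Let u23 : uniq (s2 ++ s3).
Proof. by move: us; rewrite cat_uniq => /and3P[]. Qed.
Let n12 p : p \in s1 -> p \notin s2.
Proof.
move: us; rewrite cat_uniq has_cat negb_or => /and3P[_ /andP[/hasPn h _] _] ps.
by apply/negP => /h; rewrite /= ps.
Qed.
Let n13 p : p \in s1 -> p \notin s3.
Proof.
move: us; rewrite cat_uniq has_cat negb_or => /and3P[_ /andP[_ /hasPn h] _] ps.
by apply/negP => /h; rewrite /= ps.
Qed.
Let n23 p : p \in s2 -> p \notin s3.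
Proof.
move: us; rewrite !cat_uniq => /and5P[_ _ _ /hasPn h _] ps.
by apply/negP => /h; rewrite /= ps.
Qed.

Let rows : pred word :=
  fun w => all_letters (lbl 3) s3 w && two_letters lower_label (s1 ++ s2) (size s1) w.
Let cols : pred word :=
  fun w => all_letters (lbl 2) s1 w && two_letters upper_label (s2 ++ s3) (size s3) w.

Lemma rows_swap p q w : p \in s2 -> q \in s1 -> rows (swap p q w) = rows w.
Proof.
move=> ps qs; rewrite /rows all_letters_swap; [|exact: n23|exact: n13].
by rewrite two_letters_swap // mem_cat ?ps ?qs ?orbT.
Qed.

Lemma cols_swap p q w : p \in s3 -> q \in s2 -> cols (swap p q w) = cols w.
Proof.
move=> ps qs; rewrite /cols all_letters_swap.
- by rewrite two_letters_swap // mem_cat ?ps ?qs ?orbT.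
- by apply: contraTN ps => /n13.
- by apply: contraTN qs => /n12.
Qed.

Lemma rows_row : rows row.
Proof.
rewrite /rows /all_letters /two_letters all_cat count_cat.
have -> : all (fun p => row p == lbl 3) s3 by apply/allP => p /row3 ->.
have -> : all (fun p => (row p == lower_label false) || (row p == lower_label true)) s1.
  by apply/allP => p /row1 ->; rewrite eqxx orbT.
have -> : all (fun p => (row p == lower_label false) || (row p == lower_label true)) s2.
  by apply/allP => p /row2 ->; rewrite eqxx.
have /eq_in_count -> : {in s1, (fun p => row p == lower_label true) =1 predT}.
  by move=> p /row1 ->; rewrite eqxx.
have /eq_in_count -> : {in s2, (fun p => row p == lower_label true) =1 pred0}.
  by move=> p /row2 ->; rewrite lbl_eq.
by rewrite count_predT count_pred0 addn0 eqxx.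
Qed.

Lemma cols_col : cols col.
Proof.
rewrite /cols /all_letters /two_letters all_cat count_cat.
have -> : all (fun p => col p == lbl 2) s1 by apply/allP => p /col1 ->.
have -> : all (fun p => (col p == upper_label false) || (col p == upper_label true)) s2.
  by apply/allP => p /col2 ->; rewrite eqxx.
have -> : all (fun p => (col p == upper_label false) || (col p == upper_label true)) s3.
  by apply/allP => p /col3 ->; rewrite eqxx orbT.
have /eq_in_count -> : {in s2, (fun p => col p == upper_label true) =1 pred0}.
  by move=> p /col2 ->; rewrite lbl_eq.
have /eq_in_count -> : {in s3, (fun p => col p == upper_label true) =1 predT}.
  by move=> p /col3 ->; rewrite eqxx.
by rewrite count_predT count_pred0 eqxx.
Qed.

Lemma column_support J : ~~ cols J -> R_block K^o s3 s2 (indicator K col) J = 0.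
Proof.
move=> cJ; pose S : pred word := fun w => ~~ cols w.
pose zero : {ffun word -> K^o} := 0.
have -> : 0 = R_block K^o s3 s2 zero J by rewrite linear0 ffunE.
apply: (R_block_local t (S := S)) => // [p q w ps qs|w Sw].
  by rewrite /S cols_swap.
by rewrite !ffunE; case: eqP => // wc; move: Sw; rewrite /S wc cols_col.
Qed.

Definition inverses s := \prod_(p <- s) (t p - x)^-1.

(** Functions of bits on block 2 are extended by false, so that sums over them
    are sums over a finite type without repetitions. *)
Definition restriction s (a : P -> bool) : {ffun P -> bool} :=
  [ffun p => (p \in s) && a p].

Definition supported s : pred {ffun P -> bool} :=
  fun kappa => [forall p, (p \notin s) ==> ~~ kappa p].

Definition monomial (kappa lam : {ffun P -> bool}) : V :=
  (\prod_(p <- s2) e (upper_label (lam p)) (lower_label (kappa p)) : endo V)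
   ((e (lbl 4) (lbl 3) ^+ (size s3 - count lam s2) : endo V)
    ((e (lbl 2) (lbl 1) ^+ (size s1 - count kappa s2) : endo V) v)).

(** The coefficients -1 and 1 are the signs eta of [lowering_product] for e21
    and e43; they also apply to the weights below. *)
Definition spectral1 p : K := -1 * t p.
Definition spectral3 p : K := 1 * t p.
Definition level1 : K := -1 * (lam2 - x).
Definition level3 : K := 1 * (lam3 - x).

(** The words in rows have letters 1, 2 in blocks 1 and 2 and letters 3 in
    block 3; the words in cols have letters 2 in block 1 and letters 3, 4 in
    the others. For these, T1 consists of e21 and e22, T3 of e43 and e33, and
    T2 of e31, e32, e41, e42. The exponents of e21 and e43 follow from the
    total numbers of letters 1 and 4. *)
Lemma entriesE I J : rows I -> cols J ->
  entries t e x v s1 s2 s3 I J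
  = (inverses s2 * inverses s3 * inverses s1
     * ((-1) ^+ count (fun p => I p == lower_label true) s2
        * weight_product level1 0 [seq (spectral1 q, I q == lower_label true) | q <- rev s1]
        * weight_product level3 0 [seq (spectral3 q, J q == upper_label true) | q <- rev s3]))
    *: monomial (restriction s2 (fun p => I p == lower_label true))
                (restriction s2 (fun p => J p == upper_label true)).
Proof.
move=> /andP[/allP I3 I12] /andP[/allP J1 J23].
have I12l := two_lettersP I12; have J23l := two_lettersP J23.
pose a1 p := I p == lower_label true; pose a3 p := J p == upper_label true.
have ca1 : count a1 s1 = (size s1 - count a1 s2)%N.
  by move: I12 => /andP[_ /eqP]; rewrite count_cat -/a1 => <-; rewrite addnK.
have cn1 : count (fun p => ~~ a1 p) s1 = count a1 s2.
  apply/eqP; rewrite -(eqn_add2l (count a1 s1)) (count_predC a1 s1).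
  by move: I12 => /andP[_ /eqP <-]; rewrite count_cat.
have ca3 : count a3 s3 = (size s3 - count a3 s2)%N.
  by move: J23 => /andP[_ /eqP]; rewrite count_cat -/a3 => <-; rewrite addKn.
rewrite /entries.
have -> : \prod_(p <- s1) T_entry p (I p) (J p)
   = \prod_(p <- s1) ladder (e (lbl 2) (lbl 1)) (e (lbl 2) (lbl 2)) (a1 p) (t p - x)^-1.
  apply: eq_big_seq => p ps; rewrite (eqP (J1 p ps)).
  rewrite {1}I12l ?mem_cat ?ps // -/(a1 p) !/(T_entry _ _ _).
  by case: (a1 p); rewrite /= lbl_eq //= ?add0r.
have e2221 : e (lbl 2) (lbl 2) * e (lbl 2) (lbl 1)
    = e (lbl 2) (lbl 1) * e (lbl 2) (lbl 2) - (-1) *: e (lbl 2) (lbl 1).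
  by rewrite gl_swap !lbl_eq //= mulr1n mulr0n subr0 scaleN1r opprK.
have h1 := proj2 sing (lbl 2).
rewrite (lowering_product e2221 h1) ?mulrNN ?mulr1 //.
set k1 := count a1 s1; set u := (_ ^+ k1 : endo V) v.
have e3343 : e (lbl 3) (lbl 3) * e (lbl 4) (lbl 3)
    = e (lbl 4) (lbl 3) * e (lbl 3) (lbl 3) - 1 *: e (lbl 4) (lbl 3).
  by rewrite gl_swap !lbl_eq //= mulr1n mulr0n sub0r scale1r.
have h3 : e (lbl 3) (lbl 3) u = lam3 *: u.
  rewrite /u; elim: (k1) => [|k IH]; first by rewrite expr0 endo1E (proj2 sing).
  rewrite exprS endoME -endoME gl_swap !lbl_eq //= mulr0n subr0 addr0.
  by rewrite endoME IH linearZ.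
have -> : \prod_(p <- s3) T_entry p (I p) (J p)
   = \prod_(p <- s3) ladder (e (lbl 4) (lbl 3)) (e (lbl 3) (lbl 3)) (a3 p) (t p - x)^-1.
  apply: eq_big_seq => p ps; rewrite (eqP (I3 p ps)).
  rewrite {1}J23l ?mem_cat ?ps ?orbT // -/(a3 p) !/(T_entry _ _ _).
  by case: (a3 p); rewrite /= lbl_eq //= ?add0r.
rewrite linearZ /= (lowering_product e3343 h3) ?mulr1 //.
have -> : \prod_(p <- s2) T_entry p (I p) (J p)
   = inverses s2 *: \prod_(p <- s2) e (upper_label (a3 p)) (lower_label (a1 p)).
  rewrite -prod_endo_scale; apply: eq_big_seq => p ps.
  rewrite {1}I12l ?mem_cat ?ps ?orbT // {1}J23l ?mem_cat ?ps // -/(a1 p) -/(a3 p).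
  by rewrite !/(T_entry _ _ _); case: (a1 p); case: (a3 p); rewrite /= lbl_eq //= add0r.
rewrite endoZE !linearZ /= !scalerA; congr (_ *: _).
  rewrite cn1 expr1n -/a1 -/a3; rewrite /inverses /level1 /level3 /spectral1 /spectral3; ring.
have cr a : count (restriction s2 a) s2 = count a s2.
  by apply: eq_in_count => p ps; rewrite ffunE ps.
rewrite /monomial !cr /u /k1 ca1 ca3.
have -> // : \prod_(p <- s2) e (upper_label (a3 p)) (lower_label (a1 p))
  = \prod_(p <- s2) e (upper_label (restriction s2 a3 p)) (lower_label (restriction s2 a1 p)).
by apply: eq_big_seq => p ps; rewrite !ffunE ps.
Qed.

(** Exactly one kappa agrees with w; introducing the sum separates the choice
    of the monomial from the action of the R-matrices on w. *)
Lemma restriction_sum (F : {ffun P -> bool} -> V) (lam : bool -> 'I_4) w :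
  injective lam -> {in s2, forall p, w p = lam (w p == lam true)} ->
  \sum_(kappa | supported s2 kappa)
     (all (fun p => w p == lam (kappa p)) s2)%:R *: F kappa
  = F (restriction s2 (fun p => w p == lam true)).
Proof.
move=> lamI wl; set k0 := restriction _ _.
have lamE (b : bool) : (lam b == lam true) = b by rewrite (inj_eq lamI); case: b.
rewrite (bigD1 k0) /=; last first.
  by apply/forallP => p; apply/implyP => ps; rewrite ffunE (negbTE ps).
have -> : all (fun p => w p == lam (k0 p)) s2.
  by apply/allP => p ps; rewrite {1}wl // ffunE ps.
rewrite scale1r big1 ?addr0 // => kappa /andP[/forallP sk nk].
case: (boolP (all _ _)) => [/allP h|_]; last by rewrite scale0r.
case/negP: nk; apply/eqP/ffunP => p; rewrite ffunE.
case: (boolP (p \in s2)) => ps /=; first by rewrite (eqP (h p ps)) lamE.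
by apply/negbTE; apply: (implyP (sk p)).
Qed.

Definition lower_amplitude (kappa : {ffun P -> bool}) : K :=
  (-1) ^+ count kappa s2
  * partition_function [seq (spectral1 p, kappa p) | p <- s2] (weight_product level1 0)
      [seq (spectral1 q, true) | q <- rev s1].

Definition upper_amplitude (lam : {ffun P -> bool}) : K :=
  partition_function [seq (spectral3 p, lam p) | p <- s2] (weight_product level3 0)
      [seq (spectral3 q, true) | q <- rev s3].

Let prefactor := inverses s2 * inverses s3 * inverses s1.

(** R21 acts on the row index, which is constant in each of the blocks 1 and
    2; this gives the partition function with lines at block 2 and sites at
    block 1. *)
Lemma row_sum J : cols J ->
  R_block V s2 s1 [ffun I => entries t e x v s1 s2 s3 I J] row
  = \sum_(kappa | supported s2 kappa)
      (prefactor * lower_amplitude kappa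
        * weight_product level3 0 [seq (spectral3 q, J q == upper_label true) | q <- rev s3])
      *: monomial kappa (restriction s2 (fun p => J p == upper_label true)).
Proof.
move=> cJ; set W3 := weight_product level3 _ _; set lJ := restriction _ _.
pose coef (kappa : {ffun P -> bool}) := prefactor * W3 * (-1) ^+ count kappa s2.
pose site kappa := site_function spectral1 lower_label level1 kappa s2 (rev s1).
pose psi : {ffun word -> V} := \sum_(kappa | supported s2 kappa)
  pure_tensor (site kappa) (coef kappa *: monomial kappa lJ).
have agree I : rows I -> [ffun I => entries t e x v s1 s2 s3 I J] I = psi I.
  move=> rI; rewrite ffunE entriesE // -/W3 -/lJ sum_ffunE.
  have I12 : two_letters lower_label (s1 ++ s2) (size s1) I by case/andP: rI.
  have wl : {in s2, forall p, I p = lower_label (I p == lower_label true)}.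
    by move=> p ps; apply: (two_lettersP I12); rewrite mem_cat ps orbT.
  set W1 := weight_product level1 _ _.
  transitivity (\sum_(kappa | supported s2 kappa)
     (all (fun p => I p == lower_label (kappa p)) s2)%:R
       *: ((coef kappa * W1) *: monomial kappa lJ)).
    rewrite (restriction_sum (fun kappa => (coef kappa * W1) *: monomial kappa lJ) lower_label_inj wl).
    congr (_ *: _); rewrite /coef /prefactor.
    have -> : count (restriction s2 (fun p => I p == lower_label true)) s2
       = count (fun p => I p == lower_label true) s2.
      by apply: eq_in_count => p ps; rewrite ffunE ps.
    ring.
  apply: eq_bigr => kappa _; rewrite pure_tensorE ffunE -/W1 !scalerA.
  by congr (_ *: _); ring.
rewrite (R_block_local t _ agree rows_row); last first.
  by move=> p q w ps qs; rewrite rows_swap.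
rewrite /psi linear_sum sum_ffunE; apply: eq_bigr => kappa _.
have -> : R_block V s2 s1 (pure_tensor (site kappa) (coef kappa *: monomial kappa lJ))
   = pure_tensor (R_block K^o s2 s1 (site kappa)) (coef kappa *: monomial kappa lJ).
  apply: prod_pure_tensor => p rho; apply: prod_pure_tensor => q rho'.
  exact: shift_pure_tensor.
rewrite pure_tensorE scalerA; congr (_ *: _).
have -> : R_block K^o s2 s1 (site kappa) row
  = partition_function [seq (spectral1 p, kappa p) | p <- s2] (weight_product level1 0)
      [seq (spectral1 q, true) | q <- rev s1].
  have -> : R_block K^o s2 s1 = \prod_(p <- s2) \prod_(q <- rev s1) cross 'I_4 spectral1 p q.
    apply: eq_bigr => p _; apply: eq_bigr => q _; rewrite /cross /Rx /R_op; congr (shift_op _ _ _).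
    by rewrite /spectral1 !mulN1r addrC opprK.
  apply: (partition_link (lam := lower_label) spectral1 lower_label_inj level1 kappa (beta := fun=> true)) => [|p ps|q].
  - have pe : perm_eq (s2 ++ rev s1) (s1 ++ s2).
      by rewrite perm_catC perm_cat2r perm_rev.
    by rewrite (perm_uniq pe).
  - by rewrite row2.
  - by rewrite mem_rev => qs; rewrite row1.
by rewrite /coef /lower_amplitude; ring.
Qed.

(** By transposition, R32 acts on the Cartan eigenvalues instead of the column
    index; in the transposed operator, block 2 provides the lines, and block 3
    the sites. *)
Lemma column_sum lam :
  \sum_J R_block K^o s3 s2 (indicator K col) J * site_function spectral3 upper_label level3 lam s2 (rev s3) J
  = upper_amplitude lam.
Proof.
set site := site_function _ _ _ _ _ _.
under eq_bigr do rewrite mulrC.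
have indE J : indicator K col J = (J == col)%:R by rewrite ffunE.
rewrite R_block_adjoint (bigD1 col) //= indE eqxx mulr1 [X in _ + X]big1 ?addr0; last first.
  by move=> J /negbTE Jc; rewrite indE Jc mulr0.
have -> : \prod_(p <- rev s3) \prod_(q <- s2) Rx K^o 4 t p q
   = \prod_(p <- s2) \prod_(q <- rev s3) cross 'I_4 spectral3 p q.
  rewrite grid_swap; first last.
  - move=> p p' q q'; rewrite !mem_rev => ps ps' qs qs' pp' qq'.
    apply: R_comm => //; first by apply: contraTneq ps => ->; apply: n23.
    by apply: contraTneq ps' => <-; apply: n23.
  - by move: u23; rewrite cat_uniq => /and3P[].
  - by rewrite rev_uniq; move: u23; rewrite cat_uniq => /and3P[].
  apply: eq_bigr => p _; apply: eq_bigr => q _.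
  by rewrite /Rx R_opC /cross /spectral3 !mul1r.
apply: (partition_link spectral3 upper_label_inj level3 lam (beta := fun=> true)) => [|p ps|q].
- have pe : perm_eq (s2 ++ rev s3) (s2 ++ s3) by rewrite perm_cat2l perm_rev.
  by rewrite (perm_uniq pe).
- by rewrite col2.
- by rewrite mem_rev => qs; rewrite col3.
Qed.

(** The sums over the intermediate columns J and the rows are independent of
    each other once the pair (lam, kappa) of bits on block 2, which determines
    the monomial, is fixed. *)
Theorem nested_expansion :
  (T_block s1 * T_block s2 * T_block s3
    * R_block V s3 s2 * R_block V s3 s1 * R_block V s2 s1)
     (pure_tensor (indicator K col) v) row
  = prefactor *: \sum_(lam | supported s2 lam) \sum_(kappa | supported s2 kappa)
      (upper_amplitude lam * lower_amplitude kappa) *: monomial kappa lam.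
Proof.
rewrite (nested_sum sing us cover tx t21 t31 t32 row1 row2 row3 col1).
pose F (lam : {ffun P -> bool}) : V := \sum_(kappa | supported s2 kappa)
  (prefactor * lower_amplitude kappa) *: monomial kappa lam.
transitivity (\sum_J \sum_(lam | supported s2 lam)
  (R_block K^o s3 s2 (indicator K col) J * site_function spectral3 upper_label level3 lam s2 (rev s3) J)
  *: F lam).
  apply: eq_bigr => J _; case: (boolP (cols J)) => [cJ|/column_support ->]; last first.
    by rewrite scale0r big1 // => lam _; rewrite mul0r scale0r.
  rewrite row_sum //.
  set W3 := weight_product _ _ _.
  have J23 : two_letters upper_label (s2 ++ s3) (size s3) J by case/andP: cJ.
  have wl : {in s2, forall p, J p = upper_label (J p == upper_label true)}.
    by move=> p ps; apply: (two_lettersP J23); rewrite mem_cat ps.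
  under [RHS]eq_bigr do rewrite -scalerA.
  rewrite -scaler_sumr; congr (_ *: _).
  transitivity (W3 *: F (restriction s2 (fun p => J p == upper_label true))).
    rewrite /F scaler_sumr; apply: eq_bigr => kappa _.
    by rewrite scalerA; congr (_ *: _); ring.
  rewrite -(restriction_sum F upper_label_inj wl) scaler_sumr; apply: eq_bigr => lam _.
  by rewrite ffunE scalerA -/W3; congr (_ *: _); ring.
rewrite exchange_big scaler_sumr; apply: eq_bigr => lam _ /=.
rewrite -scaler_suml column_sum /F !scaler_sumr; apply: eq_bigr => kappa _.
by rewrite !scalerA; congr (_ *: _); ring.
Qed.

End Expansion.

(** * Symmetrization as a sum over permutations *)

Section SymAsPermutations.
Variables (K : fieldType).
Implicit Types s : seq K.

Lemma ordered_factor_rcons s x :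
  ordered_factor (rcons s x) = ordered_factor s * \prod_(l <- s) (1 - (l - x)^-1).
Proof.
elim: s => [|y s IH] /=; first by rewrite !big_nil !mulr1.
by rewrite IH -cats1 big_cat big_seq1 /= big_cons; ring.
Qed.

Lemma ordered_factor_rev_opp s :
  ordered_factor (rev (map -%R s)) = ordered_factor s.
Proof.
elim: s => [|x s IH] //=; rewrite rev_cons ordered_factor_rcons IH mulrC.
rewrite (perm_big _ (permEl (perm_rev _))) big_map; congr (_ * _).
by apply: eq_bigr => l _; rewrite opprK [- l + x]addrC.
Qed.

Lemma Qfactor_ordered m (s : m.-tuple K) : uniq s -> Qfactor s = ordered_factor s.
Proof.
pose g (x y : K) := (x - y - 1) / (x - y).
have gE x y : x != y -> g x y = 1 - (x - y)^-1.
  by move=> xy; rewrite /g mulrBl mul1r divff // subr_eq0.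
have QE : Qfactor s = \prod_(i < m) \prod_(j < m | (i < j)%N) g s`_i s`_j.
  by apply: eq_bigr => i _; apply: eq_bigr => j _; rewrite !(tnth_nth 0).
rewrite QE; case: s {QE} => s /= /eqP sz us.
rewrite -{}sz; elim: s us => [|x s IH] /=; first by rewrite big_ord0.
case/andP=> xs us; rewrite big_ord_recl; congr (_ * _).
  rewrite big_mkcond big_ord_recl /= mul1r.
  rewrite (big_nth 0) big_mkord; apply: eq_bigr => j _ /=.
  by rewrite add0n gE //; apply: contraNneq xs => ->; apply: mem_nth.
rewrite -IH //; apply: eq_bigr => i _; rewrite big_mkcond big_ord_recl /= mul1r.
by rewrite [RHS]big_mkcond.
Qed.

(** As the entries of s are distinct, its permutations as a sequence
    correspond to the permutations of indices. *)
Lemma Sym_permutations m (s : m.-tuple K) (f : m.-tuple K -> K) (h : seq K -> K) :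
  uniq s -> (forall u : m.-tuple K, perm_eq u s -> f u = h u) ->
  Defs.Sym f s = \sum_(u <- permutations s) ordered_factor u * h u.
Proof.
move=> us fh.
have pS (sigma : 'S_m) : perm_eq (permute s sigma) s.
  by apply/tuple_permP; exists sigma.
rewrite /Defs.Sym; transitivity (\sum_(sigma : 'S_m)
    ordered_factor (permute s sigma) * h (permute s sigma)).
  apply: eq_bigr => sigma _; rewrite fh // mulrC Qfactor_ordered //.
  by rewrite (perm_uniq (pS sigma)).
rewrite -(big_map (fun sigma : 'S_m => tval (permute s sigma)) xpredT
  (fun u => ordered_factor u * h u)).
apply: perm_big; apply: uniq_perm.
- rewrite map_inj_uniq ?index_enum_uniq // => a b /val_inj ab; apply/permP => i.
  have := congr1 (fun u : m.-tuple K => tnth u i) ab.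
  by rewrite !tnth_mktuple => /(tuple_uniqP _ us).
- exact: permutations_uniq.
move=> u; rewrite mem_permutations; apply/mapP/idP => [[sigma _ ->]|]; first exact: pS.
by case/tuple_permP=> sigma ->; exists sigma; rewrite ?mem_index_enum.
Qed.

Lemma sum_permutations_rev (I : eqType) (s : seq I) (h : seq I -> K) :
  \sum_(u <- permutations s) h (rev u) = \sum_(u <- permutations s) h u.
Proof.
rewrite -(big_map rev xpredT h); apply: perm_big; apply: uniq_perm.
- by rewrite map_inj_uniq ?permutations_uniq //; apply: inv_inj revK.
- exact: permutations_uniq.
move=> u; apply/mapP/idP => [[w]|]; rewrite mem_permutations.
  by move=> pw ->; rewrite mem_permutations perm_rev.
by move=> pu; exists (rev u); rewrite ?revK // mem_permutations perm_rev.
Qed.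

End SymAsPermutations.

(** * Symmetrization of the function G *)

Definition positions (b : seq bool) : seq nat :=
  [seq l <- iota 0 (size b) | nth false b l].

(** A set i of sites as a word in bits; [positions] is the inverse operation. *)
Definition mask_of (m : nat) (i : seq nat) : seq bool :=
  [seq l \in i | l <- iota 0 m].

Lemma size_mask_of m i : size (mask_of m i) = m.
Proof. by rewrite size_map size_iota. Qed.

Lemma positions_cons x b : positions (x :: b)
  = if x then 0%N :: map S (positions b) else map S (positions b).
Proof.
rewrite /positions /= -[1%N]addn0 iotaDl filter_map.
by case: x.
Qed.

Lemma positions_mask m i : sorted ltn i -> all (fun k => k < m)%N i ->
  positions (mask_of m i) = i.
Proof.
move=> si ai; apply: (irr_sorted_eq ltn_trans ltnn) => //.
  by apply: sorted_filter; [apply: ltn_trans | apply: iota_ltn_sorted].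
move=> k; rewrite mem_filter size_mask_of mem_iota /= add0n.
case: (ltnP k m) => km; last first.
  by rewrite andbF; apply/esym/negbTE/negP => /(allP ai); rewrite ltnNge km.
by rewrite andbT (nth_map 0%N) ?size_iota // nth_iota.
Qed.

Lemma size_positions b : size (positions b) = count id b.
Proof. by elim: b => // -[] b IH; rewrite positions_cons /= size_map IH. Qed.

Lemma positions_rev b :
  positions (rev b) = [seq (size b).-1 - k | k <- rev (positions b)]%N.
Proof.
apply: (irr_sorted_eq ltn_trans ltnn).
- by apply: sorted_filter; [apply: ltn_trans | apply: iota_ltn_sorted].
- rewrite map_rev rev_sorted sorted_map.
  apply: (@sub_in_sorted _ [pred k | (k < size b)%N] ltn).
  + move=> a c; rewrite !inE => ha hc /= hac; lia.
  + by apply/allP => k; rewrite mem_filter mem_iota => /andP[_].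
  + by apply: sorted_filter; [apply: ltn_trans | apply: iota_ltn_sorted].
move=> k; rewrite mem_filter size_rev mem_iota /= add0n.
apply/andP/mapP => [[hk kb]|[l]].
  exists ((size b).-1 - k)%N; last by lia.
  rewrite mem_rev mem_filter mem_iota /= add0n; apply/andP; split; last by lia.
  by rewrite nth_rev // in hk; rewrite (_ : _ - k = size b - k.+1)%N //; lia.
rewrite mem_rev mem_filter mem_iota /= add0n => /andP[hl lb] ->; split; last by lia.
rewrite nth_rev; last by lia.
by rewrite (_ : size b - _ = l)%N //; lia.
Qed.

Section ClosedForm.
Variables (K : fieldType) (c : K).
Implicit Types (zs ys : seq K) (i : seq nat).

(** The factor of G that depends on t^3, for c = Lam3 - x. *)
Definition closed_amplitude zs ys i : K :=
  \prod_(0 <= a < size i)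
    ((zs`_a + c) / (zs`_a - ys`_(nth 0%N i a))
     * \prod_((nth 0%N i a).+1 <= l < size ys) (1 + (zs`_a - ys`_l)^-1)).

Lemma closed_amplitude_shift zs y ys i :
  closed_amplitude zs (y :: ys) (map S i) = closed_amplitude zs ys i.
Proof.
rewrite /closed_amplitude size_map; apply: eq_big_nat => a /andP[_ ai].
by rewrite (nth_map 0%N) //= big_add1.
Qed.

Lemma closed_amplitude_cons z zs y ys i :
  closed_amplitude (z :: zs) (y :: ys) (0%N :: map S i)
  = (z + c) / (z - y) * (\prod_(y' <- ys) (1 + (z - y')^-1))
    * closed_amplitude zs ys i.
Proof.
rewrite {1}/closed_amplitude /= big_nat_recl //=; congr (_ * _ * _).
  by rewrite big_add1 /= [RHS](big_nth 0).
rewrite -[RHS](closed_amplitude_shift zs y ys i) /closed_amplitude !size_map.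
by apply: eq_big_nat.
Qed.

End ClosedForm.

(** The recursion meets the elements of the set i in increasing order, and a
    particle absorbed at a site crosses the sites behind, which is the second
    product in G. *)
Lemma ordered_amplitude_closed (K : numFieldType) (c : K) (zs ys : seq K) (b : seq bool) :
  size b = size ys -> (count id b <= size zs)%N ->
  ordered_amplitude c zs (zip ys b) = closed_amplitude c zs ys (positions b).
Proof.
elim: b zs ys => [|x b IH] zs [|y ys] //= => [_ _|[sz] cz].
  by rewrite /closed_amplitude big_nil.
rewrite positions_cons; case: x cz => /=; last first.
  by move=> cz; rewrite closed_amplitude_shift IH.
case: zs => // z zs; rewrite add1n ltnS => cz.
rewrite closed_amplitude_cons IH //; congr (_ * _ * _).
rewrite /passing -[in RHS](@unzip1_zip _ _ ys b) ?sz // big_map.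
by apply: eq_bigr.
Qed.

Section Gfunction.
Variables (K : numFieldType) (Lam2 Lam3 x : K).
Implicit Types (s : seq K) (i j : seq nat).

(** The factor of G that depends on t^1. *)
Definition left_factor (s1 s2 : seq K) j : K :=
  \prod_(0 <= s < size j)
    ((s1`_(size s1 - size j + s) - x + Lam2)
       / (s2`_(nth 0%N j s) - s1`_(size s1 - size j + s))
     * \prod_(0 <= l < nth 0%N j s)
         ((s2`_l - s1`_(size s1 - size j + s) + 1)
            / (s2`_l - s1`_(size s1 - size j + s)))).

(** Changing the signs of all parameters and reversing the order of the sites
    and of the particles exchanges the two factors of G. *)
Lemma left_factor_closed (s1 s2 : seq K) j :
  all (fun k => k < size s2)%N j -> (size j <= size s1)%N ->
  {in s2 & s1, forall y z, y != z} ->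
  left_factor s1 s2 j
  = (-1) ^+ size j * closed_amplitude (x - Lam2) (rev (map -%R s1))
      (rev (map -%R s2)) [seq (size s2).-1 - k | k <- rev j]%N.
Proof.
move=> aj qn dis.
rewrite /left_factor /closed_amplitude !(size_map, size_rev) big_nat_rev /= add0n.
have -> : (-1) ^+ size j = \prod_(0 <= a < size j) (-1 : K).
  by rewrite prodr_const_nat subn0.
rewrite -big_split /=; apply: eq_big_nat => a /andP[_ aq].
have -> : (size s1 - size j + (size j - a.+1) = size s1 - a.+1)%N by lia.
rewrite (nth_map 0%N) ?size_rev // [nth 0%N (rev j) a]nth_rev //.
set k := nth 0%N j _; set z := s1`_ _.
have kj : k \in j by apply: mem_nth; rewrite ltn_subrL (leq_ltn_trans _ aq).
have km : (k < size s2)%N by apply: (allP aj).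
have zs1 : z \in s1.
  by apply: mem_nth; rewrite ltn_subrL (leq_trans (leq_ltn_trans _ aq) qn).
have nz : (rev (map -%R s1))`_a = - z.
  have a1 := leq_trans aq qn.
  by rewrite -map_rev (nth_map 0) ?size_rev // nth_rev.
have ny l : (l < size s2)%N -> (rev (map -%R s2))`_l = - s2`_(size s2 - l.+1).
  by move=> lm; rewrite -map_rev (nth_map 0) ?size_rev // nth_rev.
rewrite nz ny; last by lia.
have -> : (size s2 - ((size s2).-1 - k).+1 = k)%N by lia.
have d1 l : (l < size s2)%N -> s2`_l - z != 0.
  by move=> lm; rewrite subr_eq0 dis // mem_nth.
rewrite mulrA; congr (_ * _).
  have hk := d1 k km; rewrite (_ : - z - - s2`_k = s2`_k - z); last by ring.
  by field.
have -> : ((size s2).-1 - k).+1 = (0 + (size s2 - k))%N by lia.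
rewrite big_addn (_ : size s2 - (size s2 - k) = k)%N; last by lia.
rewrite [RHS]big_nat_rev /= add0n; apply: eq_big_nat => l /andP[_ lk].
rewrite ny; last by lia.
rewrite (_ : size s2 - (k - l.+1 + (size s2 - k)).+1 = l)%N; last by lia.
have h : s2`_l - z != 0 by apply: d1; lia.
rewrite (_ : - z - - s2`_l = s2`_l - z); last by ring.
by field.
Qed.

Lemma Gfun_factors xi1 xi2 xi3 i j (s1 : xi1.-tuple K) (s2 : xi2.-tuple K)
    (s3 : xi3.-tuple K) :
  all (fun k => k < xi2)%N i -> (size i <= xi3)%N ->
  {in s3 & s2, forall z y, z != y} ->
  Gfun Lam2 Lam3 x i j s1 s2 s3
  = closed_amplitude (Lam3 - x) s3 s2 i * left_factor s1 s2 j.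
Proof.
move=> ai pn dis; rewrite /Gfun /left_factor !size_tuple; congr (_ * _).
rewrite /closed_amplitude size_tuple; apply: eq_big_nat => a /andP[_ ai'].
congr (_ / _ * _); first by ring.
apply: eq_big_nat => l /andP[_ lm].
rewrite mulrDl divff ?mul1r // subr_eq0 dis // mem_nth ?size_tuple //.
by apply: leq_trans ai' pn.
Qed.

(** The amplitude after the symmetry of [left_factor_closed], which is the
    symmetrization of [left_factor] up to a factorial. *)
Definition dual_amplitude (t1 : seq K) (s : seq (K * bool)) : K :=
  (-1) ^+ count snd s
  * amplitude (x - Lam2) (map -%R t1) (rev [seq (- d.1, d.2) | d <- s]).

Lemma sum_left_factor (t1 s2 : seq K) j :
  uniq t1 -> sorted ltn j -> all (fun k => k < size s2)%N j -> (size j <= size t1)%N ->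
  {in s2 & t1, forall y z, y != z} ->
  \sum_(u <- permutations t1) ordered_factor u * left_factor u s2 j
  = (size t1 - size j)`!%:R * dual_amplitude t1 (zip s2 (mask_of (size s2) j)).
Proof.
move=> ut sj aj qn dis; set b := mask_of _ _.
have sb : size b = size s2 by apply: size_mask_of.
have pb : positions b = j by apply: positions_mask.
have cb : count id b = size j by rewrite -size_positions pb.
have cz : count snd (zip s2 b) = size j.
  by rewrite -cb -[in RHS](@unzip2_zip _ _ s2 b) ?sb // count_map; apply: eq_count.
have zE : rev [seq (- d.1, d.2) | d <- zip s2 b] = zip (rev (map -%R s2)) (rev b).
  rewrite -rev_zip; last by rewrite size_map sb.
  have -> // : [seq (- d.1, d.2) | d <- zip s2 b] = zip (map -%R s2) b.
  by elim: (s2) (b) => [|y s IH] [|x0 b0] //=; rewrite IH.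
rewrite /dual_amplitude cz mulrCA.
have um : uniq (map -%R t1) by rewrite map_inj_uniq //; apply: oppr_inj.
have cr : count snd (rev [seq (- d.1, d.2) | d <- zip s2 b]) = size j.
  by rewrite count_rev count_map -cz; apply: eq_count.
have := amplitude_symmetrization (x - Lam2) (s := rev [seq (- d.1, d.2) | d <- zip s2 b]) um.
rewrite cr size_map => /(_ qn) <-.
rewrite sum_permutations_map //; last by move=> ? ? _ _; apply: oppr_inj.
rewrite -sum_permutations_rev mulr_sumr; apply: eq_big_seq => u.
rewrite mem_permutations => pu.
have su : size u = size t1 by apply: perm_size.
rewrite -(ordered_factor_rev_opp (rev u)) left_factor_closed ?size_rev ?su //; last first.
  by move=> y z ys; rewrite mem_rev (perm_mem pu); apply: dis.
rewrite [map -%R (rev u)]map_rev revK mulrCA; congr (_ * (_ * _)).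
rewrite zE ordered_amplitude_closed ?positions_rev ?pb ?sb //.
  by rewrite !size_rev sb size_map.
by rewrite count_rev cb size_map su.
Qed.

(** The symmetrizations over t^3 and t^1 bear on one factor of G each. *)
Theorem SymG_amplitudes xi1 xi2 xi3 i j (t1 : xi1.-tuple K) (t2 : xi2.-tuple K)
    (t3 : xi3.-tuple K) : generic t1 t2 t3 ->
  sorted ltn i -> all (fun k => k < xi2)%N i -> (size i <= xi3)%N ->
  sorted ltn j -> all (fun k => k < xi2)%N j -> (size j <= xi1)%N ->
  SymG Lam2 Lam3 x i j t1 t2 t3
  = (xi3 - size i)`!%:R * (xi1 - size j)`!%:R
    * \sum_(s <- permutations t2) ordered_factor s
        * (amplitude (Lam3 - x) t3 (zip s (mask_of xi2 i))
           * dual_amplitude t1 (zip s (mask_of xi2 j))).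
Proof.
move=> [ut1 ut2 ut3 d32 d21] si ai pn sj aj qn.
have D32 : {in t3 & t2, forall z y, z != y}.
  by move=> z y /tnthP[a ->] /tnthP[b ->].
have D21 : {in t2 & t1, forall z y, z != y}.
  by move=> z y /tnthP[a ->] /tnthP[b ->].
pose A (u2 : seq K) := (xi3 - size i)`!%:R * amplitude (Lam3 - x) t3 (zip u2 (mask_of xi2 i)).
have inner (s1 : xi1.-tuple K) (s2 : xi2.-tuple K) : perm_eq s2 t2 ->
   Defs.Sym (fun s3 : xi3.-tuple K => Gfun Lam2 Lam3 x i j s1 s2 s3) t3 = A s2 * left_factor s1 s2 j.
  move=> p2.
  rewrite (Sym_permutations (h := fun u3 : seq K =>
    closed_amplitude (Lam3 - x) u3 s2 i * left_factor s1 s2 j)) //; last first.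
    move=> u3 p3; apply: Gfun_factors => // z y.
    by rewrite (perm_mem p3) (perm_mem p2); apply: D32.
  under eq_bigr do rewrite mulrA.
  rewrite -mulr_suml; congr (_ * _).
  have sm : size (mask_of xi2 i) = size s2 by rewrite size_mask_of size_tuple.
  have cm : count id (mask_of xi2 i) = size i by rewrite -size_positions positions_mask.
  have cz : count snd (zip s2 (mask_of xi2 i)) = size i.
    by rewrite -cm -[in RHS](@unzip2_zip _ _ s2 (mask_of xi2 i)) ?sm // count_map; apply: eq_count.
  have := amplitude_symmetrization (Lam3 - x) (s := zip (tval s2) (mask_of xi2 i)) ut3.
  rewrite cz size_tuple => /(_ pn) e; rewrite /A -e; apply: eq_big_seq => u3.
  rewrite mem_permutations => /perm_size; rewrite size_tuple => s3.
  by rewrite ordered_amplitude_closed ?sm ?cm ?s3 // positions_mask.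
have middle (s1 : xi1.-tuple K) :
   Defs.Sym (fun s2 : xi2.-tuple K => Defs.Sym (fun s3 : xi3.-tuple K => Gfun Lam2 Lam3 x i j s1 s2 s3) t3) t2
   = \sum_(u2 <- permutations t2) ordered_factor u2 * (A u2 * left_factor s1 u2 j).
  by apply: Sym_permutations => // u2 p2; apply: inner.
rewrite /SymG (Sym_permutations (h := fun u1 : seq K =>
  \sum_(u2 <- permutations t2) ordered_factor u2 * (A u2 * left_factor u1 u2 j))) //.
under eq_bigr do rewrite mulr_sumr.
rewrite exchange_big mulr_sumr; apply: eq_big_seq => u2.
rewrite mem_permutations => p2.
have s2 : size u2 = xi2 by rewrite (perm_size p2) size_tuple.
have := @sum_left_factor t1 u2 j ut1 sj.
rewrite s2 size_tuple => /(_ aj qn)/(_ _)/wrap[].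
  by move=> y z; rewrite (perm_mem p2); apply: D21.
move=> e; transitivity (ordered_factor u2 * A u2
   * \sum_(u <- permutations t1) ordered_factor u * left_factor u u2 j).
  by rewrite mulr_sumr; apply: eq_bigr => u _; ring.
by rewrite e /A; ring.
Qed.

End Gfunction.

(** * Words in pairs of bits *)

Lemma exchangeable_relabel (K : fieldType) (L L' : Type) (D : pred K)
    (f : L -> L') (F : seq (K * L') -> K) :
  exchangeable D F -> exchangeable D (fun s => F [seq (d.1, f d.2) | d <- s]).
Proof.
move=> exF s1 s2 y1 y2 b1 b2 aD; rewrite !map_cat /=; apply: exF.
by rewrite -[_ :: _]/(map (fun d => (d.1, f d.2)) [:: (y1, b1), (y2, b2) & s2])
  -map_cat all_map.
Qed.

(** Negating the parameters and reversing the order preserves the exchange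
    relation, since it preserves the difference of the parameters at two
    neighbouring sites. *)
Lemma dual_amplitude_exchangeable (K : numFieldType) (lam x : K) (t1 : seq K) :
  uniq t1 -> exchangeable [pred y | y \notin t1] (dual_amplitude lam x t1).
Proof.
move=> ut s1 s2 y1 y2 b1 b2 aD; rewrite /dual_amplitude.
pose N := (count snd s1 + (b1 + (b2 + count snd s2)))%N.
have cE (z1 z2 : K) (c1 c2 : bool) : (c1 + c2 = b1 + b2)%N ->
    count snd (s1 ++ [:: (z1, c1), (z2, c2) & s2]) = N.
  by move=> h; rewrite count_cat /= /N (addnA c1) h -(addnA b1).
rewrite !cE ?[(b2 + b1)%N]addnC //.
have um : uniq (map -%R t1) by rewrite map_inj_uniq //; apply: oppr_inj.
rewrite !map_cat /= !rev_cat !rev_cons !cat_rcons.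
rewrite mulrCA [X in _ = X + _]mulrCA -mulrDr; congr (_ * _).
have := amplitude_exchangeable (x - lam) um
  (s1 := rev [seq (- d.1, d.2) | d <- s2]) (s2 := rev [seq (- d.1, d.2) | d <- s1])
  (y1 := - y2) (y2 := - y1) (b1 := b2) (b2 := b1).
have -> : - y2 - - y1 = y1 - y2 by ring.
apply; have mapD (s : seq (K * bool)) : all (fun c => [pred y | y \notin t1] c.1) s ->
   all (fun c : K * bool => c.1 \notin map -%R t1) (rev [seq (- d.1, d.2) | d <- s]).
  rewrite all_rev all_map; apply: sub_all => d /=.
  by rewrite mem_map //; apply: oppr_inj.
move: aD; rewrite !all_cat /= !(mem_map (@oppr_inj _)) => /and4P[h1 h2 h3 h4].
by rewrite h2 h3 !mapD.
Qed.

Section Letters.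
Implicit Types a : seq (bool * bool).

Definition both (d : bool * bool) := d.1 && d.2.

(** The sizes p and q of the two sets, and the size r of their intersection,
    determine the number of letters of each kind. *)
Lemma count_letters a :
  [/\ count_mem (true, true) a = count both a,
      (count_mem (true, false) a + count both a)%N = count fst a,
      (count_mem (false, true) a + count both a)%N = count snd a
    & (count_mem (false, false) a + count fst a + count snd a
       = size a + count both a)%N].
Proof.
elim: a => // [[x y] a [h1 h2 h3 h4]] /=.
rewrite /both /= in h1 h2 h3 h4 *.
by case: x y => [] []; split=> /=; lia.
Qed.

Lemma perm_eq_letters a a' : size a = size a' -> count fst a = count fst a' ->
  count snd a = count snd a' -> count both a = count both a' -> perm_eq a a'.
Proof.
move=> h0 h1 h2 h3.
have [a1 a2 a3 a4] := count_letters a; have [b1 b2 b3 b4] := count_letters a'.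
rewrite /= in a1 a2 a3 a4 b1 b2 b3 b4.
by apply/allP => -[[] []] _; apply/eqP => /=; lia.
Qed.

Lemma multiplicity_letters a : multiplicity a =
  ((size a + count both a - (count fst a + count snd a))`!
   * (count snd a - count both a)`! * (count fst a - count both a)`!
   * (count both a)`!)%N.
Proof.
have [a1 a2 a3 a4] := count_letters a.
rewrite /multiplicity -(pair_bigA _ (fun x y => (count_mem (x, y) a)`!)) /=.
rewrite /= in a1 a2 a3 a4; rewrite !big_bool /= a1.
have -> : count_mem (true, false) a = (count fst a - count both a)%N by move=> /=; lia.
have -> : count_mem (false, true) a = (count snd a - count both a)%N by move=> /=; lia.
have -> : count_mem (false, false) a
  = (size a + count both a - (count fst a + count snd a))%N by move=> /=; lia.
by rewrite [RHS](ACl (4*3*2*1))%AC /= mulnA.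
Qed.

Lemma prod_letters (A : pzRingType) (m : bool * bool -> A) a :
  (forall d d', m d * m d' = m d' * m d) ->
  \prod_(d <- a) m d = m (false, false) ^+ count_mem (false, false) a
    * m (false, true) ^+ count_mem (false, true) a
    * m (true, false) ^+ count_mem (true, false) a
    * m (true, true) ^+ count_mem (true, true) a.
Proof.
move=> mC.
have comm d d' k : m d * m d' ^+ k = m d' ^+ k * m d by apply: commrX; apply: mC.
elim: a => [|d a IH]; first by rewrite big_nil !mulr1.
rewrite big_cons IH /= !exprD.
set F := m _ ^+ _; set G := m (false, true) ^+ _; set H := m (true, false) ^+ _.
have cF : m d * F = F * m d by apply: comm.
have cG : m d * G = G * m d by apply: comm.
have cH : m d * H = H * m d by apply: comm.
clearbody F G H; case: d cF cG cH => [] [] [] /= cF cG cH; rewrite !mul1r.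
- by rewrite !mulrA cF -(mulrA F) cG (mulrA F) -(mulrA (F * G)) cH !mulrA.
- by rewrite !mulrA cF -(mulrA F) cG !mulrA.
- by rewrite !mulrA cF.
- by rewrite !mulrA.
Qed.

End Letters.

(** * The three blocks of sites *)

Lemma prod_enum_ord (A : pzRingType) n (F : 'I_n -> A) :
  \prod_(i < n) F i = \prod_(i <- enum 'I_n) F i.
Proof. by rewrite enumT unlock; congr foldr; rewrite unlock. Qed.

Lemma map_rev_ord n : map (@rev_ord n) (enum 'I_n) = rev (enum 'I_n).
Proof.
apply: (inj_map val_inj); rewrite map_rev val_enum_ord -map_comp.
rewrite (eq_map (g := (fun k => n - k.+1)%N \o val)) // map_comp val_enum_ord.
apply: (eq_from_nth (x0 := 0%N)); first by rewrite size_map size_rev.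
move=> k; rewrite size_map size_iota => kn.
rewrite (nth_map 0%N) ?size_iota // nth_rev ?size_iota // !nth_iota ?add0n //; lia.
Qed.

Section TensorBlocks.
Variables (K : fieldType) (V : lmodType K) (m : nat) (t : 'I_m -> K).

Lemma action_Tproduct (e : gl_module 4 V) (x : K) k (pos : 'I_k -> 'I_m) (tt : k.-tuple K) :
  (forall i, t (pos i) = tnth tt i) -> (forall i, tnth tt i != x) ->
  action (Tproduct (eval_module e x) pos tt) = T_block t e x (map pos (enum 'I_k)).
Proof.
move=> tE tx; rewrite action_prod prod_enum_ord /T_block [RHS]big_map.
by apply: eq_bigr => i _; rewrite action_T // /Tx tE.
Qed.

Lemma action_Rproduct k l (pos1 : 'I_k -> 'I_m) (pos2 : 'I_l -> 'I_m)
    (tt : k.-tuple K) (ss : l.-tuple K) :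
  (forall i, t (pos1 i) = tnth tt i) -> (forall i, t (pos2 i) = tnth ss i) ->
  (forall i j, pos1 i != pos2 j) ->
  action (Rproduct V 4 pos1 pos2 tt ss)
  = R_block V 4 t (map pos1 (enum 'I_k)) (map pos2 (enum 'I_l)).
Proof.
move=> tE sE d; rewrite action_prod prod_enum_ord /R_block [RHS]big_map.
apply: eq_bigr => i _; rewrite action_prod prod_enum_ord -map_rev [RHS]big_map.
rewrite -map_rev_ord [RHS]big_map; apply: eq_bigr => j _.
by rewrite action_R // /Rx tE sE.
Qed.

End TensorBlocks.

Section Blocks.
Variables (K : numFieldType) (xi1 xi2 xi3 : nat).
Variables (t1 : xi1.-tuple K) (t2 : xi2.-tuple K) (t3 : xi3.-tuple K).
Local Notation N := (xi1 + xi2 + xi3)%N.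

Definition parameter (p : 'I_N) : K :=
  match split p with
  | inl a => match split a with inl i => tnth t1 i | inr j => tnth t2 j end
  | inr k => tnth t3 k
  end.

Definition block1 := map (@group1 xi1 xi2 xi3) (enum 'I_xi1).
Definition block2 := map (@group2 xi1 xi2 xi3) (enum 'I_xi2).
Definition block3 := map (@group3 xi1 xi2 xi3) (enum 'I_xi3).

Lemma parameter1 i : parameter (group1 xi2 xi3 i) = tnth t1 i.
Proof. by rewrite /parameter /group1 (unsplitK (inl _)) (unsplitK (inl _)). Qed.
Lemma parameter2 i : parameter (group2 xi1 xi3 i) = tnth t2 i.
Proof. by rewrite /parameter /group2 (unsplitK (inl _)) (unsplitK (inr _)). Qed.
Lemma parameter3 i : parameter (group3 xi1 xi2 i) = tnth t3 i.
Proof. by rewrite /parameter /group3 (unsplitK (inr _)). Qed.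

Lemma map_parameter1 : map parameter block1 = t1.
Proof. by rewrite -map_comp (eq_map parameter1) map_tnth_enum. Qed.
Lemma map_parameter2 : map parameter block2 = t2.
Proof. by rewrite -map_comp (eq_map parameter2) map_tnth_enum. Qed.
Lemma map_parameter3 : map parameter block3 = t3.
Proof. by rewrite -map_comp (eq_map parameter3) map_tnth_enum. Qed.

Lemma size_block1 : size block1 = xi1. Proof. by rewrite size_map size_enum_ord. Qed.
Lemma size_block2 : size block2 = xi2. Proof. by rewrite size_map size_enum_ord. Qed.
Lemma size_block3 : size block3 = xi3. Proof. by rewrite size_map size_enum_ord. Qed.

Lemma val_blocks : map val (block1 ++ block2 ++ block3) = iota 0 N.
Proof.
transitivity (iota 0 xi1 ++ (iota xi1 xi2 ++ iota (xi1 + xi2) xi3)); last first.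
  by rewrite -addnA !iotaD !add0n.
have shiftE a n : iota a n = map (addn a) (map val (enum 'I_n)).
  by rewrite val_enum_ord -iotaDl addn0.
rewrite !map_cat (shiftE 0%N) (shiftE xi1) (shiftE (xi1 + xi2)%N).
by rewrite /block1 /block2 /block3 -!map_comp; congr (_ ++ (_ ++ _)); apply: eq_map.
Qed.

Lemma blocks_uniq : uniq (block1 ++ block2 ++ block3).
Proof. by rewrite -(map_inj_uniq val_inj) val_blocks iota_uniq. Qed.

Lemma blocks_cover p : p \in block1 ++ block2 ++ block3.
Proof. by rewrite -(mem_map val_inj) val_blocks mem_iota /=. Qed.

Lemma blockwise1 a1 a2 a3 : {in block1, forall p, blockwise xi1 xi2 xi3 a1 a2 a3 p = a1}.
Proof. by move=> _ /mapP[i _ ->]; rewrite ffunE /= ltn_ord. Qed.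
Lemma blockwise2 a1 a2 a3 : {in block2, forall p, blockwise xi1 xi2 xi3 a1 a2 a3 p = a2}.
Proof.
by move=> _ /mapP[i _ ->]; rewrite ffunE /= ltnNge leq_addr /= ltn_add2l ltn_ord.
Qed.
Lemma blockwise3 a1 a2 a3 : {in block3, forall p, blockwise xi1 xi2 xi3 a1 a2 a3 p = a3}.
Proof.
move=> _ /mapP[i _ ->]; rewrite ffunE /= ltnNge -addnA leq_addr /=.
by rewrite ltn_add2l ltnNge leq_addr.
Qed.

Section WeightFunction.
Variables (V : lmodType K) (e : gl_module 4 V) (x : K) (v : V).
Hypothesis gen : generic_weight x t1 t2 t3.

Lemma tnth_neq k (u : k.-tuple K) i : x \notin u -> tnth u i != x.
Proof. by apply: contraNneq => <-; apply: mem_tnth. Qed.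

Lemma parameter_neq p : parameter p != x.
Proof.
have [_ _ [x1 x2 x3]] := gen.
by rewrite /parameter; case: split => [a|k]; first case: split => [i|j];
  apply: tnth_neq.
Qed.

(** The entry of a matrix is its value on the column index, as an indicator
    function, at the row index. *)
Lemma weight_functionE :
  weight_function (eval_module e x) t1 t2 t3 v
  = (T_block parameter e x block1 * T_block parameter e x block2
     * T_block parameter e x block3
     * R_block V 4 parameter block3 block2 * R_block V 4 parameter block3 block1
     * R_block V 4 parameter block2 block1)
      (pure_tensor (indicator K (blockwise xi1 xi2 xi3 (lbl 2) (lbl 3) (lbl 4))) v)
      (blockwise xi1 xi2 xi3 (lbl 1) (lbl 2) (lbl 3)).
Proof.
have [_ _ [x1 x2 x3]] := gen.
have d12 i j : group2 xi1 xi3 i != group1 xi2 xi3 j.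
  by rewrite -val_eqE /= gtn_eqF // (leq_trans (ltn_ord j)) // leq_addr.
have d13 i j : group3 xi1 xi2 i != group1 xi2 xi3 j.
  by rewrite -val_eqE /= gtn_eqF // (leq_trans (ltn_ord j)) // -addnA leq_addr.
have d23 i j : group3 xi1 xi2 i != group2 xi1 xi3 j.
  by rewrite -val_eqE /= gtn_eqF // -addnA ltn_add2l (leq_trans (ltn_ord j)) // leq_addr.
rewrite /block1 /block2 /block3.
rewrite -(action_Tproduct e parameter1 (fun i => tnth_neq i x1)).
rewrite -(action_Tproduct e parameter2 (fun i => tnth_neq i x2)).
rewrite -(action_Tproduct e parameter3 (fun i => tnth_neq i x3)).
rewrite -(action_Rproduct V parameter3 parameter2 d23).
rewrite -(action_Rproduct V parameter3 parameter1 d13).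
rewrite -(action_Rproduct V parameter2 parameter1 d12).
rewrite -!actionM actionE /weight_function.
set row := blockwise _ _ _ _ _ _; set col := blockwise _ _ _ _ _ _.
have ptE w : pure_tensor (indicator K col) v w = (w == col)%:R *: v.
  by rewrite pure_tensorE ffunE.
rewrite (bigD1 col) //= ptE eqxx scale1r [X in _ + X]big1 ?addr0 // => w /negbTE wc.
by rewrite ptE wc scale0r linear0.
Qed.
End WeightFunction.
End Blocks.

(** * Sums over a class of words *)

Lemma amplitude_vanish (K : numFieldType) (c : K) zs s :
  (size zs < count snd s)%N -> amplitude c zs s = 0.
Proof.
elim: s zs => [|[y b] s IH] zs //=; case: b => /=; last exact: IH.
rewrite add1n ltnS => h; apply: big1_seq => z /= zzs.
by rewrite IH ?mulr0 // size_rem //; case: (zs) zzs h.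
Qed.

Lemma sum_fiber (V : nmodType) (T : finType) (Q : pred T) (c : T -> nat) a b (f : T -> V) :
  \sum_(a <= r < b) \sum_(w | Q w && (c w == r)) f w
  = \sum_(w | Q w && (a <= c w < b)%N) f w.
Proof.
rewrite (exchange_big_dep Q) /=; last by move=> r w _ /andP[].
rewrite [RHS]big_mkcondr; apply: eq_bigr => w Qw; rewrite Qw /=.
rewrite (eq_bigl (fun r => r == c w)) => [|r]; last by rewrite eq_sym.
by rewrite big_nat1_eq.
Qed.

Section Words.
Variables (m : nat) (i j : seq nat).

Definition word_of : seq (bool * bool) := zip (mask_of m i) (mask_of m j).

Lemma size_word_of : size word_of = m.
Proof. by rewrite size_zip !size_mask_of minnn. Qed.

Lemma count_word_of p q r : admissible m p q r i j ->
  [/\ count fst word_of = p, count snd word_of = q & count both word_of = r].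
Proof.
case=> <- <- /andP[si ai] /andP[sj aj] <-.
have sm : size (mask_of m i) = size (mask_of m j) by rewrite !size_mask_of.
split.
- rewrite -[in RHS](positions_mask si ai) size_positions -[in RHS](@unzip1_zip _ _ (mask_of m i) (mask_of m j)) ?sm //.
  by rewrite count_map; apply: eq_count.
- rewrite -[in RHS](positions_mask sj aj) size_positions -[in RHS](@unzip2_zip _ _ (mask_of m i) (mask_of m j)) ?sm //.
  by rewrite count_map; apply: eq_count.
have -> : word_of = [seq (l \in i, l \in j) | l <- iota 0 m].
  by rewrite /word_of /mask_of; elim: (iota 0 m) => //= l s ->.
rewrite count_map -[in RHS](positions_mask si ai) /positions count_filter size_mask_of.
apply: eq_in_count => l; rewrite mem_iota /= add0n => lm.
by rewrite /both /= (nth_map 0%N) ?size_iota // nth_iota // andbC.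
Qed.

End Words.

Section WordSums.
Variables (K : numFieldType) (lam2 lam3 x : K) (xi1 xi2 xi3 : nat).
Variables (t1 : xi1.-tuple K) (t2 : xi2.-tuple K) (t3 : xi3.-tuple K).
Hypothesis gen : generic t1 t2 t3.
Local Notation t := (parameter t1 t2 t3).
Local Notation sites := (block2 xi1 xi2 xi3).
Local Notation word := {ffun 'I_(xi1 + xi2 + xi3) -> bool * bool}.

Definition word_amplitude (w : word) : K :=
  amplitude (lam3 - x) t3 [seq (d.1, d.2.1) | d <- labelled t w sites]
  * dual_amplitude lam2 x t1 [seq (d.1, d.2.2) | d <- labelled t w (rev sites)].

Definition blank : word := [ffun=> (false, false)].

Lemma sites_uniq : uniq sites.
Proof. by have := blocks_uniq xi1 xi2 xi3; rewrite !cat_uniq => /and5P[]. Qed.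

(** [symmetrize_words] turns the symmetrization over t^2 into a sum over the
    rearrangements of the word that encodes the two sets of indices. *)
Lemma class_sum p q r i j : in_range xi1 xi2 xi3 p q r -> admissible xi2 p q r i j ->
  SymG lam2 lam3 x i j t1 t2 t3
  = ((xi3 - p)`! * (xi1 - q)`! * multiplicity (word_of xi2 i j))%N%:R
    * \sum_(w | rearranges blank sites (word_of xi2 i j) w) word_amplitude w.
Proof.
move=> rng adm; have [ut1 ut2 ut3 d32 d21] := gen.
have [si sj /andP[oi ai] /andP[oj aj] _] := adm.
have [px qx] : (p <= xi3)%N /\ (q <= xi1)%N.
  by case/and4P: rng; rewrite !leq_min => /andP[_ ?] /andP[_ ?].
rewrite SymG_amplitudes ?si ?sj // !natrM -[RHS]mulrA; congr (_ * _).
pose D : pred K := fun y => (y \notin tval t3) && (y \notin tval t1).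
pose F (s : seq (K * (bool * bool))) := amplitude (lam3 - x) t3 [seq (d.1, d.2.1) | d <- s].
pose G (s : seq (K * (bool * bool))) := dual_amplitude lam2 x t1 [seq (d.1, d.2.2) | d <- s].
have exF : exchangeable D F.
  apply: exchangeable_relabel; apply: (exchangeable_sub _ (amplitude_exchangeable (lam3 - x) ut3)).
  by move=> y /andP[].
have exG : exchangeable D G.
  apply: exchangeable_relabel; apply: (exchangeable_sub _ (dual_amplitude_exchangeable lam2 x ut1)).
  by move=> y /andP[].
have tI : {in sites &, injective t}.
  move=> a b /mapP[k _ ->] /mapP[l _ ->]; rewrite !parameter2 => /(tuple_uniqP _ ut2) -> //.
have aD : all D (map t sites).
  rewrite map_parameter2; apply/allP => y y2; apply/andP; split.
    apply/negP => /tnthP[a ya]; move: y2 => /tnthP[b yb].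
    by move: (d32 a b); rewrite -ya -yb eqxx.
  apply/negP => /tnthP[a ya]; move: y2 => /tnthP[b yb].
  by move: (d21 b a); rewrite -ya -yb eqxx.
have sz : size (word_of xi2 i j) = size sites by rewrite size_word_of size_block2.
apply/esym; apply: (etrans (symmetrize_words blank exF exG sites_uniq tI aD sz)).
rewrite -[in RHS](map_parameter2 t1 t2 t3) (sum_permutations_map _ tI sites_uniq).
apply: eq_big_seq => qs; rewrite mem_permutations => /perm_size sq.
congr (_ * _); rewrite /F /G.
have sq' : size (map t qs) = xi2 by rewrite size_map sq size_block2.
have zE (A B C : Type) (u : seq A) (b : seq B) (b' : seq C) : size b = size b' ->
   [seq (d.1, d.2.1) | d <- zip u (zip b b')] = zip u b
   /\ [seq (d.1, d.2.2) | d <- zip u (zip b b')] = zip u b'.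
  elim: u b b' => [|a u IH] [|c b] [|c' b'] //= [] /IH[e1 e2].
  by rewrite e1 e2.
by have [-> ->] // := zE _ _ _ (map t qs) (mask_of xi2 i) (mask_of xi2 j) (etrans (size_mask_of _ _) (esym (size_mask_of _ _))).
Qed.

End WordSums.

(** * The formula for the weight function *)

Section WeightExpansion.
Variables (K : numFieldType) (V : lmodType K) (e : gl_module 4 V).
Variables (Lam : 'I_4 -> K) (v : V).
Hypothesis sing : singular e Lam v.
Variables (x : K) (xi1 xi2 xi3 : nat).
Variables (t1 : xi1.-tuple K) (t2 : xi2.-tuple K) (t3 : xi3.-tuple K).
Hypothesis gen : generic_weight x t1 t2 t3.
Local Notation t := (parameter t1 t2 t3).
Local Notation b1 := (block1 xi1 xi2 xi3).
Local Notation b2 := (block2 xi1 xi2 xi3).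
Local Notation b3 := (block3 xi1 xi2 xi3).
Local Notation word := {ffun 'I_(xi1 + xi2 + xi3) -> bool * bool}.
Local Notation bword := {ffun 'I_(xi1 + xi2 + xi3) -> bool}.
Local Notation lam2 := (Lam (lbl 2)).
Local Notation lam3 := (Lam (lbl 3)).

Lemma upper_amplitudeE (lam : bword) :
  upper_amplitude t x Lam b2 b3 lam
  = amplitude (lam3 - x) t3 [seq (t p, lam p) | p <- b2].
Proof.
have [[ut1 ut2 ut3 d32 d21] _ _] := gen.
rewrite /upper_amplitude /level3 mul1r.
have -> : [seq (spectral3 t q, true) | q <- rev b3] = rev [seq (z, true) | z <- t3].
  rewrite -(map_parameter3 t1 t2 t3) -map_comp -map_rev.
  by apply: eq_map => q; rewrite /spectral3 mul1r.
have -> : [seq (spectral3 t p, lam p) | p <- b2] = [seq (t p, lam p) | p <- b2].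
  by apply: eq_map => q; rewrite /spectral3 mul1r.
apply: partition_functionE => //; rewrite all_map; apply/allP => p /mapP[k _ ->] /=.
rewrite parameter2; apply/negP => /tnthP[l e23].
by move: (d32 l k); rewrite -e23 eqxx.
Qed.

Lemma lower_amplitudeE (kappa : bword) :
  lower_amplitude t x Lam b1 b2 kappa
  = dual_amplitude lam2 x t1 [seq (t p, kappa p) | p <- rev b2].
Proof.
have [[ut1 ut2 ut3 d32 d21] _ _] := gen.
rewrite /lower_amplitude /dual_amplitude /level1 mulN1r opprB.
congr (_ ^+ _ * _).
  by rewrite count_map count_rev; apply: eq_count.
have -> : [seq (spectral1 t q, true) | q <- rev b1] = rev [seq (z, true) | z <- map -%R t1].
  rewrite -(map_parameter1 t1 t2 t3); move: (block1 _ _ _) => b.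
  by rewrite -!map_comp -map_rev; apply: eq_map => q; rewrite /spectral1 /= mulN1r.
have -> : rev [seq (- d.1, d.2) | d <- [seq (t p, kappa p) | p <- rev b2]]
   = [seq (spectral1 t p, kappa p) | p <- b2].
  by rewrite -!map_rev revK -map_comp; apply: eq_map => q; rewrite /spectral1 /= mulN1r.
apply: partition_functionE; first by rewrite map_inj_uniq //; apply: oppr_inj.
rewrite all_map; apply/allP => p /mapP[k _ ->] /=.
rewrite /spectral1 /= mulN1r parameter2 mem_map; last exact: oppr_inj.
by apply/negP => /tnthP[l e21]; move: (d21 k l); rewrite -e21 eqxx.
Qed.

Definition first_letters (w : word) : bword := [ffun p => (w p).1].
Definition second_letters (w : word) : bword := [ffun p => (w p).2].

Lemma weight_expansion :
  weight_function (eval_module e x) t1 t2 t3 v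
  = (inverses t x b2 * inverses t x b3 * inverses t x b1) *:
    \sum_(w : word | [forall p, (p \notin b2) ==> (w p == blank xi1 xi2 xi3 p)])
       word_amplitude lam2 lam3 x t1 t2 t3 w
       *: monomial e v b1 b2 b3 (second_letters w) (first_letters w).
Proof.
have [[_ _ _ d32 d21] d31 _] := gen; have [[ut1 _ ut3 _ _] _ _] := gen.
rewrite weight_functionE //.
rewrite (nested_expansion sing (blocks_uniq xi1 xi2 xi3) (blocks_cover (xi3 := xi3))
  (parameter_neq gen)); first last.
- exact: blockwise3.
- exact: blockwise2.
- exact: blockwise1.
- exact: blockwise3.
- exact: blockwise2.
- exact: blockwise1.
- by move=> _ _ /mapP[k _ ->] /mapP[l _ ->]; rewrite parameter3 parameter2.
- by move=> _ _ /mapP[k _ ->] /mapP[l _ ->]; rewrite parameter3 parameter1.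
- by move=> _ _ /mapP[k _ ->] /mapP[l _ ->]; rewrite parameter2 parameter1.
congr (_ *: _); rewrite pair_big_dep /=.
rewrite (reindex (fun w : word => (first_letters w, second_letters w))) /=; last first.
  exists (fun ab : bword * bword => [ffun p => (ab.1 p, ab.2 p)]) => [w _|[a b] _].
    by apply/ffunP => p; rewrite !ffunE; case: (w p).
  by congr (_, _); apply/ffunP => p; rewrite !ffunE.
apply: eq_big => [w|w _].
  apply/andP/forallP => [[/forallP h1 /forallP h2] p|h].
    apply/implyP => pb; move: (h1 p) (h2 p); rewrite pb !ffunE /=.
    by case: (w p) => [] [] [].
  by split; apply/forallP => p; apply/implyP => pb; move: (h p); rewrite pb !ffunE /= => /eqP ->.
congr (_ *: _); rewrite /word_amplitude upper_amplitudeE lower_amplitudeE.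
rewrite /labelled -!map_comp; congr (amplitude _ _ _ * dual_amplitude _ _ _ _).
  by apply: eq_map => p; rewrite /= ffunE.
by apply: eq_map => p; rewrite /= ffunE.
Qed.

(** The letters 1, 2 and 3, 4 are disjoint: e31, e32, e41 and e42 span an
    abelian subalgebra. *)
Lemma up_down_comm (a b c d : bool) :
  e (upper_label a) (lower_label b) * e (upper_label c) (lower_label d) = e (upper_label c) (lower_label d) * e (upper_label a) (lower_label b).
Proof.
have ud (y z : bool) : (lower_label y == upper_label z) = false.
  by case: y; case: z; rewrite lbl_eq.
by rewrite gl_swap ud [upper_label a == _]eq_sym ud !mulr0n subr0 addr0.
Qed.

Lemma monomialE (w : word) p q r :
  count fst (map w b2) = p -> count snd (map w b2) = q -> count both (map w b2) = r ->
  monomial e v b1 b2 b3 (second_letters w) (first_letters w)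
  = (e (lbl 3) (lbl 2) ^+ (xi2 + r - (p + q)) * e (lbl 3) (lbl 1) ^+ (q - r)
      * e (lbl 4) (lbl 2) ^+ (p - r) * e (lbl 4) (lbl 1) ^+ r
      * e (lbl 2) (lbl 1) ^+ (xi1 - q) * e (lbl 4) (lbl 3) ^+ (xi3 - p) : endo V) v.
Proof.
move=> cp cq cr; rewrite /monomial size_block1 size_block3.
have -> : count (first_letters w) b2 = p.
  by rewrite -cp count_map; apply: eq_count => k; rewrite ffunE.
have -> : count (second_letters w) b2 = q.
  by rewrite -cq count_map; apply: eq_count => k; rewrite ffunE.
have -> : \prod_(k <- b2) e (upper_label (first_letters w k)) (lower_label (second_letters w k))
   = \prod_(d <- map w b2) e (upper_label d.1) (lower_label d.2).
  by rewrite big_map; apply: eq_bigr => k _; rewrite !ffunE.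
rewrite (prod_letters _ (m := fun d => e (upper_label d.1) (lower_label d.2))); last first.
  by move=> d d'; apply: up_down_comm.
have [a1 a2 a3 a4] := count_letters (map w b2).
rewrite size_map size_block2 cp cq cr in a1 a2 a3 a4.
have -> : count_mem (false, false) (map w b2) = (xi2 + r - (p + q))%N.
  by rewrite -[LHS](addnK (p + q)) addnA a4.
have -> : count_mem (false, true) (map w b2) = (q - r)%N by rewrite -a3 addnK.
have -> : count_mem (true, false) (map w b2) = (p - r)%N by rewrite -a2 addnK.
rewrite a1 /=.
rewrite -!endoME; congr ((_ : endo V) v); rewrite -!mulrA; do 4 congr (_ * _).
have c : GRing.comm (e (lbl 4) (lbl 3)) (e (lbl 2) (lbl 1)).
  by rewrite /GRing.comm gl_swap !lbl_eq // !mulr0n subr0 addr0.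
by apply: commrX; apply/commr_sym/commrX/commr_sym.
Qed.

(** There are only xi3 particles to be absorbed in X, and xi1 in Y: this
    bounds p and q in the formula. *)
Lemma word_amplitude_vanish (w : word) :
  (xi3 < count fst (map w b2))%N || (xi1 < count snd (map w b2))%N ->
  word_amplitude lam2 lam3 x t1 t2 t3 w = 0.
Proof.
have cnt (f : pred (bool * bool)) (s : seq 'I_(xi1 + xi2 + xi3)) :
    count snd [seq (d.1, f d.2) | d <- labelled t w s] = count f (map w s).
  by rewrite !count_map; apply: eq_count.
case/orP => h; rewrite /word_amplitude.
  by rewrite amplitude_vanish ?mul0r // cnt size_tuple.
rewrite [X in _ * X](_ : _ = 0) ?mulr0 // /dual_amplitude.
rewrite amplitude_vanish ?mulr0 // size_map size_tuple.
by rewrite count_rev count_map (eq_count (a2 := snd)) // cnt map_rev count_rev.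
Qed.

End WeightExpansion.

Theorem theorem5p7 (R : realType) (V : lmodType R[i]) (e : gl_module 4 V)
    (Lam : 'I_4 -> R[i]) (v : V) (Hv : singular e Lam v)
    (x : R[i]) (xi1 xi2 xi3 : nat) :
  (forall i j : nat -> nat -> nat -> seq nat,
   (forall p q r, in_range xi1 xi2 xi3 p q r ->
      admissible xi2 p q r (i p q r) (j p q r)) ->
   forall (t1 : xi1.-tuple R[i]) (t2 : xi2.-tuple R[i]) (t3 : xi3.-tuple R[i]),
   generic_weight x t1 t2 t3 ->
   weight_function (eval_module e x) t1 t2 t3 v =
   ((\prod_(y <- t1) (y - x)^-1) * (\prod_(y <- t2) (y - x)^-1)
     * (\prod_(y <- t3) (y - x)^-1)) *:
   \sum_(0 <= p < (minn xi2 xi3).+1)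
   \sum_(0 <= q < (minn xi2 xi1).+1)
   \sum_((p + q - xi2)%N <= r < (minn p q).+1)
     (SymG (Lam (lbl 2)) (Lam (lbl 3)) x (i p q r) (j p q r) t1 t2 t3
      / ((xi2 + r - (p + q))`! * (q - r)`! * (p - r)`! * r`!
         * (xi1 - q)`! * (xi3 - p)`!)%N%:R) *:
     (e (lbl 3) (lbl 2) ^+ (xi2 + r - (p + q))
      * e (lbl 3) (lbl 1) ^+ (q - r)
      * e (lbl 4) (lbl 2) ^+ (p - r)
      * e (lbl 4) (lbl 1) ^+ r
      * e (lbl 2) (lbl 1) ^+ (xi1 - q)
      * e (lbl 4) (lbl 3) ^+ (xi3 - p) : endo V) v)
  /\
  (forall p q r, in_range xi1 xi2 xi3 p q r ->
   forall i j i' j' : seq nat,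
   admissible xi2 p q r i j -> admissible xi2 p q r i' j' ->
   forall (t1 : xi1.-tuple R[i]) (t2 : xi2.-tuple R[i]) (t3 : xi3.-tuple R[i]),
   generic t1 t2 t3 ->
   SymG (Lam (lbl 2)) (Lam (lbl 3)) x i j t1 t2 t3
   = SymG (Lam (lbl 2)) (Lam (lbl 3)) x i' j' t1 t2 t3).
Proof.
split=> [i j adm t1 t2 t3 gen|p q r rng i j i' j' adm adm' t1 t2 t3 gen]; last first.
  rewrite (class_sum _ _ _ gen rng adm) (class_sum _ _ _ gen rng adm').
  have [f1 s1 c1] := count_word_of adm; have [f2 s2 c2] := count_word_of adm'.
  have pe : perm_eq (word_of xi2 i j) (word_of xi2 i' j').
    by apply: perm_eq_letters; rewrite ?size_word_of ?f1 ?s1 ?c1 ?f2 ?s2 ?c2.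
  rewrite !multiplicity_letters !size_word_of f1 s1 c1 f2 s2 c2; congr (_ * _).
  by apply: eq_bigl => w; rewrite /rearranges (permPr pe).
have [gen0 _ _] := gen.
rewrite (weight_expansion Hv gen); congr (_ *: _).
  have inv s : inverses (parameter t1 t2 t3) x s
      = \prod_(y <- map (parameter t1 t2 t3) s) (y - x)^-1 by rewrite [RHS]big_map.
  by rewrite !inv map_parameter1 map_parameter2 map_parameter3 mulrC mulrA.
pose b2 := block2 xi1 xi2 xi3.
pose supp (w : {ffun 'I_(xi1 + xi2 + xi3) -> bool * bool}) :=
  [forall p, (p \notin b2) ==> (w p == blank xi1 xi2 xi3 p)].
pose cp (w : {ffun 'I_(xi1 + xi2 + xi3) -> bool * bool}) := count fst (map w b2).
pose cq (w : {ffun 'I_(xi1 + xi2 + xi3) -> bool * bool}) := count snd (map w b2).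
pose cr (w : {ffun 'I_(xi1 + xi2 + xi3) -> bool * bool}) := count both (map w b2).
pose f w := word_amplitude (Lam (lbl 2)) (Lam (lbl 3)) x t1 t2 t3 w
  *: monomial e v (block1 xi1 xi2 xi3) b2 (block3 xi1 xi2 xi3) (second_letters w) (first_letters w).
have term p q r : in_range xi1 xi2 xi3 p q r ->
   (SymG (Lam (lbl 2)) (Lam (lbl 3)) x (i p q r) (j p q r) t1 t2 t3
      / ((xi2 + r - (p + q))`! * (q - r)`! * (p - r)`! * r`!
         * (xi1 - q)`! * (xi3 - p)`!)%N%:R) *:
     (e (lbl 3) (lbl 2) ^+ (xi2 + r - (p + q))
      * e (lbl 3) (lbl 1) ^+ (q - r)
      * e (lbl 4) (lbl 2) ^+ (p - r)
      * e (lbl 4) (lbl 1) ^+ r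
      * e (lbl 2) (lbl 1) ^+ (xi1 - q)
      * e (lbl 4) (lbl 3) ^+ (xi3 - p) : endo V) v
   = \sum_(w | [&& supp w, cp w == p & cq w == q] && (cr w == r)) f w.
  move=> rng; have ad := adm p q r rng.
  have [f1 s1 c1] := count_word_of ad.
  (* The class of words attached to (p, q, r) is the set of rearrangements of
     the word of any admissible pair. *)
  have eqw w : rearranges (blank xi1 xi2 xi3) b2 (word_of xi2 (i p q r) (j p q r)) w
      = [&& supp w, cp w == p & cq w == q] && (cr w == r).
    rewrite /rearranges -!andbA; congr (_ && _); apply/idP/and3P => [pe|[/eqP e1 /eqP e2 /eqP e3]].
      have ct := seq.permP pe; by rewrite /cp /cq /cr !ct f1 s1 c1 !eqxx.
    apply: perm_eq_letters; rewrite ?f1 ?s1 ?c1 //.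
    by rewrite size_map size_block2 size_word_of.
  rewrite (class_sum _ _ _ gen0 rng ad) multiplicity_letters size_word_of f1 s1 c1.
  set n1 := (_ * _ * _)%N; set n2 := (_ * _ * _ * _ * _ * _)%N.
  (* The multiplicity of the word provides the first four factorials, the
     unused particles the last two. *)
  have n12 : n1 = n2 by rewrite /n1 /n2; lia.
  rewrite n12 [_%:R * _]mulrC mulfK; last first.
    by rewrite pnatr_eq0 -lt0n !muln_gt0 !fact_gt0.
  rewrite scaler_suml (eq_bigl _ _ eqw); apply: eq_bigr => w.
  move=> /andP[/and3P[_ /eqP e1 /eqP e2] /eqP e3].
  by rewrite /f (monomialE e v e1 e2 e3).
(* The sums over r, q and p are removed one after the other; the bounds on r
   hold for every word, and the words outside the bounds on p and q have
   amplitude 0. *)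
transitivity (\sum_(0 <= p < (minn xi2 xi3).+1) \sum_(0 <= q < (minn xi2 xi1).+1)
   \sum_(w | [&& supp w, cp w == p & cq w == q]) f w); last first.
  apply: eq_big_nat => p /andP[_ hp]; apply: eq_big_nat => q /andP[_ hq].
  transitivity (\sum_((p + q - xi2)%N <= r < (minn p q).+1)
     \sum_(w | [&& supp w, cp w == p & cq w == q] && (cr w == r)) f w); last first.
    apply: eq_big_nat => r /andP[h1 h2]; apply/esym/term.
    by rewrite /in_range; apply/and4P.
  rewrite (sum_fiber (fun w => [&& supp w, cp w == p & cq w == q])).
  apply: eq_bigl => w; apply/esym/andb_idr => /and3P[_ /eqP <- /eqP <-].
  have [a1 a2 a3 a4] := count_letters (map w b2).
  rewrite size_map size_block2 -/(cp w) -/(cq w) -/(cr w) /= in a1 a2 a3 a4.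
  by rewrite ltnS leq_min; apply/and3P; split; lia.
transitivity (\sum_(0 <= p < (minn xi2 xi3).+1)
   \sum_(w | (supp w && (cp w == p)) && (0 <= cq w < (minn xi2 xi1).+1)%N) f w); last first.
  apply: eq_bigr => p _; rewrite -sum_fiber; apply: eq_bigr => q _.
  by apply: eq_bigl => w; rewrite -andbA.
transitivity (\sum_(0 <= p < (minn xi2 xi3).+1)
   \sum_(w | (supp w && (0 <= cq w < (minn xi2 xi1).+1)%N) && (cp w == p)) f w); last first.
  by apply: eq_bigr => p _; apply: eq_bigl => w; rewrite andbAC.
rewrite sum_fiber [LHS](bigID (fun w => (0 <= cq w < (minn xi2 xi1).+1)%N
   && (0 <= cp w < (minn xi2 xi3).+1)%N)) /= [X in _ + X]big1 ?addr0; last first.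
  move=> w /andP[_]; have bnd (h : pred (bool * bool)) : (count h (map w b2) <= xi2)%N.
    by apply: leq_trans (count_size _ _) _; rewrite size_map size_block2.
  rewrite negb_and !ltnS !leq_min /cp /cq !bnd /= -!ltnNge orbC => h.
  by rewrite /f word_amplitude_vanish ?scale0r.
by apply: eq_bigl => w; rewrite andbA.
Qed.
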